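(* Suppose that $1\le p<\infty$ and let $\mathcal I=\mathcal{QN}_p$ or $\mathcal I=\mathcal{SK}_p$. Then $$\mathrm{index}(\mathfrak A_X^{\mathcal I})\le\max\{2,\lceil p/2\rceil\}$$ for any Banach space $X$.
   Context: All Banach spaces are over the same scalar field $\mathbb K=\mathbb R$ or $\mathbb C$. $\mathcal L(X,Y)$ denotes the bounded linear operators $X\to Y$, $\mathcal F(X,Y)$ the bounded finite-rank operators, and $\mathcal F(X)=\mathcal F(X,X)$, etc. $B_X$ is the closed unit ball of $X$, and $p'$ is the conjugate exponent of $p$. Let $1\le p<\infty$. For a Banach space $E$, $\ell^p_s(E)$ is the space of strongly $p$-summable sequences $(x_k)\subset E$, i.e. $\|(x_k)\|_p=(\sum_k\|x_k\|^p)^{1/p}<\infty$. Quasi $p$-nuclear operators: $T\in\mathcal{QN}_p(X,Y)$ if $T\in\mathcal L(X,Y)$ and there is $(x_k^* )\in\ell^p_s(X^* )$ with $\|Tx\|\le(\sum_{k=1}^\infty|x_k^*(x)|^p)^{1/p}$ for all $x\in X$; $\|T\|_{\mathcal{QN}_p}$ is the infimum of $\|(x_k^* )\|_p$ over all such sequences. Sinha-Karn $p$-compact operators: $T\in\mathcal{SK}_p(X,Y)$ if $T\in\mathcal L(X,Y)$ and there is $(y_k)\in\ell^p_s(Y)$ with $T(B_X)\subset\{\sum_{k=1}^\infty\lambda_ky_k\mid(\lambda_k)\in B_{\ell^{p'}}\}$ (with $(\lambda_k)\in B_{c_0}$ if $p=1$); $\|T\|_{\mathcal{SK}_p}$ is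 the infimum of $\|(y_k)\|_p$ over all such sequences. Both are Banach operator ideals (complete normed operator ideals in the sense of Pietsch). For $\mathcal I=\mathcal{QN}_p$ or $\mathcal{SK}_p$, write $\mathcal I(X)=\mathcal I(X,X)$ and $\mathfrak A_X^{\mathcal I}=\mathcal I(X)/\overline{\mathcal F(X)}^{\|\cdot\|_{\mathcal I}}$, a Banach algebra under composition with the quotient norm, where the closure is taken in $(\mathcal I(X),\|\cdot\|_{\mathcal I})$. An algebra $A$ is nilpotent if there is $n\in\mathbb N=\{1,2,\dots\}$ with $a_1\cdots a_n=0$ for all $a_1,\dots,a_n\in A$; the smallest such $n$ is $\mathrm{index}(A)$. The asserted bound includes the assertion that $\mathfrak A_X^{\mathcal I}$ is nilpotent. For real $x>0$, $\lceil x\rceil=\min\{n\in\mathbb N\mid n\ge x\}$. *)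

(* Defs.v *)
From HB Require Import structures.
From mathcomp Require Import all_boot all_order all_algebra.
From mathcomp Require Import generic_quotient ring_quotient.
From mathcomp Require Import complex.
From mathcomp Require Import all_classical all_reals all_analysis.

Set Implicit Arguments.
Unset Strict Implicit.
Unset Printing Implicit Defensive.

Import Order.TTheory GRing.Theory Num.Theory.
Import numFieldNormedType.Exports.

Local Open Scope classical_set_scope.
Local Open Scope ring_scope.

(* The scalars are the real field or the complex field.  The norm of a normed
   space over [scalar_field R k] takes values in the scalars; [scalar_re] brings
   these nonnegative scalars back to [R]. *)
Inductive scalar_kind := RealScalars | ComplexScalars.

Definition scalar_field (R : realType) (k : scalar_kind) : numFieldType :=
  match k with RealScalars => R | ComplexScalars => R[i] end.

Definition scalar_re (R : realType) (k : scalar_kind) : scalar_field R k -> R :=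
  match k with RealScalars => id | ComplexScalars => @complex.Re R end.

Definition rnorm (R : realType) (k : scalar_kind)
  (X : normedModType (scalar_field R k)) (x : X) : R := scalar_re `|x|.

Section operators.
Context {R : realType} {k : scalar_kind}.
Local Notation K := (scalar_field R k).

Definition bounded_op (X Y : normedModType K) (T : X -> Y) : Prop :=
  linear T /\ exists M : R, forall x, rnorm (T x) <= M * rnorm x.

Definition finite_rank (X Y : normedModType K) (T : X -> Y) : Prop :=
  bounded_op T /\ exists (n : nat) (e : 'I_n -> Y),
    forall x, exists c : 'I_n -> K, T x = \sum_(i < n) c i *: e i.

Definition unit_ball (X : normedModType K) : set X := [set x | rnorm x <= 1].

Definition op_norm (X Y : normedModType K) (T : X -> Y) : \bar R :=
  ereal_sup [set (rnorm (T x))%:E | x in @unit_ball X].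

End operators.

Arguments unit_ball {R k} X.

Definition lp_norm (R : realType) (p : R) (u : nat -> \bar R) : \bar R :=
  ((\sum_(0 <= n <oo) u n `^ p) `^ p^-1)%E.

Section ideal_definitions.
Context {R : realType} {k : scalar_kind}.
Local Notation K := (scalar_field R k).
Implicit Types (X Y : normedModType K) (p : R).

(* Functionals are maps [X -> K^o]: [K^o] is the scalar field seen as a normed
   space over itself. *)
Definition qn_seq X Y p (T : X -> Y) (f : nat -> X -> K^o) : Prop :=
  [/\ forall n, bounded_op (f n),
      (lp_norm p (fun n => op_norm (f n)) < +oo)%E &
      forall x, ((rnorm (T x))%:E <= lp_norm p (fun n => (rnorm (f n x))%:E))%E].

Definition QN X Y p : set (X -> Y) :=
  [set T | bounded_op T /\ exists f, qn_seq p T f].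

(* The infimum is taken in the extended reals: it is [+oo] when there is no
   admissible sequence. *)
Definition qn_norm X Y p (T : X -> Y) : \bar R :=
  ereal_inf [set lp_norm p (fun n => op_norm (f n)) | f in qn_seq p T].

Definition conj_exp p : R := p / (p - 1).

(* The closed unit ball of l^p', replaced by that of c_0 when p = 1. *)
Definition sk_coef p : set (nat -> K^o) :=
  if p == 1 then [set l | l @ \oo --> (0 : K^o) /\ forall n, rnorm (l n) <= 1]
  else [set l | (lp_norm (conj_exp p) (fun n => (rnorm (l n))%:E) <= 1)%E].

Definition p_hull Y p (y : nat -> Y) : set Y :=
  [set z | exists2 l, sk_coef p l &
             series (fun n => (l n : K) *: y n) @ \oo --> z].

Definition sk_seq X Y p (T : X -> Y) (y : nat -> Y) : Prop :=
  (lp_norm p (fun n => (rnorm (y n))%:E) < +oo)%E /\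
  T @` unit_ball X `<=` p_hull p y.

Definition SK X Y p : set (X -> Y) :=
  [set T | bounded_op T /\ exists y, sk_seq p T y].

Definition sk_norm X Y p (T : X -> Y) : \bar R :=
  ereal_inf [set lp_norm p (fun n => (rnorm (y n))%:E) | y in sk_seq p T].

End ideal_definitions.

Definition interleave (E : Type) (u v : nat -> E) (n : nat) : E :=
  if odd n then v n./2 else u n./2.

Section scalar_theory.
Context {R : realType} {k : scalar_kind}.
Local Notation K := (scalar_field R k).
Implicit Types (X Y : normedModType K).

Lemma scalar_re_le (a b : K) : a <= b -> scalar_re a <= scalar_re b.
Proof. by case: k a b => //= a b; rewrite lecE => /andP[]. Qed.

Lemma scalar_reD (a b : K) : scalar_re (a + b) = scalar_re a + scalar_re b.
Proof. by case: k a b => //= -[a a'] [b b']. Qed.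

Lemma scalar_reM (a b : K) : 0 <= a -> 0 <= b ->
  scalar_re (a * b) = scalar_re a * scalar_re b.
Proof.
case: k a b => //= -[a a'] [b b']; rewrite !lecE /= => /andP[/eqP-> _] /andP[/eqP-> _].
by rewrite mul0r subr0.
Qed.

Lemma scalar_re_nat n : scalar_re (n%:R : K) = n%:R.
Proof.
elim: n => [|n IHn]; first by case: k.
by rewrite -!natr1 scalar_reD IHn; congr (_ + _); case: k.
Qed.

Lemma scalar_re_inj_le (a b : K) : 0 <= a -> 0 <= b ->
  scalar_re a <= scalar_re b -> a <= b.
Proof.
case: k a b => //= -[a a'] [b b']; rewrite !lecE /= => /andP[/eqP-> _] /andP[/eqP-> _] ->.
by rewrite eqxx.
Qed.

Lemma scalar_re_surj (r : R) : 0 < r -> exists2 m : K, 0 < m & scalar_re m = r.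
Proof.
move=> r0; case: k => /=; first by exists r.
by exists (r%:C)%C => //; rewrite ltcE /= eqxx.
Qed.

Lemma scalar_re0 : scalar_re (0 : K) = 0.
Proof. exact: (scalar_re_nat 0). Qed.

Lemma scalar_re_ge0 (a : K) : 0 <= a -> 0 <= scalar_re a.
Proof. by move=> a0; rewrite -scalar_re0; exact: scalar_re_le. Qed.

Lemma rnorm_ge0 X (x : X) : 0 <= rnorm x.
Proof. exact: scalar_re_ge0. Qed.

Lemma rnorm0 X : rnorm (0 : X) = 0.
Proof. by rewrite /rnorm normr0 scalar_re0. Qed.

Lemma rnormD X (x y : X) : rnorm (x + y) <= rnorm x + rnorm y.
Proof. by rewrite -scalar_reD; apply/scalar_re_le/ler_normD. Qed.

Lemma rnormZ X (a : K) (x : X) : rnorm (a *: x) = scalar_re `|a| * rnorm x.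
Proof. by rewrite /rnorm normrZ scalar_reM. Qed.

Lemma bounded_op_gt0 X Y (T : X -> Y) : bounded_op T ->
  exists2 m : K, 0 < m & forall x, rnorm (T x) <= scalar_re m * rnorm x.
Proof.
move=> [_ [M TM]].
have [m m0 mM] : exists2 m : K, 0 < m & scalar_re m = `|M| + 1.
  by apply: scalar_re_surj; rewrite ltr_wpDl.
exists m => // x; rewrite mM (le_trans (TM x))// ler_wpM2r ?rnorm_ge0//.
by rewrite (le_trans (ler_norm M))// lerDl.
Qed.

Lemma bounded_op0 X Y : bounded_op (0 : X -> Y).
Proof.
split=> [a u v|]; first by rewrite /= scaler0 addr0.
by exists 0 => x; rewrite mul0r rnorm0.
Qed.

Lemma bounded_opD X Y (S T : X -> Y) :
  bounded_op S -> bounded_op T -> bounded_op (S + T).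
Proof.
move=> [lS [M SM]] [lT [N TN]]; split=> [a u v|].
  by rewrite !fctE lS lT scalerDr addrACA.
exists (M + N) => x; rewrite fctE (le_trans (rnormD _ _))// mulrDl.
exact: lerD.
Qed.

Lemma bounded_opZ X (a : K) : bounded_op (fun x : X => a *: x).
Proof.
split=> [b u v|]; first by rewrite scalerDr !scalerA mulrC.
by exists (scalar_re `|a|) => x; rewrite rnormZ.
Qed.

Lemma bounded_op_comp X Y (Z : normedModType K) (S : Y -> Z) (T : X -> Y) :
  bounded_op S -> bounded_op T -> bounded_op (S \o T).
Proof.
move=> bS bT; have [m m0 Sm] := bounded_op_gt0 bS.
case: bS bT => [lS _] [lT [N TN]]; split=> [a u v|] /=; first by rewrite lT lS.
exists (scalar_re m * N) => x; rewrite (le_trans (Sm _))// -mulrA ler_wpM2l//.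
by rewrite scalar_re_ge0// ltW.
Qed.

Lemma bounded_opE X Y (T : X -> Y) : bounded_op T ->
  exists L : {linear X -> Y}, T = L.
Proof.
move=> [lT _].
pose L := HB.pack_for {linear X -> Y} T (GRing.isLinear.Build _ _ _ _ T lT).
by exists L.
Qed.

Lemma bounded_op_continuous X Y (T : X -> Y) : bounded_op T -> continuous T.
Proof.
move=> bT; have [m m0 Tm] := bounded_op_gt0 bT.
have [L TL] := bounded_opE bT; rewrite TL in Tm *.
apply: bounded_linear_continuous; apply/linear_boundedP.
near=> r => x; apply: (@le_trans _ _ (m * `|x|)).
  apply: scalar_re_inj_le => //; first by rewrite mulr_ge0// ltW.
  by rewrite scalar_reM ?(ltW m0)//; apply: Tm.
rewrite ler_wpM2r//; near: r; apply: nbhs_pinfty_ge.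
exact: gtr0_real.
Unshelve. all: by end_near. Qed.

Lemma op_norm_ge0 X Y (T : X -> Y) : (0 <= op_norm T)%E.
Proof.
apply: (@le_trans _ _ (rnorm (T 0))%:E); first by rewrite lee_fin rnorm_ge0.
by apply: ereal_sup_ubound; exists 0 => //; rewrite /unit_ball/= rnorm0.
Qed.

Lemma op_normZ X Y (a : K) (T : X -> Y) :
  (op_norm (a *: T)%R <= (scalar_re `|a|)%:E * op_norm T)%E.
Proof.
apply: ge_ereal_sup => _ [x x1 <-]; rewrite rnormZ EFinM lee_wpmul2l//.
  by rewrite lee_fin scalar_re_ge0.
by apply: ereal_sup_ubound; exists x.
Qed.

Lemma op_norm_comp X Y (Z : normedModType K) (m : K) (T : Y -> Z) (B : X -> Y) :
  0 < m -> linear T -> (forall x, rnorm (B x) <= scalar_re m * rnorm x) ->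
  (op_norm (T \o B) <= (scalar_re m)%:E * op_norm T)%E.
Proof.
move=> m0 lT Bm; apply: ge_ereal_sup => _ [x x1 <-] /=.
have m0' : 0 <= scalar_re m by rewrite scalar_re_ge0// ltW.
have mV : scalar_re m^-1 * scalar_re m = 1.
  by rewrite -scalar_reM ?invr_ge0 ?(ltW m0)// mulVf ?gt_eqF// (scalar_re_nat 1).
have -> : T (B x) = m *: T (m^-1 *: B x).
  have := lT m (m^-1 *: B x) 0; rewrite addr0 scalerA divff ?gt_eqF// scale1r => ->.
  by have := lT (-1) 0 0; rewrite scaler0 add0r scaleN1r addNr => ->; rewrite addr0.
rewrite rnormZ gtr0_norm// EFinM lee_wpmul2l//; apply: ereal_sup_ubound.
exists (m^-1 *: B x) => //; rewrite /unit_ball/= rnormZ gtr0_norm ?invr_gt0//.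
rewrite -mV ler_wpM2l//.
  by rewrite scalar_re_ge0// invr_ge0 ltW.
by rewrite (le_trans (Bm x))// ler_piMr.
Qed.

Lemma finite_rank0 X : finite_rank (0 : X -> X).
Proof.
split; first exact: bounded_op0.
by exists 0%N, (fun=> 0) => x; exists (fun=> 0); rewrite big_ord0.
Qed.

Lemma finite_rankD X (S T : X -> X) :
  finite_rank S -> finite_rank T -> finite_rank (S + T).
Proof.
move=> [bS [n [e Se]]] [bT [m [f Tf]]]; split; first exact: bounded_opD.
exists (n + m)%N, (fun i : 'I_(n + m) => match fintype.split i with inl j => e j | inr j => f j end) => x.
have [c Sx] := Se x; have [d Tx] := Tf x.
exists (fun i : 'I_(n + m) => match fintype.split i with inl j => c j | inr j => d j end).
rewrite fctE Sx Tx big_split_ord /=; congr (_ + _); apply: eq_bigr => i _.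
  by rewrite -[lshift m i]/(unsplit (inl i)) unsplitK.
by rewrite -[rshift n i]/(unsplit (inr i)) unsplitK.
Qed.

Lemma finite_rank_compl X (A T : X -> X) :
  bounded_op A -> finite_rank T -> finite_rank (A \o T).
Proof.
move=> bA [bT [n [e Te]]]; split; first exact: bounded_op_comp.
exists n, (A \o e) => x; have [c Tx] := Te x; exists c => /=.
have [L ->] := bounded_opE bA.
by rewrite Tx linear_sum; apply: eq_bigr => i _; rewrite linearZ.
Qed.

Lemma finite_rank_compr X (T B : X -> X) :
  finite_rank T -> bounded_op B -> finite_rank (T \o B).
Proof.
move=> [bT [n [e Te]]] bB; split; first exact: bounded_op_comp.
by exists n, e => x; exact: Te.
Qed.

End scalar_theory.

Section interleave_theory.

Lemma sum_interleave (V : nmodType) (u v : nat -> V) n :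
  \sum_(0 <= i < n) interleave u v i =
  \sum_(0 <= i < uphalf n) u i + \sum_(0 <= i < n./2) v i.
Proof.
elim: n => [|n IHn]; first by rewrite !big_nil addr0.
rewrite big_nat_recr//= IHn /interleave uphalf_half.
case: (odd n); rewrite /= ?add0n ?add1n.
  by rewrite -addrA -big_nat_recr.
by rewrite addrAC -big_nat_recr.
Qed.

Lemma half_cvg_oo : half @ \oo --> \oo.
Proof.
move=> A [m _ Am]; exists m.*2 => // n /= mn; apply: Am => /=.
by rewrite -[m]doubleK half_leq.
Qed.

Lemma uphalf_cvg_oo : uphalf @ \oo --> \oo.
Proof.
move=> A [m _ Am]; exists m.*2 => // n /= mn; apply: Am => /=.
by rewrite uphalf_half (leq_trans _ (leq_addl _ _))// -[m]doubleK half_leq.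
Qed.

Lemma cvg_series_interleave (K : numFieldType) (V : normedModType K)
    (u v : nat -> V) (s t : V) :
  series u @ \oo --> s -> series v @ \oo --> t ->
  series (interleave u v) @ \oo --> s + t.
Proof.
move=> us vt.
rewrite (_ : series _ = (series u \o uphalf) + (series v \o half)); last first.
  by apply/funext => n; rewrite fctE /series/= sum_interleave.
apply: cvgD.
  exact: (cvg_comp _ _ uphalf_cvg_oo us).
exact: (cvg_comp _ _ half_cvg_oo vt).
Qed.

Lemma interleave_cvg0 (K : numFieldType) (V : normedModType K) (u v : nat -> V) :
  u @ \oo --> (0 : V) -> v @ \oo --> (0 : V) ->
  interleave u v @ \oo --> (0 : V).
Proof.
move=> /(cvg_comp _ _ half_cvg_oo) u0 /(cvg_comp _ _ half_cvg_oo) v0.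
apply/cvgr0Pnorm_lt => e e0.
move/cvgr0Pnorm_lt : u0 => /(_ _ e0); move/cvgr0Pnorm_lt : v0 => /(_ _ e0).
apply: filterS2 => n; rewrite /interleave /=.
by case: odd.
Qed.

Lemma nneseries_interleave (R : realType) (u v : nat -> \bar R) :
  (forall n, 0 <= u n)%E -> (forall n, 0 <= v n)%E ->
  (\sum_(0 <= n <oo) interleave u v n =
   \sum_(0 <= n <oo) u n + \sum_(0 <= n <oo) v n)%E.
Proof.
move=> u0 v0; apply/cvg_lim => //.
rewrite (_ : (fun n => _) = fun n => (\sum_(0 <= i < uphalf n) u i +
    \sum_(0 <= i < n./2) v i)%E); last first.
  by apply/funext => n; exact: sum_interleave.
have cu : (fun n => \sum_(0 <= i < n) u i)%E @ \oo -->
    (\sum_(0 <= n <oo) u n)%E by apply: is_cvg_nneseries.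
have cv : (fun n => \sum_(0 <= i < n) v i)%E @ \oo -->
    (\sum_(0 <= n <oo) v n)%E by apply: is_cvg_nneseries.
apply: cvgeD.
- by rewrite ge0_adde_def// inE; apply: nneseries_ge0.
- exact: (cvg_comp _ _ uphalf_cvg_oo (cu)). 
- exact: (cvg_comp _ _ half_cvg_oo (cv)). 
Qed.

End interleave_theory.

Section lp_norm_theory.
Context {R : realType}.
Implicit Types (p : R) (u v : nat -> \bar R).
Local Open Scope ereal_scope.

Lemma lp_norm_ge0 p u : 0 <= lp_norm p u.
Proof. exact: poweR_ge0. Qed.

Lemma lp_norm0 p : (0 < p)%R -> lp_norm p (fun=> 0) = 0.
Proof.
move=> p0; rewrite /lp_norm eseries0 => [|n _ _]; rewrite poweR0r// ?invr_eq0 gt_eqF//.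
Qed.

Lemma le_lp_norm p u v : (0 < p)%R -> (forall n, 0 <= u n) ->
  (forall n, u n <= v n) -> lp_norm p u <= lp_norm p v.
Proof.
move=> p0 u0 uv; have v0 n : 0 <= v n by exact: le_trans (uv n).
apply: gt0_ler_poweR.
- by rewrite invr_ge0 ltW.
- by rewrite in_itv/= leey andbT nneseries_ge0// => n _ _; exact: poweR_ge0.
- by rewrite in_itv/= leey andbT nneseries_ge0// => n _ _; exact: poweR_ge0.
apply: lee_nneseries => n _ *; first exact: poweR_ge0.
by apply: gt0_ler_poweR; rewrite ?in_itv/= ?leey ?andbT ?(ltW p0).
Qed.

Lemma lp_normZ p (c : R) u : (0 < p)%R -> (0 <= c)%R -> (forall n, 0 <= u n) ->
  lp_norm p (fun n => c%:E * u n) = c%:E * lp_norm p u.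
Proof.
move=> p0 c0 u0; rewrite /lp_norm.
under eq_eseriesr do rewrite poweRM//.
rewrite nneseriesZl; last by move=> *; exact: poweR_ge0.
rewrite poweRM ?lee_fin ?powR_ge0//; last first.
  by rewrite nneseries_ge0// => n _ _; exact: poweR_ge0.
by rewrite poweR_EFin -powRrM divff ?gt_eqF// powRr1.
Qed.

Lemma lp_norm_interleave p u v : (0 < p)%R ->
  lp_norm p (interleave u v) =
  (\sum_(0 <= n <oo) u n `^ p + \sum_(0 <= n <oo) v n `^ p) `^ p^-1.
Proof.
move=> p0; rewrite /lp_norm -nneseries_interleave; last 2 first.
- by move=> n; exact: poweR_ge0.
- by move=> n; exact: poweR_ge0.
by congr (_ `^ _); apply: eq_eseriesr => n _; rewrite /interleave; case: odd.
Qed.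

Lemma lp_norm_interleavel p u v : (0 < p)%R ->
  lp_norm p u <= lp_norm p (interleave u v).
Proof.
move=> p0; rewrite lp_norm_interleave//.
have S0 w : 0 <= \sum_(0 <= n <oo) w n `^ p.
  by apply: nneseries_ge0 => n _ _; exact: poweR_ge0.
apply: gt0_ler_poweR; rewrite ?in_itv/= ?leey ?andbT ?invr_ge0 ?(ltW p0)//.
  exact: adde_ge0.
by rewrite leeDl.
Qed.

Lemma lp_norm_interleaver p u v : (0 < p)%R ->
  lp_norm p v <= lp_norm p (interleave u v).
Proof.
move=> p0; have := @lp_norm_interleavel p v u p0.
by rewrite !lp_norm_interleave// addeC.
Qed.

Lemma lp_norm_interleave_le p u v : (1 <= p)%R ->
  lp_norm p (interleave u v) <= 2%:E * (lp_norm p u + lp_norm p v).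
Proof.
move=> p1; have p0 : (0 < p)%R by exact: lt_le_trans p1.
rewrite lp_norm_interleave//.
set a := limn _; set b := limn _.
have a0 : 0 <= a by apply: nneseries_ge0 => n _ _; exact: poweR_ge0.
have b0 : 0 <= b by apply: nneseries_ge0 => n _ _; exact: poweR_ge0.
have H (x y : \bar R) : 0 <= x -> x <= y ->
    (x + y) `^ p^-1 <= 2%:E * (x `^ p^-1 + y `^ p^-1).
  move=> x0 xy; have y0 := le_trans x0 xy.
  apply: (@le_trans _ _ ((2%:E * y) `^ p^-1)).
    apply: gt0_ler_poweR; rewrite ?in_itv/= ?leey ?andbT ?invr_ge0 ?(ltW p0)//.
    - exact: adde_ge0.
    - by rewrite mule_ge0.
    - by rewrite mule_natl mule2n leeD2r.
  rewrite poweRM// lee_pmul ?poweR_ge0//.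
    rewrite poweR_EFin lee_fin -[leRHS]powRr1//.
    by apply: ler_powR; rewrite ?ler1n// invf_le1.
  by rewrite leeDr// poweR_ge0.
have [ab|ba] := leP a b; first exact: H.
by rewrite addeC [X in _ <= _ * X]addeC H// ltW.
Qed.

End lp_norm_theory.


(* A component I(X) of an operator ideal with its ideal norm, together with the
   facts needed to form the quotient of I(X) by the closure of the finite-rank
   operators: the norm estimates are stated up to a constant, which is enough
   for that closure to be a two-sided ideal. *)
Record endo_ideal (R : realType) (k : scalar_kind)
    (X : normedModType (scalar_field R k)) := EndoIdeal {
  ideal_op :> (X -> X) -> Prop;
  ideal_norm : (X -> X) -> \bar R;
  ideal_bounded : forall T, ideal_op T -> bounded_op T;
  ideal_op0 : ideal_op 0;
  ideal_opD : forall S T, ideal_op S -> ideal_op T -> ideal_op (S + T);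
  ideal_op_compl : forall A T, bounded_op A -> ideal_op T -> ideal_op (A \o T);
  ideal_op_compr : forall T B, ideal_op T -> bounded_op B -> ideal_op (T \o B);
  ideal_norm0 : ideal_norm 0 = 0%E;
  ideal_normD : exists2 c : R, 0 < c & forall S T (d : R),
    (ideal_norm S < d%:E)%E -> (ideal_norm T < d%:E)%E ->
    (ideal_norm (S + T)%R < (c * d)%:E)%E;
  ideal_norm_compl : forall A, bounded_op A ->
    exists2 c : R, 0 < c & forall T (d : R), bounded_op T ->
      (ideal_norm T < d%:E)%E -> (ideal_norm (A \o T) < (c * d)%:E)%E;
  ideal_norm_compr : forall B, bounded_op B ->
    exists2 c : R, 0 < c & forall T (d : R), bounded_op T ->
      (ideal_norm T < d%:E)%E -> (ideal_norm (T \o B) < (c * d)%:E)%E }.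

Section qn_theory.
Context {R : realType} {k : scalar_kind}.
Local Notation K := (scalar_field R k).
Variable p : R.
Hypothesis p1 : 1 <= p.
Implicit Types (X Y : normedModType K).
Let p0 : 0 < p. Proof. exact: lt_le_trans p1. Qed.

Lemma qn_seq0 X Y : qn_seq p (0 : X -> Y) (fun=> 0) /\
  lp_norm p (fun n => op_norm (0 : X -> K^o)) = 0%E.
Proof.
have o0 : op_norm (0 : X -> K^o) = 0%E.
  apply/eqP; rewrite eq_le op_norm_ge0 andbT; apply: ge_ereal_sup.
  by move=> _ [x _ <-]; rewrite [rnorm _]rnorm0.
split; last by rewrite o0 lp_norm0.
split=> [n||]; first exact: bounded_op0.
  by rewrite o0 lp_norm0// ltry.
by move=> x; rewrite [rnorm _]rnorm0 lp_norm_ge0.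
Qed.

Lemma qn_seqD X Y (S T : X -> Y) f g :
  qn_seq p S f -> qn_seq p T g ->
  exists2 h, qn_seq p (S + T) h &
    (lp_norm p (fun n => op_norm (h n)) <=
     4%:E * (lp_norm p (fun n => op_norm (f n)) +
             lp_norm p (fun n => op_norm (g n))))%E.
Proof.
move=> [bf fy Sf] [bg gy Tg].
pose h n : X -> K^o := (fun y : K^o => (2 : K) *: y) \o interleave f g n.
have n2 : scalar_re `|2 : K| = 2 by rewrite normr_nat scalar_re_nat.
have hle : (lp_norm p (fun n => op_norm (h n)) <=
     4%:E * (lp_norm p (fun n => op_norm (f n)) +
             lp_norm p (fun n => op_norm (g n))))%E.
  rewrite (_ : 4 = 2 * 2); last by rewrite -natrM.
  rewrite EFinM -muleA.
  apply: (@le_trans _ _ (lp_norm p (fun n => 2%:E *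
      interleave (fun n => op_norm (f n)) (fun n => op_norm (g n)) n)%E)).
    apply: le_lp_norm => // n; first exact: op_norm_ge0.
    have := op_normZ (2 : K) (interleave f g n); rewrite n2 => /le_trans; apply.
    by rewrite /interleave; case: odd.
  rewrite lp_normZ//; last first.
    by move=> n; rewrite /interleave; case: odd; exact: op_norm_ge0.
  by rewrite lee_wpmul2l//; exact: lp_norm_interleave_le.
exists h; last exact: hle.
split=> [n||x].
- apply: bounded_op_comp; first exact: bounded_opZ.
  by rewrite /interleave; case: odd.
- by apply: le_lt_trans hle _; rewrite lte_mul_pinfty// lte_add_pinfty.
rewrite (_ : (fun n => _) = (fun n => 2%:E *
    interleave (fun n => (rnorm (f n x))%:E) (fun n => (rnorm (g n x))%:E) n)%E);
  last first.
  apply/funext => n; rewrite /h/= rnormZ n2 EFinM.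
  by rewrite /interleave; case: odd.
rewrite lp_normZ//; last first.
  by move=> n; rewrite /interleave; case: odd; rewrite lee_fin rnorm_ge0.
rewrite mule_natl mule2n fctE.
apply: (@le_trans _ _ ((rnorm (S x))%:E + (rnorm (T x))%:E)%E).
  by rewrite -EFinD lee_fin rnormD.
apply: leeD.
  by apply: le_trans (Sf x) _; exact: lp_norm_interleavel.
by apply: le_trans (Tg x) _; exact: lp_norm_interleaver.
Qed.

Lemma qn_seq_compl X Y (T : X -> Y) (A : Y -> Y) f (m : K) : 0 < m ->
  (forall x, rnorm (A x) <= scalar_re m * rnorm x) -> qn_seq p T f ->
  exists2 h, qn_seq p (A \o T) h &
    (lp_norm p (fun n => op_norm (h n)) <=
     (scalar_re m)%:E * lp_norm p (fun n => op_norm (f n)))%E.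
Proof.
move=> m0 Am [bf fy Tf].
have m0' : 0 <= scalar_re m by rewrite scalar_re_ge0// ltW.
pose h n : X -> K^o := (fun y : K^o => (m : K) *: y) \o f n.
have hle : (lp_norm p (fun n => op_norm (h n)) <=
     (scalar_re m)%:E * lp_norm p (fun n => op_norm (f n)))%E.
  rewrite -lp_normZ//; last by move=> n; exact: op_norm_ge0.
  apply: le_lp_norm => // n; first exact: op_norm_ge0.
  by have := op_normZ (m : K) (f n); rewrite gtr0_norm.
exists h; last exact: hle.
split=> [n||x].
- by apply: bounded_op_comp => //; exact: bounded_opZ.
- by apply: le_lt_trans hle _; rewrite lte_mul_pinfty.
rewrite (_ : (fun n => _) = (fun n => (scalar_re m)%:E * (rnorm (f n x))%:E)%E);
  last by apply/funext => n; rewrite /h/= rnormZ gtr0_norm// EFinM.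
rewrite lp_normZ//; last by move=> n; rewrite lee_fin rnorm_ge0.
apply: (@le_trans _ _ ((scalar_re m)%:E * (rnorm (T x))%:E)%E).
  by rewrite -EFinM lee_fin Am.
by rewrite lee_wpmul2l.
Qed.

Lemma qn_seq_compr X Y (T : X -> Y) (B : X -> X) f (m : K) : 0 < m ->
  (forall x, rnorm (B x) <= scalar_re m * rnorm x) -> bounded_op B ->
  qn_seq p T f ->
  exists2 h, qn_seq p (T \o B) h &
    (lp_norm p (fun n => op_norm (h n)) <=
     (scalar_re m)%:E * lp_norm p (fun n => op_norm (f n)))%E.
Proof.
move=> m0 Bm bB [bf fy Tf].
have m0' : 0 <= scalar_re m by rewrite scalar_re_ge0// ltW.
have hle : (lp_norm p (fun n => op_norm (f n \o B)) <=
     (scalar_re m)%:E * lp_norm p (fun n => op_norm (f n)))%E.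
  rewrite -lp_normZ//; last by move=> n; exact: op_norm_ge0.
  apply: le_lp_norm => // n; first exact: op_norm_ge0.
  by apply: op_norm_comp => //; case: (bf n).
exists (fun n => f n \o B); last exact: hle.
split=> [n||x].
- exact: bounded_op_comp.
- by apply: le_lt_trans hle _; rewrite lte_mul_pinfty.
exact: Tf.
Qed.

Section qn_endo_ideal.
Variable X : normedModType K.

Lemma qn_norm_lt Y (T : X -> Y) (d : R) : (qn_norm p T < d%:E)%E ->
  exists2 f, qn_seq p T f & (lp_norm p (fun n => op_norm (f n)) < d%:E)%E.
Proof. by move=> /ereal_inf_lt[_ [f Tf <-] fd]; exists f. Qed.

Lemma qn_norm_le Y (T : X -> Y) f : qn_seq p T f ->
  (qn_norm p T <= lp_norm p (fun n => op_norm (f n)))%E.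
Proof. by move=> Tf; apply: ereal_inf_lbound; exists f. Qed.

Fact qn_op0 : QN p (0 : X -> X).
Proof.
by split; [exact: bounded_op0|exists (fun=> 0); exact: (qn_seq0 X X).1].
Qed.

Fact qn_opD (S T : X -> X) : QN p S -> QN p T -> QN p (S + T).
Proof.
move=> [bS [f Sf]] [bT [g Tg]]; split; first exact: bounded_opD.
by have [h Sh _] := qn_seqD Sf Tg; exists h.
Qed.

Fact qn_op_compl (A T : X -> X) : bounded_op A -> QN p T -> QN p (A \o T).
Proof.
move=> bA [bT [f Tf]]; split; first exact: bounded_op_comp.
have [m m0 Am] := bounded_op_gt0 bA.
by have [h Th _] := qn_seq_compl m0 Am Tf; exists h.
Qed.

Fact qn_op_compr (T B : X -> X) : QN p T -> bounded_op B -> QN p (T \o B).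
Proof.
move=> [bT [f Tf]] bB; split; first exact: bounded_op_comp.
have [m m0 Bm] := bounded_op_gt0 bB.
by have [h Th _] := qn_seq_compr m0 Bm bB Tf; exists h.
Qed.

Fact qn_norm0 : qn_norm p (0 : X -> X) = 0%E.
Proof.
apply/eqP; rewrite eq_le; apply/andP; split.
  by have [s0 <-] := qn_seq0 X X; exact: qn_norm_le.
by apply: le_ereal_inf_tmp => _ [f _ <-]; exact: lp_norm_ge0.
Qed.

Fact qn_normD : exists2 c : R, 0 < c & forall (S T : X -> X) (d : R),
    (qn_norm p S < d%:E)%E -> (qn_norm p T < d%:E)%E ->
    (qn_norm p (S + T)%R < (c * d)%:E)%E.
Proof.
exists (4 * 2) => // S T d /qn_norm_lt[f Sf fd] /qn_norm_lt[g Tg gd].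
have [h Sh hle] := qn_seqD Sf Tg; apply: le_lt_trans (qn_norm_le Sh) _.
apply: le_lt_trans hle _; rewrite -mulrA EFinM lte_pmul2l//.
by rewrite mulr_natl mulr2n EFinD lteD.
Qed.

Lemma scalar_re_gt0 (m : K) : 0 < m -> 0 < scalar_re m.
Proof.
move=> m0; rewrite lt_neqAle scalar_re_ge0 ?ltW// andbT; apply/eqP => m0'.
have : m <= 0 by apply: scalar_re_inj_le; rewrite ?(ltW m0)// -m0' scalar_re0.
by rewrite lt_geF.
Qed.

Fact qn_norm_compl (A : X -> X) : bounded_op A ->
    exists2 c : R, 0 < c & forall (T : X -> X) (d : R), bounded_op T ->
      (qn_norm p T < d%:E)%E -> (qn_norm p (A \o T) < (c * d)%:E)%E.
Proof.
move=> bA; have [m m0 Am] := bounded_op_gt0 bA.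
exists (scalar_re m); first exact: scalar_re_gt0.
move=> T d _ /qn_norm_lt[f Tf fd]; have [h Th hle] := qn_seq_compl m0 Am Tf.
apply: le_lt_trans (qn_norm_le Th) _; apply: le_lt_trans hle _.
by rewrite EFinM lte_pmul2l// lte_fin scalar_re_gt0.
Qed.

Fact qn_norm_compr (B : X -> X) : bounded_op B ->
    exists2 c : R, 0 < c & forall (T : X -> X) (d : R), bounded_op T ->
      (qn_norm p T < d%:E)%E -> (qn_norm p (T \o B) < (c * d)%:E)%E.
Proof.
move=> bB; have [m m0 Bm] := bounded_op_gt0 bB.
exists (scalar_re m); first exact: scalar_re_gt0.
move=> T d _ /qn_norm_lt[f Tf fd]; have [h Th hle] := qn_seq_compr m0 Bm bB Tf.
apply: le_lt_trans (qn_norm_le Th) _; apply: le_lt_trans hle _.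
by rewrite EFinM lte_pmul2l// lte_fin scalar_re_gt0.
Qed.

Definition QN_ideal : endo_ideal X :=
  @EndoIdeal R k X (QN p) (qn_norm p) (fun T => @proj1 _ _) qn_op0 qn_opD
    qn_op_compl qn_op_compr qn_norm0 qn_normD qn_norm_compl qn_norm_compr.

End qn_endo_ideal.

End qn_theory.

Arguments QN_ideal {R k p} p1 X.

Section sk_theory.
Context {R : realType} {k : scalar_kind}.
Local Notation K := (scalar_field R k).
Variable p : R.
Hypothesis p1 : 1 <= p.
Implicit Types (X Y : normedModType K).
Let p0 : 0 < p. Proof. exact: lt_le_trans p1. Qed.

Lemma conj_exp_ge1 : p != 1 -> 1 <= conj_exp p.
Proof.
move=> pN1; have pg1 : 1 < p by rewrite lt_neqAle eq_sym pN1.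
by rewrite /conj_exp ler_pdivlMr ?subr_gt0// mul1r lerBlDr lerDl.
Qed.

Lemma sk_coef0 : sk_coef p (fun=> (0 : K)).
Proof.
rewrite /sk_coef; case: ifPn => [_|/conj_exp_ge1 q1] /=.
  by split=> [|n]; [exact: cvg_cst|rewrite rnorm0].
by rewrite rnorm0 lp_norm0 ?(lt_le_trans _ q1).
Qed.

Lemma rnorm4V : scalar_re `|(4^-1 : K)| = 4^-1.
Proof.
have h : scalar_re (4^-1 : K) * 4 = 1.
  by rewrite -[X in _ * X](scalar_re_nat (k := k) 4) -scalar_reM ?invr_ge0// mulVf ?pnatr_eq0// (scalar_re_nat 1).
by rewrite ger0_norm ?invr_ge0//; apply: (mulIf (x := 4)); rewrite ?pnatr_eq0// h mulVf ?pnatr_eq0.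
Qed.

Lemma sk_coef_interleave (l m : nat -> K^o) : sk_coef p l -> sk_coef p m ->
  sk_coef p (fun n => 4^-1 *: interleave l m n).
Proof.
rewrite /sk_coef; case: ifPn => [_|/conj_exp_ge1 q1] /=.
  move=> [l0 l1] [m0 m1]; split.
    rewrite -[X in _ --> X](scaler0 _ (4^-1 : K)); apply: cvgZl_tmp.
    exact: interleave_cvg0.
  move=> n; rewrite rnormZ rnorm4V.
  have : rnorm (interleave l m n) <= 1 by rewrite /interleave; case: odd.
  by move=> h; rewrite ler_pdivrMl// mulr1 (le_trans h)// ler1n.
have q0 : 0 < conj_exp p by exact: lt_le_trans q1.
move=> l1 m1.
rewrite (_ : (fun n => _) = (fun n => 4^-1%:E *
    interleave (fun n => (rnorm (l n))%:E) (fun n => (rnorm (m n))%:E) n)%E);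
  last first.
  apply/funext => n; rewrite rnormZ rnorm4V EFinM.
  by rewrite /interleave; case: odd.
rewrite lp_normZ ?invr_ge0//; last first.
  by move=> n; rewrite /interleave; case: odd; rewrite lee_fin rnorm_ge0.
apply: (@le_trans _ _ (4^-1%:E * (2%:E * (1 + 1)))%E).
  rewrite lee_wpmul2l ?lee_fin ?invr_ge0//.
  apply: le_trans (lp_norm_interleave_le _ _ q1) _.
  by rewrite lee_wpmul2l ?lee_fin// leeD.
by rewrite -EFinD -!EFinM lee_fin -[1 + 1]mulr2n -natrM mulVf ?pnatr_eq0.
Qed.

Lemma sk_seq0 X Y : sk_seq p (0 : X -> Y) (fun=> 0) /\
  lp_norm p (fun n => (rnorm (0 : Y))%:E) = 0%E.
Proof.
split; last by rewrite rnorm0 lp_norm0.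
split; first by rewrite rnorm0 lp_norm0// ltry.
move=> _ [x _ <-]; exists (fun=> 0); first exact: sk_coef0.
rewrite (_ : series _ = cst 0); first exact: cvg_cst.
by apply/funext => n; rewrite /series/= big1// => i _; rewrite scaler0.
Qed.

Lemma sk_seqD X Y (S T : X -> Y) f g :
  sk_seq p S f -> sk_seq p T g ->
  exists2 h, sk_seq p (S + T) h &
    (lp_norm p (fun n => (rnorm (h n))%:E) <=
     8%:E * (lp_norm p (fun n => (rnorm (f n))%:E) +
             lp_norm p (fun n => (rnorm (g n))%:E)))%E.
Proof.
move=> [fy Sf] [gy Tg].
pose h n : Y := (4 : K) *: interleave f g n.
have hle : (lp_norm p (fun n => (rnorm (h n))%:E) <=
     8%:E * (lp_norm p (fun n => (rnorm (f n))%:E) +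
             lp_norm p (fun n => (rnorm (g n))%:E)))%E.
  rewrite (_ : 8 = 4 * 2); last by rewrite -natrM.
  rewrite EFinM -muleA.
  rewrite (_ : (fun n => _) = (fun n => 4%:E *
      interleave (fun n => (rnorm (f n))%:E) (fun n => (rnorm (g n))%:E) n)%E);
    last first.
    apply/funext => n; rewrite /h rnormZ normr_nat scalar_re_nat EFinM.
    by rewrite /interleave; case: odd.
  rewrite lp_normZ//; last first.
    by move=> n; rewrite /interleave; case: odd; rewrite lee_fin rnorm_ge0.
  by rewrite lee_wpmul2l//; exact: lp_norm_interleave_le.
exists h; last exact: hle.
split.
  by apply: le_lt_trans hle _; rewrite lte_mul_pinfty// lte_add_pinfty.
move=> _ [x x1 <-].
have [l cl ls] : p_hull p f (S x) by apply: Sf; exists x.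
have [m cm ms] : p_hull p g (T x) by apply: Tg; exists x.
exists (fun n => 4^-1 *: interleave l m n); first exact: sk_coef_interleave.
rewrite (_ : (fun n => _) =
    interleave (fun n => (l n : K) *: f n) (fun n => (m n : K) *: g n)).
  exact: cvg_series_interleave.
apply/funext => n; rewrite /h scalerA.
rewrite -[4^-1 *: _]/(4^-1 * _) mulrAC mulVf ?pnatr_eq0// mul1r.
by rewrite /interleave; case: odd.
Qed.

Lemma sk_seq_compl X Y (T : X -> Y) (A : Y -> Y) f (m : K) : 0 < m ->
  (forall x, rnorm (A x) <= scalar_re m * rnorm x) -> bounded_op A ->
  sk_seq p T f ->
  exists2 h, sk_seq p (A \o T) h &
    (lp_norm p (fun n => (rnorm (h n))%:E) <=
     (scalar_re m)%:E * lp_norm p (fun n => (rnorm (f n))%:E))%E.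
Proof.
move=> m0 Am bA [fy Tf].
have m0' : 0 <= scalar_re m by rewrite scalar_re_ge0// ltW.
have hle : (lp_norm p (fun n => (rnorm (A (f n)))%:E) <=
     (scalar_re m)%:E * lp_norm p (fun n => (rnorm (f n))%:E))%E.
  rewrite -lp_normZ//; last by move=> n; rewrite lee_fin rnorm_ge0.
  apply: le_lp_norm => // n; first by rewrite lee_fin rnorm_ge0.
  by rewrite -EFinM lee_fin Am.
exists (A \o f); last exact: hle.
split.
  by apply: le_lt_trans hle _; rewrite lte_mul_pinfty.
move=> _ [x x1 <-].
have [l cl ls] : p_hull p f (T x) by apply: Tf; exists x.
exists l => //=; have cA := bounded_op_continuous bA.
rewrite (_ : series _ = A \o series (fun n => (l n : K) *: f n)).
  exact: (cvg_comp _ _ ls (cA (T x))).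
have [L ->] := bounded_opE bA.
apply/funext => n; rewrite /series/= linear_sum.
by apply: eq_bigr => i _; rewrite linearZ.
Qed.

Lemma sk_seq_compr X Y (T : X -> Y) (B : X -> X) f (m : K) : 0 < m ->
  (forall x, rnorm (B x) <= scalar_re m * rnorm x) -> bounded_op T ->
  sk_seq p T f ->
  exists2 h, sk_seq p (T \o B) h &
    (lp_norm p (fun n => (rnorm (h n))%:E) <=
     (scalar_re m)%:E * lp_norm p (fun n => (rnorm (f n))%:E))%E.
Proof.
move=> m0 Bm bT [fy Tf].
have m0' : 0 <= scalar_re m by rewrite scalar_re_ge0// ltW.
have hle : (lp_norm p (fun n => (rnorm (m *: f n))%:E) <=
     (scalar_re m)%:E * lp_norm p (fun n => (rnorm (f n))%:E))%E.
  rewrite -lp_normZ//; last by move=> n; rewrite lee_fin rnorm_ge0.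
  apply: le_lp_norm => // n; first by rewrite lee_fin rnorm_ge0.
  by rewrite -EFinM lee_fin rnormZ gtr0_norm.
exists (fun n => m *: f n); last exact: hle.
split.
  by apply: le_lt_trans hle _; rewrite lte_mul_pinfty.
move=> _ [x x1 <-].
have [l cl ls] : p_hull p f (T (m^-1 *: B x)).
  apply: Tf; exists (m^-1 *: B x) => //.
  have mV : scalar_re m^-1 * scalar_re m = 1.
    by rewrite -scalar_reM ?invr_ge0 ?(ltW m0)// mulVf ?gt_eqF// (scalar_re_nat 1).
  rewrite /unit_ball/= rnormZ gtr0_norm ?invr_gt0// -mV ler_wpM2l//.
    by rewrite scalar_re_ge0// invr_ge0 ltW.
  by rewrite (le_trans (Bm x))// ler_piMr.
exists l => //=.
have -> : T (B x) = m *: T (m^-1 *: B x).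
  have [L ->] := bounded_opE bT.
  by rewrite -linearZ scalerA divff ?gt_eqF// scale1r.
rewrite (_ : series _ =
    fun n => m *: series (fun n => (l n : K) *: f n) n).
  exact: (cvgZl_tmp (k := m) ls).
apply/funext => n; rewrite /series/= scaler_sumr; apply: eq_bigr => i _.
by rewrite !scalerA mulrC.
Qed.

Section sk_endo_ideal.
Variable X : normedModType K.

Lemma sk_norm_lt Y (T : X -> Y) (d : R) : (sk_norm p T < d%:E)%E ->
  exists2 f, sk_seq p T f & (lp_norm p (fun n => (rnorm (f n))%:E) < d%:E)%E.
Proof. by move=> /ereal_inf_lt[_ [f Tf <-] fd]; exists f. Qed.

Lemma sk_norm_le Y (T : X -> Y) f : sk_seq p T f ->
  (sk_norm p T <= lp_norm p (fun n => (rnorm (f n))%:E))%E.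
Proof. by move=> Tf; apply: ereal_inf_lbound; exists f. Qed.

Fact sk_op0 : SK p (0 : X -> X).
Proof.
by split; [exact: bounded_op0|exists (fun=> 0); exact: (sk_seq0 X X).1].
Qed.

Fact sk_opD (S T : X -> X) : SK p S -> SK p T -> SK p (S + T).
Proof.
move=> [bS [f Sf]] [bT [g Tg]]; split; first exact: bounded_opD.
by have [h Sh _] := sk_seqD Sf Tg; exists h.
Qed.

Fact sk_op_compl (A T : X -> X) : bounded_op A -> SK p T -> SK p (A \o T).
Proof.
move=> bA [bT [f Tf]]; split; first exact: bounded_op_comp.
have [m m0 Am] := bounded_op_gt0 bA.
by have [h Th _] := sk_seq_compl m0 Am bA Tf; exists h.
Qed.

Fact sk_op_compr (T B : X -> X) : SK p T -> bounded_op B -> SK p (T \o B).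
Proof.
move=> [bT [f Tf]] bB; split; first exact: bounded_op_comp.
have [m m0 Bm] := bounded_op_gt0 bB.
by have [h Th _] := sk_seq_compr m0 Bm bT Tf; exists h.
Qed.

Fact sk_norm0 : sk_norm p (0 : X -> X) = 0%E.
Proof.
apply/eqP; rewrite eq_le; apply/andP; split.
  by have [s0 <-] := sk_seq0 X X; exact: sk_norm_le.
by apply: le_ereal_inf_tmp => _ [f _ <-]; exact: lp_norm_ge0.
Qed.

Fact sk_normD : exists2 c : R, 0 < c & forall (S T : X -> X) (d : R),
    (sk_norm p S < d%:E)%E -> (sk_norm p T < d%:E)%E ->
    (sk_norm p (S + T)%R < (c * d)%:E)%E.
Proof.
exists (8 * 2) => // S T d /sk_norm_lt[f Sf fd] /sk_norm_lt[g Tg gd].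
have [h Sh hle] := sk_seqD Sf Tg; apply: le_lt_trans (sk_norm_le Sh) _.
apply: le_lt_trans hle _; rewrite -mulrA EFinM lte_pmul2l//.
by rewrite mulr_natl mulr2n EFinD lteD.
Qed.

Fact sk_norm_compl (A : X -> X) : bounded_op A ->
    exists2 c : R, 0 < c & forall (T : X -> X) (d : R), bounded_op T ->
      (sk_norm p T < d%:E)%E -> (sk_norm p (A \o T) < (c * d)%:E)%E.
Proof.
move=> bA; have [m m0 Am] := bounded_op_gt0 bA.
exists (scalar_re m); first exact: scalar_re_gt0.
move=> T d _ /sk_norm_lt[f Tf fd]; have [h Th hle] := sk_seq_compl m0 Am bA Tf.
apply: le_lt_trans (sk_norm_le Th) _; apply: le_lt_trans hle _.
by rewrite EFinM lte_pmul2l// lte_fin scalar_re_gt0.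
Qed.

Fact sk_norm_compr (B : X -> X) : bounded_op B ->
    exists2 c : R, 0 < c & forall (T : X -> X) (d : R), bounded_op T ->
      (sk_norm p T < d%:E)%E -> (sk_norm p (T \o B) < (c * d)%:E)%E.
Proof.
move=> bB; have [m m0 Bm] := bounded_op_gt0 bB.
exists (scalar_re m); first exact: scalar_re_gt0.
move=> T d bT /sk_norm_lt[f Tf fd].
have [h Th hle] := sk_seq_compr m0 Bm bT Tf.
apply: le_lt_trans (sk_norm_le Th) _; apply: le_lt_trans hle _.
by rewrite EFinM lte_pmul2l// lte_fin scalar_re_gt0.
Qed.

Definition SK_ideal : endo_ideal X :=
  @EndoIdeal R k X (SK p) (sk_norm p) (fun T => @proj1 _ _) sk_op0 sk_opD
    sk_op_compl sk_op_compr sk_norm0 sk_normD sk_norm_compl sk_norm_compr.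

End sk_endo_ideal.

End sk_theory.

Arguments SK_ideal {R k p} p1 X.

Section finite_rank_closure.
Context {R : realType} {k : scalar_kind} {X : normedModType (scalar_field R k)}.
Local Notation K := (scalar_field R k).
Variable J : endo_ideal X.

(* The closure of F(X) in I(X) for the ideal norm.  An operator F as below is in
   I(X), since T and, its ideal norm being finite, T - F are. *)
Definition fr_closure : set (X -> X) :=
  [set T | J T /\ forall e : R, 0 < e -> exists F : X -> X,
     finite_rank F /\ (ideal_norm J (T - F)%R < e%:E)%E].

Lemma fr_closure0 : fr_closure 0.
Proof.
split; first exact: ideal_op0.
by move=> e e0; exists 0; split; [exact: finite_rank0|rewrite subr0 ideal_norm0].
Qed.

Lemma fr_closureD S T : fr_closure S -> fr_closure T -> fr_closure (S + T).
Proof.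
move=> [JS cS] [JT cT]; split; first exact: ideal_opD.
move=> e e0; have [c c0 nD] := ideal_normD J.
have [F [rF SF]] := cS (c^-1 * e) (mulr_gt0 (etrans (invr_gt0 c) c0) e0).
have [G [rG TG]] := cT (c^-1 * e) (mulr_gt0 (etrans (invr_gt0 c) c0) e0).
exists (F + G); split; first exact: finite_rankD.
have := nD _ _ _ SF TG; rewrite mulrA divff ?gt_eqF// mul1r.
by rewrite addrACA -opprD.
Qed.

Lemma bounded_opB S T : @bounded_op R k X X S -> bounded_op T ->
  bounded_op (S - T).
Proof.
move=> bS bT; apply: bounded_opD => //.
have -> : - T = (fun x : X => (-1 : K) *: x) \o T.
  by apply/funext => x; rewrite /= scaleN1r.
by apply: bounded_op_comp => //; exact: bounded_opZ.
Qed.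

Lemma fr_closure_compl A T :
  bounded_op A -> fr_closure T -> fr_closure (A \o T).
Proof.
move=> bA [JT cT]; split; first exact: ideal_op_compl.
move=> e e0; have [c c0 nA] := ideal_norm_compl J bA.
have [F [rF TF]] := cT (c^-1 * e) (mulr_gt0 (etrans (invr_gt0 c) c0) e0).
exists (A \o F); split; first exact: finite_rank_compl.
have bTF : bounded_op (T - F).
  by apply: bounded_opB; [exact: ideal_bounded JT|case: rF].
have := nA _ _ bTF TF; rewrite mulrA divff ?gt_eqF// mul1r.
have [L ->] := bounded_opE bA.
rewrite (_ : L \o (T - F) = (L \o T) - (L \o F))//.
by apply/funext => x; rewrite !fctE /= linearB.
Qed.

Lemma fr_closure_compr T B :
  fr_closure T -> bounded_op B -> fr_closure (T \o B).
Proof.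
move=> [JT cT] bB; split; first exact: ideal_op_compr.
move=> e e0; have [c c0 nB] := ideal_norm_compr J bB.
have [F [rF TF]] := cT (c^-1 * e) (mulr_gt0 (etrans (invr_gt0 c) c0) e0).
exists (F \o B); split; first exact: finite_rank_compr.
have bTF : bounded_op (T - F).
  by apply: bounded_opB; [exact: ideal_bounded JT|case: rF].
by have := nB _ _ bTF TF; rewrite mulrA divff ?gt_eqF// mul1r.
Qed.

Lemma ideal_opZ (a : K) T : J T -> J (a *: T).
Proof. exact: ideal_op_compl (bounded_opZ X a). Qed.

Lemma fr_closureZ (a : K) T : fr_closure T -> fr_closure (a *: T).
Proof. exact: fr_closure_compl (bounded_opZ X a). Qed.

Definition ideal_pred : {pred X -> X} := fun T => `[< J T >].

Fact ideal_pred_closed : submod_closed ideal_pred.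
Proof.
split; first by apply/asboolP; exact: ideal_op0.
move=> a S T /asboolP JS /asboolP JT; apply/asboolP.
by apply: ideal_opD => //; exact: ideal_opZ.
Qed.

HB.instance Definition _ :=
  GRing.isSubmodClosed.Build K (X -> X) ideal_pred ideal_pred_closed.

Record ideal_elt := IdealElt { elt_op :> X -> X; _ : elt_op \in ideal_pred }.

HB.instance Definition _ := [isSub for elt_op].
HB.instance Definition _ := [Choice of ideal_elt by <:].
HB.instance Definition _ := [SubChoice_isSubLmodule of ideal_elt by <:].

Lemma elt_opP (T : ideal_elt) : J T.
Proof. exact/asboolP/(valP T). Qed.

Fact elt_comp_subproof (S T : ideal_elt) : (S \o T) \in ideal_pred.
Proof.
by apply/asboolP/ideal_op_compl; [apply: ideal_bounded|]; exact: elt_opP.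
Qed.

Definition elt_comp (S T : ideal_elt) : ideal_elt :=
  IdealElt (elt_comp_subproof S T).

Definition fr_pred : {pred ideal_elt} := fun T => `[< fr_closure T >].

Fact fr_pred_closed : submod_closed fr_pred.
Proof.
split; first by apply/asboolP; exact: fr_closure0.
move=> a S T /asboolP JS /asboolP JT; apply/asboolP => /=.
by apply: fr_closureD => //; exact: fr_closureZ.
Qed.

HB.instance Definition _ :=
  GRing.isSubmodClosed.Build K ideal_elt fr_pred fr_pred_closed.

End finite_rank_closure.

(* Associative algebras, not necessarily unital. *)
Record algebra (K : nzRingType) := Algebra {
  alg_sort :> lmodType K;
  alg_mul : alg_sort -> alg_sort -> alg_sort;
  alg_mulA : associative alg_mul;
  alg_mulDl : left_distributive alg_mul +%R;
  alg_mulDr : right_distributive alg_mul +%R;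
  alg_scaleAl : forall (a : K) x y, a *: alg_mul x y = alg_mul (a *: x) y;
  alg_scaleAr : forall (a : K) x y, a *: alg_mul x y = alg_mul x (a *: y) }.

(* a_1 * ... * a_n = 0 for all a_1, ..., a_n, where n >= 1 *)
Definition products_vanish (K : nzRingType) (A : algebra K) (n : nat) : Prop :=
  (0 < n)%N /\
  forall (a : A) (s : seq A), size (a :: s) = n -> foldl (@alg_mul K A) a s = 0.

Definition nilpotent (K : nzRingType) (A : algebra K) : Prop :=
  exists n, products_vanish A n.

Definition nil_index (K : nzRingType) (A : algebra K) (hA : nilpotent A) : nat :=
  @ex_minn (fun n => `[< products_vanish A n >])
    (let: ex_intro n hn := hA in ex_intro _ n (asboolT hn)).

(* The algebra I(X) / closure of F(X), under composition.  Only the algebra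
   structure is recorded: the index does not depend on the quotient norm. *)
Section quotient_algebra.
Context {R : realType} {k : scalar_kind} {X : normedModType (scalar_field R k)}.
Local Notation K := (scalar_field R k).
Local Open Scope quotient_scope.
Variable J : endo_ideal X.

Definition fr_quot := Quotient.quot (@fr_pred R k X J).

HB.instance Definition _ := GRing.Zmodule.on fr_quot.
HB.instance Definition _ := EqQuotient.on fr_quot.

Definition fr_class (T : ideal_elt J) : fr_quot := \pi_fr_quot T.

Lemma fr_classP (S T : ideal_elt J) :
  fr_class S = fr_class T <-> fr_closure J (elt_op S - elt_op T).
Proof.
split=> [/eqP|h]; first by rewrite -Quotient.idealrBE => /asboolP.
by apply/eqP; rewrite -Quotient.idealrBE; apply/asboolP.
Qed.

Lemma fr_class_repr (x : fr_quot) : fr_class (repr x) = x.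
Proof. exact: reprK. Qed.

Lemma fr_classD (S T : ideal_elt J) :
  fr_class (S + T) = fr_class S + fr_class T.
Proof. by rewrite /fr_class !piE. Qed.

Definition fr_scale (a : K) (x : fr_quot) : fr_quot := fr_class (a *: repr x).

Lemma fr_scale_class (a : K) T : fr_scale a (fr_class T) = fr_class (a *: T).
Proof.
apply/fr_classP; rewrite -[X in fr_closure J X]/(elt_op (a *: _ - a *: _)).
rewrite -scalerBr; apply: (@fr_closureZ _ _ _ J a (elt_op (_ - _))).
by apply/fr_classP; rewrite fr_class_repr.
Qed.

Fact fr_scaleA a b x : fr_scale a (fr_scale b x) = fr_scale (a * b) x.
Proof. by rewrite -[x]fr_class_repr !fr_scale_class scalerA. Qed.

Fact fr_scale1 : left_id 1 fr_scale.
Proof. by move=> x; rewrite -[x]fr_class_repr fr_scale_class scale1r. Qed.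

Fact fr_scaleDr : right_distributive fr_scale +%R.
Proof.
move=> a x y; rewrite -[x]fr_class_repr -[y]fr_class_repr -fr_classD.
by rewrite !fr_scale_class -fr_classD scalerDr.
Qed.

Fact fr_scaleDl x : {morph fr_scale^~ x : a b / a + b}.
Proof.
by move=> a b /=; rewrite -[x]fr_class_repr !fr_scale_class -fr_classD scalerDl.
Qed.

HB.instance Definition _ := GRing.Zmodule_isLmodule.Build K fr_quot
  fr_scaleA fr_scale1 fr_scaleDr fr_scaleDl.

Definition fr_mul (x y : fr_quot) : fr_quot :=
  fr_class (elt_comp (repr x) (repr y)).

Lemma fr_mul_class S T :
  fr_mul (fr_class S) (fr_class T) = fr_class (elt_comp S T).
Proof.
set S' := repr (fr_class S); set T' := repr (fr_class T).
have cS : fr_closure J (elt_op S' - elt_op S) by apply/fr_classP/fr_class_repr.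
have cT : fr_closure J (elt_op T' - elt_op T) by apply/fr_classP/fr_class_repr.
apply/fr_classP.
have -> : elt_op (elt_comp S' T') - elt_op (elt_comp S T) =
    ((elt_op S' - elt_op S) \o elt_op T') +
    (elt_op S \o (elt_op T' - elt_op T)).
  have [L SL] := bounded_opE (ideal_bounded (elt_opP S)).
  apply/funext => x; rewrite /= !fctE /= SL linearB /=.
  by rewrite addrA subrK.
apply: fr_closureD.
  by apply: fr_closure_compr => //; exact: ideal_bounded (elt_opP _).
by apply: fr_closure_compl => //; exact: ideal_bounded (elt_opP _).
Qed.

Fact fr_mulA : associative fr_mul.
Proof.
move=> x y z; rewrite -[x]fr_class_repr -[y]fr_class_repr -[z]fr_class_repr.
by rewrite !fr_mul_class; congr fr_class; exact: val_inj.
Qed.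

Fact fr_mulDl : left_distributive fr_mul +%R.
Proof.
move=> x y z; rewrite -[x]fr_class_repr -[y]fr_class_repr -[z]fr_class_repr.
rewrite -fr_classD !fr_mul_class -fr_classD; congr fr_class.
exact: val_inj.
Qed.

Fact fr_mulDr : right_distributive fr_mul +%R.
Proof.
move=> x y z; rewrite -[x]fr_class_repr -[y]fr_class_repr -[z]fr_class_repr.
rewrite -fr_classD !fr_mul_class -fr_classD; congr fr_class.
have [L SL] := bounded_opE (ideal_bounded (elt_opP (repr x))).
by apply/val_inj/funext => u; rewrite /= !fctE SL linearD.
Qed.

Fact fr_scaleAl (a : K) x y : a *: fr_mul x y = fr_mul (a *: x) y.
Proof.
rewrite -[x]fr_class_repr -[y]fr_class_repr.
rewrite -[a *: fr_class _]/(fr_scale a _) fr_scale_class !fr_mul_class.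
by rewrite -[LHS]/(fr_scale a _) fr_scale_class; congr fr_class; exact: val_inj.
Qed.

Fact fr_scaleAr (a : K) x y : a *: fr_mul x y = fr_mul x (a *: y).
Proof.
rewrite -[x]fr_class_repr -[y]fr_class_repr.
rewrite -[a *: fr_class _]/(fr_scale a _) fr_scale_class !fr_mul_class.
rewrite -[LHS]/(fr_scale a _) fr_scale_class; congr fr_class.
have [L SL] := bounded_opE (ideal_bounded (elt_opP (repr x))).
by apply/val_inj/funext => u; rewrite /= !fctE /= SL linearZ.
Qed.

Definition quotient_algebra : algebra K :=
  Algebra fr_mulA fr_mulDl fr_mulDr fr_scaleAl fr_scaleAr.

End quotient_algebra.

(* Main.v *)
Require Import Defs.
From mathcomp Require Import all_boot all_order all_algebra.
From mathcomp Require Import complex ring lra.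
From mathcomp Require Import all_classical all_reals all_analysis.

Set Implicit Arguments.
Unset Strict Implicit.
Unset Printing Implicit Defensive.

Import Order.TTheory GRing.Theory Num.Theory.
Import numFieldNormedType.Exports.

Local Open Scope classical_set_scope.
Local Open Scope ring_scope.

(** Both ideals become transparent once they are written in weighted sequence
    spaces.  Normalising an l^p sequence of functionals, T is quasi p-nuclear
    when |T x|^p <= C sum_j a_j |u_j x|^p with |u_j| <= 1 and sum_j a_j finite
    ([weighted_qn]).  Normalising an l^p sequence of vectors, T is p-compact when
    every T x with |x| <= 1 has the form sum_j a_j xi_j y_j with |y_j| <= 1 and
    xi bounded in L^p'(a), p' being the dual exponent ([weighted_sk]).  As the
    measure a is finite, both classes grow with p.

    The theorem rests on two facts about these classes.

    First, exponents add up like in Hoelder's inequality: composing operators of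
    exponents p and q gives exponent r with 1/r = 1/p + 1/q, as long as r > 1
    ([weighted_qn_comp], [weighted_sk_comp]).  For S o T one expresses the data
    of one factor through those of the other, which produces an infinite
    matrix, and a three-term Hoelder inequality leads to the weight
    a_j (1 + e_j), where e_j sums powers of the entries in column j of the matrix.
    In the compact case the matrix contains the coefficients of S y_i.  In the
    quasi nuclear case each functional v_i o T has to be bounded by
    sum_j a_j d_ij |u_j| with d_i bounded in L^p'(a): this is
    [lp_dual_domination], obtained by minimising |x|_p^p minus the functional.
    Hence a product of m operators of exponent p > 2 has exponent max(2, p / m).

    Second, exponent 2 means factoring through a Hilbert space, where orthogonal
    projections are available: operators of exponent 2 are limits of
    finite-rank operators for the ideal norm of exponent 2, hence for that of
    every exponent p >= 2, and also for the operator norm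
    ([weighted_qn2_approx], [weighted_sk2_approx]).

    If p > 2 and n = max(2, ceil(p / 2)), then p / n <= 2, so that a product of n
    operators has exponent 2 and lies in the closure of the finite-rank
    operators.  If p <= 2, then T has exponent 2 already, so T is a limit of
    finite-rank operators F in operator norm, and the operators S o F converge
    to S o T for the ideal norm since S is in the ideal. *)

(** * Sums of nonnegative sequences *)

Section nonneg_sums.
Context {R : realType}.
Implicit Types (s t a f g : nat -> R) (C : R).

Definition nsum s : \bar R := (\sum_(0 <= j <oo) (s j)%:E)%E.

Definition nonneg s := forall j, 0 <= s j.

Lemma nsum_ge0 s : nonneg s -> (0 <= nsum s)%E.
Proof. by move=> s0; apply: nneseries_ge0 => j _ _; rewrite lee_fin. Qed.

Lemma le_nsum s t : nonneg s -> (forall j, s j <= t j) -> (nsum s <= nsum t)%E.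
Proof.
by move=> s0 st; apply: lee_nneseries => j *; rewrite lee_fin.
Qed.

Lemma eq_nsum s t : s =1 t -> nsum s = nsum t.
Proof. by move=> /funext ->. Qed.

Lemma psum_le_nsum s n : nonneg s -> ((\sum_(j < n) s j)%:E <= nsum s)%E.
Proof.
move=> s0; rewrite -(big_mkord xpredT) -sumEFin; apply: nneseries_lim_ge => j _ _.
by rewrite lee_fin.
Qed.

Lemma nsum_leP s C : nonneg s ->
  (nsum s <= C%:E)%E <-> forall n, \sum_(j < n) s j <= C.
Proof.
move=> s0; split=> [sC n|sC].
  by rewrite -lee_fin; apply: le_trans sC; exact: psum_le_nsum.
apply: lime_le; first by apply: is_cvg_nneseries => j _ _; rewrite lee_fin.
by apply: nearW => n; rewrite sumEFin lee_fin big_mkord.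
Qed.

Lemma term_le_nsum s C j : nonneg s -> (nsum s <= C%:E)%E -> s j <= C.
Proof.
move=> s0 /(nsum_leP _ s0)/(_ j.+1); apply: le_trans.
by rewrite big_ord_recr/= lerDr sumr_ge0.
Qed.

Lemma nsumD s t : nonneg s -> nonneg t ->
  nsum (fun j => s j + t j) = (nsum s + nsum t)%E.
Proof.
move=> s0 t0; rewrite /nsum -nneseriesD => [|j _ _|j _ _]; rewrite ?lee_fin//.
Qed.

Lemma nsumZ (c : R) s : nonneg s ->
  nsum (fun j => c * s j) = (c%:E * nsum s)%E.
Proof.
by move=> s0; rewrite /nsum -nneseriesZl// => j _; rewrite lee_fin.
Qed.

Lemma nsum0 : nsum (fun=> 0) = 0%E.
Proof. by apply: eseries0. Qed.

Lemma nsum_fin s : nonneg s -> (nsum s < +oo)%E ->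
  exists2 C, 0 <= C & nsum s = C%:E.
Proof.
move=> s0 soo; exists (fine (nsum s)); first by rewrite fine_ge0// nsum_ge0.
by rewrite fineK// ge0_fin_numE// nsum_ge0.
Qed.

Definition tail N s j := if (j < N)%N then 0 else s j.

Lemma tail_ge0 N s : nonneg s -> nonneg (tail N s).
Proof. by move=> s0 j; rewrite /tail; case: ifP. Qed.

Lemma tail_le N s j : nonneg s -> tail N s j <= s j.
Proof. by move=> s0; rewrite /tail; case: ifP. Qed.

Lemma nsum_tailE N s : nonneg s -> nsum (tail N s) = (\sum_(N <= j <oo) (s j)%:E)%E.
Proof.
move=> s0; rewrite /nsum (nneseries_split 0 N) ?add0n; last first.
  by move=> j _; rewrite lee_fin tail_ge0.
rewrite big1_seq ?add0e; last first.
  by move=> j /=; rewrite mem_index_iota /tail => /= ->.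
by apply/congr_lim/funext => n; apply: eq_big_nat => j /andP[Nj _]; rewrite /tail ltnNge Nj.
Qed.

Lemma nsum_split (s : nat -> R) N : nonneg s ->
  nsum s = ((\sum_(j < N) s j)%:E + nsum (tail N s))%E.
Proof.
move=> s0; rewrite nsum_tailE// /nsum (nneseries_split 0 N) ?add0n.
  by rewrite sumEFin big_mkord.
by move=> j _; rewrite lee_fin.
Qed.

Lemma nsum_tail_small s (e : R) : nonneg s -> (nsum s < +oo)%E -> 0 < e ->
  exists N, (nsum (tail N s) <= e%:E)%E.
Proof.
move=> s0 soo e0.
have := @nneseries_tail_cvg R (fun j => (s j)%:E) xpredT soo.
move=> /(_ (fun j _ => s0 j)) /fine_cvgP[fin /cvgrPdist_le /(_ _ e0)].
move=> h; have [N _ /(_ N)/(_ (leqnn N))[/=]] := filterI fin h.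
rewrite sub0r normrN => fN eN; exists N; rewrite nsum_tailE//.
by rewrite -(fineK fN) lee_fin; apply: le_trans eN; rewrite ler_norm.
Qed.

Lemma nsum_interchange (s : nat -> nat -> R) : (forall i j, 0 <= s i j) ->
  (\sum_(0 <= i <oo) nsum (s i) = \sum_(0 <= j <oo) nsum (fun i => s i j))%E.
Proof. by move=> s0; apply: nneseries_interchange => i j; rewrite lee_fin. Qed.

Lemma nsum_hoelder (th : R) f g : 0 < th < 1 -> nonneg f -> nonneg g ->
  (nsum (fun j => (f j `^ th * g j `^ (1 - th))%R) <=
   nsum f `^ th * nsum g `^ (1 - th))%E.
Proof.
move=> /andP[th0 th1] f0 g0; have th1' : 0 < 1 - th by rewrite subr_gt0.
have mf (h : nat -> R) : measurable_fun setT h by [].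
have /= := @hoelder _ nat R counting (fun j => f j `^ th) (fun j => g j `^ (1 - th))
  th^-1 (1 - th)^-1 (mf _) (mf _).
rewrite !invr_gt0 !invrK => /(_ th0 th1').
rewrite addrC subrK => /(_ erefl).
rewrite !Lnorm_counting ?invr_gt0// !invrK invr1.
rewrite poweRe1; last by apply: nneseries_ge0 => j _ _; exact: poweR_ge0.
under eq_eseriesr do rewrite poweRe1 ?abse_ge0// abse_EFin /= ger0_norm ?mulr_ge0 ?powR_ge0//.
move=> /le_trans; apply.
rewrite le_eqVlt; apply/orP; left; apply/eqP.
by congr ((_ `^ _) * (_ `^ _))%E; apply: eq_eseriesr => j _;
  rewrite abse_EFin poweR_EFin ger0_norm ?powR_ge0// -powRrM divff ?gt_eqF// powRr1.
Qed.

Lemma nsum_hoelder_le (th F G : R) f g : 0 < th < 1 -> nonneg f -> nonneg g ->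
  (nsum f <= F%:E)%E -> (nsum g <= G%:E)%E ->
  (nsum (fun j => (f j `^ th * g j `^ (1 - th))%R) <= (F `^ th * G `^ (1 - th))%:E)%E.
Proof.
move=> th01 f0 g0 fF gG; apply: le_trans (nsum_hoelder th01 f0 g0) _.
have [th0 th1] := andP th01.
rewrite EFinM -!poweR_EFin lee_pmul ?poweR_ge0//; apply: gt0_ler_poweR => //;
  rewrite ?in_itv/= ?leey ?andbT ?nsum_ge0// ?(le_trans _ fF) ?(le_trans _ gG)//
   ?nsum_ge0//.
- exact: ltW.
- by rewrite subr_ge0 ltW.
Qed.

Lemma nsum_hoelder3_le (t1 t2 t3 F G H : R) f g h :
  0 < t1 -> 0 < t2 -> 0 < t3 -> t1 + t2 + t3 = 1 ->
  nonneg f -> nonneg g -> nonneg h ->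
  (nsum f <= F%:E)%E -> (nsum g <= G%:E)%E -> (nsum h <= H%:E)%E ->
  (nsum (fun j => (f j `^ t1 * g j `^ t2 * h j `^ t3)%R) <=
     (F `^ t1 * G `^ t2 * H `^ t3)%:E)%E.
Proof.
move=> t10 t20 t30 t1E f0 g0 h0 fF gG hH.
have u0 : 0 < t1 + t2 by rewrite addr_gt0.
have F0 : 0 <= F by rewrite -lee_fin (le_trans _ fF)// nsum_ge0.
have G0 : 0 <= G by rewrite -lee_fin (le_trans _ gG)// nsum_ge0.
have tE : t3 = 1 - (t1 + t2) by rewrite -t1E addrAC subrr add0r.
have sE : 1 - t1 / (t1 + t2) = t2 / (t1 + t2).
  by apply: (mulIf (lt0r_neq0 u0)); rewrite mulrBl !divfK ?gt_eqF// mul1r addrAC subrr add0r.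
have key : forall x y, 0 <= x -> 0 <= y -> x `^ t1 * y `^ t2 =
    (x `^ (t1 / (t1 + t2)) * y `^ (t2 / (t1 + t2))) `^ (t1 + t2).
  by move=> x y x0 y0; rewrite powRM ?powR_ge0// -!powRrM !divfK ?gt_eqF.
have fg := @nsum_hoelder_le (t1 / (t1 + t2)) F G f g _ f0 g0 fF gG.
rewrite tE key// (eq_nsum (t := fun j => (f j `^ (t1 / (t1 + t2)) *
    g j `^ (t2 / (t1 + t2))) `^ (t1 + t2) * h j `^ (1 - (t1 + t2)))); last first.
  by move=> j; rewrite key.
apply: nsum_hoelder_le => //.
- by rewrite u0 -t1E ltrDl.
- by move=> j; rewrite mulr_ge0 ?powR_ge0.
- rewrite -sE; apply: fg.
  by rewrite divr_gt0//= ltr_pdivrMr// mul1r ltrDl.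
Qed.

End nonneg_sums.

(** * Powers and conjugate exponents *)

Section powers.
Context {R : realType}.
Implicit Types p : R.

Lemma conj_exp_gt1 (p : R) : 1 < p -> 1 < conj_exp p.
Proof.
by move=> p1; rewrite /conj_exp ltr_pdivlMr ?subr_gt0// mul1r ltrBlDr ltrDl.
Qed.

Lemma conj_expV (p : R) : 1 < p -> (conj_exp p)^-1 = 1 - p^-1.
Proof.
move=> p1; have p0 : p != 0 by rewrite gt_eqF// (lt_trans ltr01).
by rewrite /conj_exp invf_div mulrBl divff// mul1r.
Qed.

Lemma conj_expK p : 1 < p -> conj_exp (conj_exp p) = p.
Proof.
move=> p1; have p0 : p != 0 by rewrite gt_eqF// (lt_trans ltr01).
have q1 := conj_exp_gt1 p1; have q2 := conj_exp_gt1 q1.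
by apply: invr_inj; rewrite !conj_expV// opprB addrC subrK.
Qed.

Lemma conj_exp2 : conj_exp 2 = 2 :> R.
Proof. by rewrite /conj_exp; field. Qed.

Lemma conj_exp_conj (p : R) : 1 < p -> p^-1 + (conj_exp p)^-1 = 1.
Proof. by move=> p1; rewrite conj_expV// addrC subrK. Qed.

Lemma powR_conj_exp (p v : R) : 1 < p -> 0 <= v ->
  (v `^ (p - 1)) `^ conj_exp p = v `^ p.
Proof.
by move=> p1 v0; rewrite -powRrM /conj_exp mulrC divfK// gt_eqF// subr_gt0.
Qed.

(** The graph of the convex function v |-> v^p lies above its tangents; this is
    Young's inequality for u and v^(p-1). *)
Lemma powR_tangent (p u v : R) : 1 < p -> 0 <= u -> 0 <= v ->
  v `^ p - u `^ p <= p * (v - u) * v `^ (p - 1).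
Proof.
move=> p1 u0 v0; have p0 : 0 < p by rewrite (lt_trans ltr01).
have q1 := conj_exp_gt1 p1; have q0 : 0 < conj_exp p by rewrite (lt_trans ltr01).
have := conjugate_powR u0 (powR_ge0 v (p - 1)) p0 q0 (conj_exp_conj p1).
rewrite powR_conj_exp// conj_expV// -(ler_pM2l p0).
have := mulr_powRB1 v0 p0.
set W := v `^ (p - 1); set V := v `^ p; set U := u `^ p => VE.
have -> : p * (U / p + V * (1 - p^-1)) = U + V * (p - 1).
  by field; rewrite gt_eqF.
by rewrite -VE => h; lra.
Qed.

Lemma powRD_le (p u v : R) : 0 < p -> 0 <= u -> 0 <= v ->
  (u + v) `^ p <= 2 `^ p * (u `^ p + v `^ p).
Proof.
move=> p0 u0 v0; wlog uv : u v u0 v0 / u <= v.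
  move=> H; have [/H|/ltW/H] := leP u v; first exact.
  by rewrite addrC [X in _ -> _ <= _ * X]addrC; apply.
apply: (@le_trans _ _ ((2 * v) `^ p)).
  apply: ge0_ler_powR; rewrite ?nnegrE ?mulr_ge0 ?addr_ge0 ?(ltW p0)//.
  by rewrite mulr_natl mulr2n lerD2r.
by rewrite powRM// ler_wpM2l ?powR_ge0// lerDr powR_ge0.
Qed.

Lemma powR_sqr (x : R) : 0 <= x -> x `^ 2 = x ^+ 2.
Proof. exact: (@powR_mulrn R x 2). Qed.

Lemma powR_le1D (x s t : R) : 0 <= x -> 0 <= s -> s <= t -> x `^ s <= 1 + x `^ t.
Proof.
move=> x0 s0 st; have [x1|/ltW x1] := leP x 1.
  apply: (@le_trans _ _ (1 `^ s)); last by rewrite powR1 lerDl powR_ge0.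
  by apply: ge0_ler_powR; rewrite ?nnegrE.
by apply: (@le_trans _ _ (x `^ t)); [exact: ler_powR|rewrite lerDr].
Qed.

End powers.

Section lp_norm_sums.
Context {R : realType}.
Implicit Types (p r : R).

Lemma le_poweR (x y : \bar R) r : 0 <= r -> (0 <= x)%E -> (x <= y)%E ->
  (x `^ r <= y `^ r)%E.
Proof.
move=> r0 x0 xy; apply: gt0_ler_poweR; rewrite ?in_itv/= ?leey ?andbT//.
exact: le_trans xy.
Qed.

Lemma term_le_eseries (u : nat -> \bar R) n : (forall j, 0 <= u j)%E ->
  (u n <= \sum_(0 <= j <oo) u j)%E.
Proof.
move=> u0; apply: (@le_trans _ _ (\sum_(0 <= j < n.+1) u j)%E).
  by rewrite big_nat_recr//= leeDr// sume_ge0.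
by apply: nneseries_lim_ge.
Qed.

Lemma lp_norm_fin_nsum p (c : nat -> R) : 1 <= p ->
  (lp_norm p (fun n => (c n)%:E) < +oo)%E -> (nsum (fun n => (c n `^ p)%R) < +oo)%E.
Proof.
move=> p1; have p0 : 0 < p by rewrite (lt_le_trans ltr01).
move=> /lty_poweRy; rewrite invr_eq0 gt_eqF// => /(_ isT).
by rewrite /nsum; under eq_eseriesr do rewrite poweR_EFin.
Qed.

Lemma lp_norm_le1_nsum p (c : nat -> R) : 1 <= p ->
  (lp_norm p (fun n => (c n)%:E) <= 1)%E -> (nsum (fun n => (c n `^ p)%R) <= 1)%E.
Proof.
move=> p1 c1; have p0 : 0 < p by rewrite (lt_le_trans ltr01).
have := le_poweR (ltW p0) (lp_norm_ge0 _ _) c1.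
rewrite poweR1r /lp_norm -poweRrM mulVf ?gt_eqF// poweRe1; last first.
  by apply: nneseries_ge0 => *; exact: poweR_ge0.
by rewrite /nsum; under eq_eseriesr do rewrite poweR_EFin.
Qed.

Lemma nsum_le_lp_norm p (c : nat -> R) (A : R) : 1 <= p -> nonneg c -> 0 <= A ->
  (nsum (fun n => (c n `^ p)%R) <= (A `^ p)%:E)%E ->
  (lp_norm p (fun n => (c n)%:E) <= A%:E)%E.
Proof.
move=> p1 c0 A0 cA; have p0 : 0 < p by rewrite (lt_le_trans ltr01).
have -> : A%:E = ((A `^ p)%:E `^ p^-1)%E.
  by rewrite poweR_EFin -powRrM divff ?gt_eqF// powRr1.
apply: le_poweR; first by rewrite invr_ge0 ltW.
  by apply: nneseries_ge0 => *; exact: poweR_ge0.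
by apply: le_trans cA; rewrite /nsum; under eq_eseriesr do rewrite poweR_EFin.
Qed.

End lp_norm_sums.

(** * Limits along an ultrafilter *)

Section ultrafilters.
Context {R : realType}.

(** Ultrafilters select limits of infinitely many bounded coordinates at once,
    in place of a diagonal extraction. *)
Lemma ultra_map (I T : Type) (U : set_system I) (g : I -> T) :
  UltraFilter U -> UltraFilter (g @ U).
Proof.
move=> UU; split; first exact: fmap_proper_filter.
move=> G GG UG; apply/seteqP; split=> // A GA.
have [//|UA] := in_ultra_setVsetC (g @^-1` A) UU.
have GnA : G (~` A) by exact: UG.
by have := filter_ex (filterI GA GnA) => -[x []].
Qed.

Lemma ultra_bounded_cvg (I : Type) (U : set_system I) (g : I -> R) (B : R) :
  UltraFilter U -> (forall i, `|g i| <= B) -> exists l : R, g @ U --> l.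
Proof.
move=> UU gB; have := @segment_compact R (- B) B; rewrite compact_ultra => cB.
have [] := cB _ (ultra_map g UU).
  rewrite /fmap/= (_ : _ @^-1` _ = setT); first exact: filterT.
  by apply/seteqP; split=> // i _ /=; rewrite in_itv/= -ler_norml.
by move=> l [_ gl]; exists l.
Qed.

Lemma ultra_eventually : exists U : set_system nat,
  UltraFilter U /\ \oo `<=` U.
Proof. exact: ultraFilterLemma. Qed.

Lemma cvg_powR (I : Type) (U : set_system I) {FU : Filter U} (x : I -> R) (l r : R) :
  0 < r -> (forall i, 0 <= x i) -> 0 <= l -> x @ U --> l ->
  (fun i => x i `^ r) @ U --> l `^ r.
Proof.
move=> r0 x0; rewrite le_eqVlt => /predU1P[<-|l0] xl.
  rewrite powR0 ?gt_eqF//; apply/cvgrPdist_lt => e e0.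
  have e1 : 0 < e `^ r^-1 by exact: powR_gt0.
  move/cvgrPdist_lt : xl => /(_ _ e1); apply: filterS => i.
  rewrite !sub0r !normrN !ger0_norm ?powR_ge0// => xe.
  have -> : e = (e `^ r^-1) `^ r by rewrite -powRrM mulVf ?gt_eqF// powRr1// ltW.
  by apply: gt0_ltr_powR; rewrite ?nnegrE ?powR_ge0.
apply: (@continuous_cvg _ _ _ U FU x (fun y : R => y `^ r) l) => //.
apply: differentiable_continuous; apply/derivable1_diffP; apply: derivable_powR.
by rewrite in_itv/= l0.
Qed.

End ultrafilters.

(** * Weak limits in weighted sequence spaces *)

Section weak_limits.
Context {R : realType}.
Implicit Types (a b : nat -> R).

Lemma nsum_pairing_le (p C D : R) a b g : 1 < p -> nonneg a -> nonneg b -> nonneg g ->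
  (nsum (fun j => (a j * g j `^ conj_exp p)%R) <= C%:E)%E ->
  (nsum (fun j => (a j * b j `^ p)%R) <= D%:E)%E ->
  (nsum (fun j => (a j * g j * b j)%R) <= (C `^ (1 - p^-1) * D `^ p^-1)%:E)%E.
Proof.
move=> p1 a0 b0 g0 gC bD.
have p0 : 0 < p by rewrite (lt_trans ltr01).
have q1 := conj_exp_gt1 p1; have q0 : 0 < conj_exp p by rewrite (lt_trans ltr01).
have th01 : 0 < p^-1 < 1 by rewrite invr_gt0 p0 invf_lt1.
have f0 : nonneg (fun j => a j * b j `^ p) by move=> j; rewrite mulr_ge0// powR_ge0.
have h0 : nonneg (fun j => a j * g j `^ conj_exp p).
  by move=> j; rewrite mulr_ge0// powR_ge0.
rewrite [_ `^ _ * _]mulrC; apply: le_trans (nsum_hoelder_le th01 f0 h0 bD gC).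
apply: le_nsum => [j|j]; first by rewrite !mulr_ge0.
rewrite !powRM ?powR_ge0// -!powRrM divff ?gt_eqF// powRr1// -conj_expV//.
rewrite divff ?gt_eqF// powRr1// mulrACA conj_expV// -powRD ?addrNK.
  by rewrite addrC subrK powRr1// -mulrA [b j * _]mulrC.
by rewrite addrC subrK oner_eq0.
Qed.

(** The tails are uniformly small by Hoelder's inequality, and a finite part
    converges coordinatewise. *)
Lemma weak_limit_le (U : set_system nat) {FU : ProperFilter U} (p C v : R)
    a b (s : nat -> R) (g : nat -> nat -> R) (l : nat -> R) :
  1 < p -> nonneg a -> nonneg b -> (forall i, nonneg (g i)) -> nonneg l ->
  (forall i, nsum (fun j => (a j * g i j `^ conj_exp p)%R) <= C%:E)%E ->
  (nsum (fun j => (a j * b j `^ p)%R) < +oo)%E ->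
  (forall j, g^~ j @ U --> l j) -> s @ U --> (0 : R) ->
  (forall i, v%:E <= (s i)%:E + nsum (fun j => (a j * g i j * b j)%R))%E ->
  (v%:E <= nsum (fun j => (a j * l j * b j)%R))%E.
Proof.
move=> p1 a0 b0 g0 l0 gC bD gl s0 vs; apply/lee_addgt0Pr => e e0.
have p0 : 0 < p by rewrite (lt_trans ltr01).
pose c := C `^ (1 - p^-1); have c0 : 0 < c + 1 by rewrite ltr_wpDl// powR_ge0.
pose d := e / (c + 1); have d0 : 0 < d by rewrite divr_gt0.
have nb : nonneg (fun j => a j * b j `^ p) by move=> j; rewrite mulr_ge0// powR_ge0.
have [N Nd] := nsum_tail_small nb bD (powR_gt0 p d0).
have gb0 i : nonneg (fun j => a j * g i j * b j) by move=> j; rewrite !mulr_ge0//; exact: g0.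
have tl i : (nsum (tail N (fun j => a j * g i j * b j)%R) <= e%:E)%E.
  apply: (@le_trans _ _ (c * d)%:E); last first.
    by rewrite lee_fin /d mulrA ler_pdivrMr// mulrC mulrDr mulr1 lerDl ltW.
  pose b' := tail N b; have b'0 : nonneg b' by exact: tail_ge0.
  have bD' : (nsum (fun j => (a j * b' j `^ p)%R) <= (d `^ p)%:E)%E.
    apply: le_trans Nd; apply: le_nsum => j.
      by rewrite mulr_ge0// powR_ge0.
    by rewrite /b' /tail; case: ifP => // _; rewrite powR0 ?mulr0// gt_eqF.
  have := nsum_pairing_le p1 a0 b'0 (g0 i) (gC i) bD'.
  rewrite -powRrM divff ?gt_eqF// powRr1 ?(ltW d0)// => h; apply: (le_trans _ h).
  apply: le_nsum => j; first exact: (tail_ge0 N (gb0 i)).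
  by rewrite /b' /tail; case: ifP => // _; rewrite mulr0.
have lb0 : nonneg (fun j => a j * l j * b j) by move=> j; rewrite !mulr_ge0.
have fin i : v <= s i + \sum_(j < N) a j * g i j * b j + e.
  have := vs i; rewrite (nsum_split N (gb0 i)) => /le_trans/(_ (leeD2l _ (leeD2l _ (tl i)))).
  by rewrite -!EFinD lee_fin addrA.
apply: (@le_trans _ _ ((\sum_(j < N) a j * l j * b j)%:E + e%:E)%E); last first.
  by rewrite leeD2r// psum_le_nsum.
rewrite -EFinD lee_fin.
apply: (@ler_cvg_to _ U FU R (cst v) (fun i => s i + \sum_(j < N) a j * g i j * b j + e)).
- exact: cvg_cst.
- rewrite -[X in _ --> X + e]add0r; apply: cvgD; last exact: cvg_cst.
  apply: cvgD => //; apply: cvg_big => [|j _]; first exact: add_continuous.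
  apply: cvgMr_tmp; apply: cvgMl_tmp; exact: gl.
- by apply: nearW.
Qed.

(** Lower semicontinuity of the norm for coordinatewise convergence. *)
Lemma weak_limit_nsum (U : set_system nat) {FU : ProperFilter U} (q C : R)
    a (C_ : nat -> R) (g : nat -> nat -> R) (l : nat -> R) :
  0 < q -> nonneg a -> (forall i, nonneg (g i)) -> nonneg l ->
  (forall i, nsum (fun j => (a j * g i j `^ q)%R) <= (C_ i)%:E)%E ->
  C_ @ U --> C -> (forall j, g^~ j @ U --> l j) ->
  (nsum (fun j => (a j * l j `^ q)%R) <= C%:E)%E.
Proof.
move=> q0 a0 g0 l0 gC CC gl.
have n0 (h : nat -> R) : nonneg h -> nonneg (fun j => a j * h j `^ q).
  by move=> h0 j; rewrite mulr_ge0// powR_ge0.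
apply/nsum_leP => [|N]; first exact: n0.
apply: (@ler_cvg_to _ U FU R (fun i => \sum_(j < N) a j * g i j `^ q) C_) => //.
  apply: cvg_big => [|j _]; first exact: add_continuous.
  by apply: cvgMl_tmp; apply: cvg_powR => [//|i|//|]; [exact: g0|exact: gl].
by apply: nearW => i; move/nsum_leP : (gC i); apply; exact: n0.
Qed.

End weak_limits.

(** * Functionals dominated by a weighted norm *)

Section domination.
Context {R : realType}.

(** Near-minimisers x_i below satisfy |t(x_i)|_p ^ p <= 2 / (1 - 1/p), and the
    factor p ^ p' comes from differentiating |t(x)|_p ^ p. *)
Definition dom_const (p : R) : R := p `^ conj_exp p * (2 / (1 - p^-1)).

(** A linear functional dominated by the weighted l^p norm of (t_j)_j is also
    dominated by the pairing of (t_j)_j with a single element of the dual l^p'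
    space, of bounded norm.  Near-minimisers
    x_i of the functional |t(x)|_p ^ p - psi(x) have a weak limit along an
    ultrafilter, and the Euler inequality at x_i passes to this limit.

    In the application psi is the real part of a scalar-valued functional, t_j
    is a multiple of the modulus of another one, and scale s multiplies by the
    positive real s: the argument is the same for real and for complex scalars because it uses
    nothing but positive homogeneity. *)
Lemma lp_dual_domination (X : zmodType) (scale : R -> X -> X) (p : R)
    (a : nat -> R) (t : nat -> X -> R) (psi : X -> R) :
  1 < p -> (forall j, 0 < a j) -> (forall j x, 0 <= t j x) ->
  (forall j, t j 0 = 0) ->
  (forall j x y, t j (x + y) <= t j x + t j y) ->
  (forall j s x, 0 < s -> t j (scale s x) = s * t j x) ->
  (forall x y, psi (x + y) = psi x + psi y) ->
  (forall s x, 0 < s -> psi (scale s x) = s * psi x) ->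
  (forall x, nsum (fun j => (a j * t j x `^ p)%R) < +oo)%E ->
  (forall x, 0 <= psi x ->
     ((psi x `^ p)%:E <= nsum (fun j => (a j * t j x `^ p)%R))%E) ->
  exists d : nat -> R, [/\ nonneg d,
    (nsum (fun j => (a j * d j `^ conj_exp p)%R) <= (dom_const p)%:E)%E &
    forall y, ((psi y)%:E <= nsum (fun j => (a j * d j * t j y)%R))%E].
Proof.
move=> p1 a_gt0 t0 t00 tD tZ psiD psiZ tfin psi_le.
have a0 : nonneg a by move=> j; exact: ltW.
have p0 : 0 < p by rewrite (lt_trans ltr01).
have q1 := conj_exp_gt1 p1; have q0 : 0 < conj_exp p by rewrite (lt_trans ltr01).
have pV1 : 0 < 1 - p^-1 by rewrite subr_gt0 invf_lt1.
have n0 (h : nat -> R) r : nonneg (fun j => a j * h j `^ r).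
  by move=> j; rewrite mulr_ge0// powR_ge0.
pose I x := fine (nsum (fun j => a j * t j x `^ p)).
have IE x : nsum (fun j => a j * t j x `^ p) = (I x)%:E.
  by have [C C0 CE] := nsum_fin (n0 _ _) (tfin x); rewrite /I CE.
have I0 x : 0 <= I x by rewrite -lee_fin -IE nsum_ge0.
have psi0 : psi 0 = 0 by apply: (addrI (psi 0)); rewrite -psiD !addr0.
(* Young's inequality for psi x and 1; it bounds Phi from below. *)
have psiI x : psi x <= I x / p + 1.
  have [px|/ltW px] := leP 0 (psi x); last first.
    by rewrite (le_trans px)// addr_ge0// divr_ge0// ltW.
  have := conjugate_powR px ler01 p0 q0 (conj_exp_conj p1).
  rewrite mulr1 powR1 => /le_trans; apply; apply: lerD.
    by rewrite ler_pM2r ?invr_gt0// -lee_fin -IE psi_le.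
  by rewrite ler_pdivrMr// mul1r ltW.
pose Phi x := I x - psi x.
have Phi_ge x : I x * (1 - p^-1) - 1 <= Phi x.
  rewrite /Phi mulrBr mulr1 -addrA -opprD lerD2l lerN2; exact: psiI.
have lbP : has_inf (range Phi).
  split; first by exists (Phi 0); exists 0.
  exists (-1) => _ [x _ <-]; apply: le_trans (Phi_ge x).
  by rewrite lerDr mulr_ge0// ltW.
pose m := inf (range Phi).
have mP x : m <= Phi x by apply: ge_inf; [case: lbP|exists x].
have Phi0 : Phi 0 = 0.
  rewrite /Phi psi0 subr0 /I (eq_nsum (t := fun=> 0)) ?nsum0// => j.
  by rewrite t00 powR0 ?mulr0// gt_eqF.
have m0 : m <= 0 by rewrite -Phi0.
(* x_i is tested against x_i + s_i y, a step that changes psi by the order s_i: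
   the defect of minimality must be of smaller order, hence s_i ^ 2. *)
pose s i : R := i.+1%:R^-1.
have s0 i : 0 < s i by rewrite invr_gt0 ltr0n.
have s1 i : s i <= 1 by rewrite invf_le1 ?ltr0n// ler1n.
have /choice[x xP] : forall i, exists x, Phi x < m + s i ^+ 2.
  move=> i; have [] := inf_adherent (eps := s i ^+ 2) _ lbP; first by rewrite exprn_gt0.
  by move=> _ [x _ <-]; exists x.
pose C := 2 / (1 - p^-1).
have IC i : I (x i) <= C.
  rewrite /C ler_pdivlMr// -lerBlDr.
  apply: (le_trans (Phi_ge (x i))); apply: (le_trans (ltW (xP i))).
  have : s i ^+ 2 <= 1 by rewrite expr_le1// ltW.
  by move=> h; lra.
have [U [UU Uoo]] := ultra_eventually.
have tau_ex j : exists l : R, (fun i => t j (x i)) @ U --> l.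
  apply: (@ultra_bounded_cvg _ _ _ _ ((C / a j) `^ p^-1)) => i.
  rewrite ger0_norm//.
  have -> : t j (x i) = (t j (x i) `^ p) `^ p^-1.
    by rewrite -powRrM divff ?gt_eqF// powRr1.
  apply: ge0_ler_powR; rewrite ?nnegrE ?invr_ge0 ?(ltW p0) ?powR_ge0//.
    by rewrite divr_ge0// (le_trans (I0 (x 0%N)))// IC.
  rewrite ler_pdivlMr// mulrC.
  have := @term_le_nsum R (fun j => a j * t j (x i) `^ p) C j (n0 _ _).
  by rewrite IE lee_fin; apply.
have [tau tauP] := choice tau_ex.
have tau0 j : 0 <= tau j.
  apply: (@ler_cvg_to _ U _ R (cst 0) (fun i => t j (x i))) => //.
    exact: cvg_cst.
  by apply: nearW.
exists (fun j => p * tau j `^ (p - 1)); split.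
- by move=> j; rewrite mulr_ge0 ?powR_ge0// ltW.
- rewrite (eq_nsum (t := fun j => p `^ conj_exp p * (a j * tau j `^ p))); last first.
    move=> j; rewrite powRM ?powR_ge0 ?(ltW p0)// powR_conj_exp//.
    by rewrite mulrCA.
  rewrite nsumZ ?EFinM; last exact: n0.
  rewrite lee_wpmul2l ?lee_fin ?powR_ge0//.
  apply: (@weak_limit_nsum _ U _ p C a (cst C) (fun i j => t j (x i))).
  + exact: p0.
  + exact: a0.
  + by move=> i j; exact: t0.
  + exact: tau0.
  + by move=> i; rewrite IE lee_fin; exact: IC.
  + exact: cvg_cst.
  + exact: tauP.
move=> y; pose b j := t j y.
have b0 : nonneg b by move=> j; exact: t0.
pose v i j := t j (x i) + s i * b j.
have v0 i j : 0 <= v i j by rewrite addr_ge0// mulr_ge0// ltW.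
pose g i j := p * v i j `^ (p - 1).
have g0 i : nonneg (g i) by move=> j; rewrite mulr_ge0 ?powR_ge0// ltW.
have sU : s @ U --> (0 : R).
  by apply: (cvg_trans _ (@cvg_harmonic R)); exact: cvg_app.
(* The Euler inequality at x_i involves (t(x_i) + s_i t(y)) ^ (p - 1), which is
   bounded in L^p'(a) and converges coordinatewise to tau ^ (p - 1). *)
apply: (@weak_limit_le _ U _ p (p `^ conj_exp p * (2 `^ p * (C + I y))) _ a b s g) => //.
- by move=> j; rewrite mulr_ge0 ?powR_ge0// ltW.
- move=> i; apply: (@le_trans _ _ (nsum (fun j => p `^ conj_exp p * (2 `^ p *
      (a j * t j (x i) `^ p + a j * b j `^ p))))).
    apply: le_nsum => j; first exact: n0.
    rewrite /g powRM ?powR_ge0 ?(ltW p0)// powR_conj_exp// mulrCA.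
    rewrite ler_wpM2l ?powR_ge0// -mulrDr mulrCA ler_wpM2l//.
    apply: (@le_trans _ _ ((t j (x i) + b j) `^ p)).
      apply: ge0_ler_powR; rewrite ?nnegrE ?addr_ge0 ?mulr_ge0 ?(ltW p0) ?(ltW (s0 i))//.
      by rewrite lerD2l ler_piMl.
    exact: powRD_le.
  have S0 : nonneg (fun j => a j * t j (x i) `^ p + a j * b j `^ p).
    by move=> j; rewrite addr_ge0// mulr_ge0// powR_ge0.
  rewrite nsumZ; last by move=> j; rewrite mulr_ge0 ?powR_ge0// S0.
  rewrite nsumZ// nsumD; [|exact: n0|exact: n0].
  rewrite IE IE -EFinD -!EFinM lee_fin.
  by rewrite !ler_wpM2l ?powR_ge0// lerD2r.
- exact: tfin.
- move=> j; apply: cvgMl_tmp; apply: cvg_powR; rewrite ?subr_gt0//.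
  rewrite -[X in _ --> X]addr0 -[X in _ --> _ + X](mul0r (b j)).
  by apply: cvgD => //; exact: cvgMr_tmp.
move=> i.
have h1 : Phi (x i) - s i ^+ 2 <= Phi (x i + scale (s i) y).
  by rewrite lerBlDr; apply: (le_trans (ltW (xP i))); rewrite lerD2r.
have gb0 : nonneg (fun j => a j * g i j * b j).
  by move=> j; exact: mulr_ge0 (mulr_ge0 (a0 j) (g0 i j)) (b0 j).
have [gboo|] := ltP (nsum (fun j => (a j * g i j * b j)%R)) +oo%E; last first.
  by rewrite leye_eq => /eqP ->; rewrite addey// leey.
have [r r0 rE] := nsum_fin gb0 gboo.
have h2 : ((I (x i + scale (s i) y))%:E <= (I (x i))%:E +
    nsum (fun j => (s i * (a j * g i j * b j))%R))%E.
  rewrite -!IE -nsumD; [|exact: n0|by move=> j; exact: mulr_ge0 (ltW (s0 i)) (gb0 j)].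
  apply: le_nsum => j; first by rewrite mulr_ge0// powR_ge0.
  have := powR_tangent p1 (t0 j (x i)) (v0 i j).
  rewrite {1 2}/v addrAC subrr add0r => h3.
  apply: (@le_trans _ _ (a j * v i j `^ p)).
    rewrite ler_wpM2l//; apply: ge0_ler_powR; rewrite ?nnegrE ?(ltW p0)//.
    by rewrite /v -tZ.
  rewrite (_ : s i * _ = a j * (p * (s i * b j) * v i j `^ (p - 1))); last by rewrite /g; ring.
  by rewrite -mulrDr ler_wpM2l// addrC -lerBlDr.
move: h2; rewrite nsumZ// rE -EFinM -!EFinD !lee_fin => h2.
move: h1; rewrite /Phi psiD psiZ// expr2 -(ler_pM2l (s0 i)) => h1; lra.
Qed.

End domination.

(** * Real and complex scalars *)

Section scalars.
Context {R : realType} {k : scalar_kind}.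
Local Notation K := (scalar_field R k).

Definition of_real (r : R) : K :=
  match k return scalar_field R k with
  | RealScalars => r
  | ComplexScalars => (r%:C)%C
  end.

Lemma scalar_re_of_real r : scalar_re (of_real r) = r.
Proof. by rewrite /of_real; case: k. Qed.

Lemma of_real_ge0 r : 0 <= r -> 0 <= of_real r.
Proof. by rewrite /of_real; case: k => //= r0; rewrite lecE /= eqxx. Qed.

Lemma of_real_gt0 r : 0 < r -> 0 < of_real r.
Proof. by rewrite /of_real; case: k => //= r0; rewrite ltcE /= eqxx. Qed.

Lemma rnorm_of_realZ (X : normedModType K) r (x : X) : 0 <= r ->
  rnorm (of_real r *: x) = r * rnorm x.
Proof. by move=> r0; rewrite rnormZ ger0_norm ?of_real_ge0// scalar_re_of_real. Qed.

Lemma rnorm_of_real r : 0 <= r -> rnorm (of_real r : K^o) = r.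
Proof. by move=> r0; rewrite /rnorm ger0_norm ?of_real_ge0// scalar_re_of_real. Qed.

Lemma of_realM r s : of_real (r * s) = of_real r * of_real s.
Proof. by rewrite /of_real; case: k => //=; rewrite rmorphM. Qed.

Lemma of_real1 : of_real 1 = 1.
Proof. by rewrite /of_real; case: k. Qed.

Lemma rnormM (a b : K) : rnorm (a * b : K^o) = rnorm (a : K^o) * rnorm (b : K^o).
Proof. exact: (@rnormZ R k K^o a b). Qed.

Lemma rnormN (X : normedModType K) (x : X) : rnorm (- x) = rnorm x.
Proof. by rewrite /rnorm normrN. Qed.

Lemma rnormBC (X : normedModType K) (x y : X) : rnorm (x - y) = rnorm (y - x).
Proof. by rewrite -rnormN opprB. Qed.

Lemma rnorm_sum (X : normedModType K) (I : Type) (r : seq I) (P : pred I) (f : I -> X) :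
  rnorm (\sum_(i <- r | P i) f i) <= \sum_(i <- r | P i) rnorm (f i).
Proof.
elim/big_ind2 : _ => [|x1 x2 y1 y2 h1 h2|//]; first by rewrite rnorm0.
by rewrite (le_trans (rnormD _ _))// lerD.
Qed.

Lemma rnorm_eq0 (X : normedModType K) (x : X) : rnorm x = 0 -> x = 0.
Proof.
move=> x0; apply/eqP; rewrite -normr_le0; apply: scalar_re_inj_le => //.
by rewrite scalar_re0 -x0.
Qed.

(** The real inner product of the underlying real plane or line. *)
Definition rdot : K -> K -> R :=
  match k return scalar_field R k -> scalar_field R k -> R with
  | RealScalars => fun a b => a * b
  | ComplexScalars => fun a b =>
      complex.Re a * complex.Re b + complex.Im a * complex.Im b
  end.

Lemma rdotC a b : rdot a b = rdot b a.
Proof. by rewrite /rdot; case: k a b => /= a b; rewrite 1?mulrC// [X in _ + X]mulrC. Qed.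

Lemma rdotDl a b c : rdot (a + b) c = rdot a c + rdot b c.
Proof.
rewrite /rdot; case: k a b c => /= [a b c|[a a'] [b b'] [c c'] /=]; first by rewrite mulrDl.
by rewrite !mulrDl addrACA.
Qed.

Lemma rdot0l b : rdot 0 b = 0.
Proof. by rewrite /rdot; case: k b => /= [b|[b b']]; rewrite /= !mul0r ?addr0. Qed.

Lemma rdotZl r a b : rdot (of_real r * a) b = r * rdot a b.
Proof.
rewrite /rdot /of_real; case: k a b => /= [a b|[a a'] [b b'] /=].
  by rewrite mulrA.
by rewrite !mul0r subr0 addr0 mulrDr !mulrA.
Qed.

Lemma rdotaa a : rdot a a = rnorm (a : K^o) ^+ 2.
Proof.
rewrite /rdot /rnorm; case: k a => /= [a|[a a']] /=.
  by rewrite real_normK ?num_real// expr2.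
by rewrite sqr_sqrtr ?addr_ge0 ?sqr_ge0// !expr2.
Qed.

(** Stands in for sesquilinearity: c' is the conjugate of c, and orthogonality
    for the real form to a space stable under scalars is stable too. *)
Lemma rdot_adj (c : K) : exists c' : K, forall a b, rdot (c * a) b = rdot a (c' * b).
Proof.
rewrite /rdot; case: k c => /= [c|[c d]]; first by exists c => a b; ring.
by exists (c -i* d)%C => -[a a'] [b b'] /=; ring.
Qed.

Lemma rdot_le a b : `|rdot a b| <= (rnorm (a : K^o) ^+ 2 + rnorm (b : K^o) ^+ 2) / 2.
Proof.
have h x y : rdot (x + y) (x + y) = rdot x x + 2 * rdot x y + rdot y y.
  by rewrite rdotDl ![rdot _ (_ + _)]rdotC !rdotDl [rdot y x]rdotC; ring.
have N a' b' : rdot (of_real (-1) * a') b' = - rdot a' b' by rewrite rdotZl mulN1r.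
have h1 : 0 <= rdot (a + b) (a + b) by rewrite rdotaa sqr_ge0.
have h2 : 0 <= rdot (of_real (-1) * a + b) (of_real (-1) * a + b) by rewrite rdotaa sqr_ge0.
have e : rdot (of_real (-1) * a) (of_real (-1) * a) = rdot a a.
  by rewrite N rdotC N opprK.
rewrite h in h1; rewrite h e N in h2; rewrite -!rdotaa ler_norml.
by apply/andP; split; lra.
Qed.

Lemma scalar_re_le_rnorm (a : K) : scalar_re a <= rnorm (a : K^o).
Proof.
rewrite /rnorm; case: k a => /= [a|[a a']] /=; first exact: ler_norm.
apply: (le_trans (ler_norm a)); rewrite -sqrtr_sqr ler_sqrt ?lerDl ?sqr_ge0//.
by rewrite addr_ge0 ?sqr_ge0.
Qed.

Lemma scalar_re_of_realM r (a : K) : scalar_re (of_real r * a) = r * scalar_re a.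
Proof.
rewrite /of_real; case: k a => //= -[a a'] /=.
by rewrite mul0r subr0.
Qed.

(** A rotation th turns the modulus of a scalar into a real part, so that
    estimates of real parts of functionals extend to moduli. *)
Lemma scalar_phase (z : K) : exists2 th : K, rnorm (th : K^o) <= 1 &
  scalar_re (th * z) = rnorm (z : K^o).
Proof.
have [->|z0] := eqVneq z 0.
  by exists 0; rewrite ?mulr0 ?scalar_re0 rnorm0// ler01.
have rz : rnorm (z : K^o) != 0.
  by apply: contra_neq z0; exact: (@rnorm_eq0 K^o).
have [z' zE] : exists z' : K, scalar_re (z' * z) = rnorm (z : K^o) ^+ 2 /\
    rnorm (z' : K^o) = rnorm (z : K^o).
  move: z {z0 rz}; rewrite /rnorm; case: k => /= [z|[z w]].
    by exists z; rewrite real_normK ?num_real.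
  exists (z -i* w)%C => /=; rewrite sqr_sqrtr ?addr_ge0 ?sqr_ge0// sqrrN.
  by split=> //; rewrite !expr2 mulNr opprK.
have rz0 : 0 <= rnorm (z : K^o) by exact: rnorm_ge0.
exists (of_real (rnorm (z : K^o))^-1 * z').
  by rewrite rnormM rnorm_of_real ?invr_ge0// zE.2 mulVf.
by rewrite -mulrA scalar_re_of_realM zE.1 expr2 mulKf.
Qed.

(** Convergence is expressed by real norms, which is uniform in the two kinds of
    scalars. *)
Lemma ultra_bounded_cvg_scalar (U : set_system nat) (g : nat -> K) (B : R) :
  UltraFilter U -> (forall i, rnorm (g i : K^o) <= B) ->
  exists l : K, (fun i => rnorm (g i - l : K^o)) @ U --> (0 : R).
Proof.
move=> UU; rewrite /rnorm; case: k g => /= g gB.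
  have [l gl] := @ultra_bounded_cvg R nat U g B UU gB.
  exists l; apply/cvgr0Pnorm_lt => e e0; move/cvgrPdist_lt : gl => /(_ _ e0).
  by apply: filterS => i; rewrite normr_id distrC.
have gBr i : `|complex.Re (g i)| <= B.
  apply: le_trans (gB i); case: (g i) => x y /=.
  by rewrite -sqrtr_sqr ler_sqrt ?lerDl ?sqr_ge0// addr_ge0 ?sqr_ge0.
have gBi i : `|complex.Im (g i)| <= B.
  apply: le_trans (gB i); case: (g i) => x y /=.
  by rewrite -sqrtr_sqr ler_sqrt ?lerDr ?sqr_ge0// addr_ge0 ?sqr_ge0.
have [l gl] := @ultra_bounded_cvg R nat U (fun i => complex.Re (g i)) B UU gBr.
have [m gm] := @ultra_bounded_cvg R nat U (fun i => complex.Im (g i)) B UU gBi.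
exists (l +i* m)%C; apply/cvgr0Pnorm_lt => e e0.
have e2 : 0 < e / 2 by rewrite divr_gt0.
move/cvgrPdist_lt : gl => /(_ _ e2); move/cvgrPdist_lt : gm => /(_ _ e2).
apply: filterS2 => i; case: (g i) => x y /= h1 h2.
rewrite ger0_norm ?sqrtr_ge0//.
have e0' := ltW e0.
rewrite -[ltRHS]ger0_norm// -sqrtr_sqr ltr_sqrt ?exprn_gt0//.
rewrite distrC in h1; rewrite distrC in h2.
have a1 : (x - l) ^+ 2 <= (e / 2) ^+ 2.
  by rewrite -[leLHS]real_normK ?num_real// lerXn2r ?nnegrE ?(ltW h2) ?(ltW e2).
have a2 : (y - m) ^+ 2 <= (e / 2) ^+ 2.
  by rewrite -[leLHS]real_normK ?num_real// lerXn2r ?nnegrE ?(ltW h1) ?(ltW e2).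
have a3 : 0 < e ^+ 2 by rewrite exprn_gt0.
apply: le_lt_trans (lerD a1 a2) _; rewrite expr_div_n; lra.
Qed.

Lemma cvg_rnormP (Y : normedModType K) (s : nat -> Y) (z : Y) :
  s @ \oo --> z <->
  forall e : R, 0 < e -> exists N, forall n, (N <= n)%N -> rnorm (z - s n) <= e.
Proof.
split=> [/cvgrPdist_le sz e e0|h].
  have [N _ NP] := sz _ (of_real_gt0 e0); exists N => n /NP /= /scalar_re_le.
  by rewrite scalar_re_of_real.
apply/cvgrPdist_le => e e0; have [N NP] := h _ (scalar_re_gt0 e0).
exists N => // n /= Nn; apply: scalar_re_inj_le => //; first exact: ltW.
exact: NP.
Qed.

End scalars.

(** * Bounded operators *)

Section bounded_operators.
Context {R : realType} {k : scalar_kind}.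
Local Notation K := (scalar_field R k).
Implicit Types X Y : normedModType K.

Lemma linear_scale X Y (T : X -> Y) (c : K) x : linear T -> T (c *: x) = c *: T x.
Proof.
move=> lT; have T0 : T 0 = 0.
  by have := lT (-1) 0 0; rewrite scaler0 add0r scaleN1r addNr.
by have := lT c x 0; rewrite addr0 T0 addr0.
Qed.

Lemma bounded_op_lin0 X Y (T : X -> Y) : bounded_op T -> T 0 = 0.
Proof. by move=> [lT _]; rewrite -[X in T X](scale0r 0) linear_scale// scale0r. Qed.

Lemma bounded_op_scale X Y (T : X -> Y) (c : K) x : bounded_op T ->
  T (c *: x) = c *: T x.
Proof. by move=> [lT _]; exact: linear_scale. Qed.

Lemma bounded_op_add X Y (T : X -> Y) x y : bounded_op T -> T (x + y) = T x + T y.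
Proof. by move=> [lT _]; have := lT 1 x y; rewrite !scale1r. Qed.

Lemma bounded_opZl X Y (c : K) (T : X -> Y) : bounded_op T ->
  bounded_op (fun x => c *: T x).
Proof. by move=> bT; apply: (bounded_op_comp (bounded_opZ Y c) bT). Qed.

Lemma unit_ball_bound X Y (T : X -> Y) (c : R) : bounded_op T ->
  (forall x, rnorm x <= 1 -> rnorm (T x) <= c) ->
  forall x, rnorm (T x) <= c * rnorm x.
Proof.
move=> bT Tc x; have [x0|x0] := eqVneq (rnorm x) 0.
  by rewrite (rnorm_eq0 x0) (bounded_op_lin0 bT) !rnorm0 mulr0.
have xp : 0 < rnorm x by rewrite lt_neqAle eq_sym x0 rnorm_ge0.
have := Tc (of_real (rnorm x)^-1 *: x).
rewrite bounded_op_scale// !rnorm_of_realZ ?invr_ge0 ?(ltW xp)// mulVf//.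
by move=> /(_ (lexx _)); rewrite ler_pdivrMl// mulrC.
Qed.

Lemma op_norm_le X Y (T : X -> Y) (c : R) : bounded_op T ->
  (op_norm T <= c%:E)%E -> forall x, rnorm (T x) <= c * rnorm x.
Proof.
move=> bT Tc; apply: unit_ball_bound => // x x1; rewrite -lee_fin.
by apply: le_trans Tc; apply: ereal_sup_ubound; exists x.
Qed.

Lemma finite_rank_sum X Y N (u : nat -> X -> K^o) (e : nat -> Y) :
  (forall i, bounded_op (u i)) -> finite_rank (fun x => \sum_(i < N) (u i x : K) *: e i).
Proof.
move=> bu; split; last by exists N, (fun i : 'I_N => e i) => x; exists (fun i => u i x).
split=> [c x y|].
  rewrite scaler_sumr -big_split/=; apply: eq_bigr => i _.
  by have [lu _] := bu i; rewrite lu scalerDl scalerA.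
have /choice[M MP] : forall i, exists M : R, forall x, rnorm (u i x) <= M * rnorm x.
  by move=> i; case: (bu i).
exists (\sum_(i < N) M i * rnorm (e i)) => x; apply: (le_trans (rnorm_sum _ _ _)).
rewrite mulr_suml; apply: ler_sum => i _; rewrite rnormZ mulrAC.
by rewrite ler_wpM2r ?rnorm_ge0//; exact: MP.
Qed.

End bounded_operators.

(** * Weighted square-summable sequences *)

Section weighted_l2.
Context {R : realType} {k : scalar_kind}.
Local Notation K := (scalar_field R k).
Variable a : nat -> R.
Hypothesis a0 : nonneg a.
Implicit Types g h : nat -> K.

Definition sqterm g j := a j * rnorm (g j : K^o) ^+ 2.

Definition l2 g := (nsum (sqterm g) < +oo)%E.

Definition dotterm g h j := a j * rdot (g j) (h j).

Definition dot g h : R := limn (series (dotterm g h)).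

Lemma sqterm_ge0 g : nonneg (sqterm g).
Proof. by move=> j; rewrite mulr_ge0// sqr_ge0. Qed.

Lemma sqtermE g : sqterm g = dotterm g g.
Proof. by apply/funext => j; rewrite /sqterm /dotterm rdotaa. Qed.

Lemma l2_le g h : (forall j, rnorm (g j : K^o) <= rnorm (h j : K^o)) -> l2 h -> l2 g.
Proof.
move=> gh; apply: le_lt_trans; apply: le_nsum => [|j]; first exact: sqterm_ge0.
by rewrite ler_wpM2l// lerXn2r// nnegrE rnorm_ge0.
Qed.

Lemma l2Z (c : K) g : l2 g -> l2 (fun j => c * g j).
Proof.
rewrite /l2 (eq_nsum (s := sqterm (fun j => c * g j))
  (t := fun j => rnorm (c : K^o) ^+ 2 * sqterm g j)); last first.
  by move=> j; rewrite /sqterm rnormM exprMn mulrCA.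
rewrite nsumZ; last exact: sqterm_ge0.
by move=> lg; rewrite lte_mul_pinfty// lee_fin sqr_ge0.
Qed.

Lemma l2D g h : l2 g -> l2 h -> l2 (fun j => g j + h j).
Proof.
move=> lg lh; apply: (@le_lt_trans _ _ (2%:E * (nsum (sqterm g) + nsum (sqterm h)))%E).
  rewrite -nsumD; try exact: sqterm_ge0.
  rewrite -nsumZ; last by move=> j; rewrite addr_ge0// sqterm_ge0.
  apply: le_nsum => [|j]; first exact: sqterm_ge0.
  rewrite /sqterm -mulrDr [leRHS]mulrCA ler_wpM2l//.
  apply: (@le_trans _ _ ((rnorm (g j : K^o) + rnorm (h j : K^o)) ^+ 2)).
    by rewrite lerXn2r ?nnegrE ?addr_ge0 ?rnorm_ge0// (@rnormD _ _ K^o).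
  set x := rnorm _; set y := rnorm _.
  have := sqr_ge0 (x - y); rewrite !expr2; lra.
by rewrite lte_mul_pinfty// lte_add_pinfty.
Qed.

Lemma dot_cvg g h : l2 g -> l2 h -> cvgn (series (dotterm g h)).
Proof.
move=> lg lh; apply: normed_cvg.
pose b j := 2^-1 * (sqterm g j + sqterm h j).
have s0 : nonneg (fun j => sqterm g j + sqterm h j).
  by move=> j; rewrite addr_ge0// sqterm_ge0.
have b0 : nonneg b by move=> j; rewrite mulr_ge0.
apply: (@series_le_cvg _ _ b) => [j||j|].
- exact: normr_ge0.
- exact: b0.
- rewrite /= /dotterm normrM (ger0_norm (a0 j)).
  apply: (le_trans (ler_wpM2l (a0 j) (rdot_le _ _))).
  by rewrite /b /sqterm -mulrDr mulrA mulrC.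
apply: nnseries_is_cvg; first exact: b0.
rewrite -/(nsum b) nsumZ// nsumD; try exact: sqterm_ge0.
by rewrite lte_mul_pinfty// lte_add_pinfty.
Qed.

Lemma dotC g h : dot g h = dot h g.
Proof.
by rewrite /dot (_ : dotterm g h = dotterm h g)//; apply/funext => j; rewrite /dotterm rdotC.
Qed.

Lemma dotDl g1 g2 h : l2 g1 -> l2 g2 -> l2 h ->
  dot (fun j => g1 j + g2 j) h = dot g1 h + dot g2 h.
Proof.
move=> l1 l2' lh; rewrite /dot -lim_seriesD; try exact: dot_cvg.
by congr (limn (series _)); apply/funext => j; rewrite /dotterm rdotDl mulrDr.
Qed.

Lemma dotDr g1 g2 h : l2 g1 -> l2 g2 -> l2 h ->
  dot h (fun j => g1 j + g2 j) = dot h g1 + dot h g2.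
Proof. by move=> *; rewrite dotC dotDl// dotC [X in _ + X]dotC. Qed.

Lemma dotZl (r : R) g h : l2 g -> l2 h ->
  dot (fun j => of_real r * g j) h = r * dot g h.
Proof.
move=> lg lh; rewrite /dot -[RHS]/(r *: limn _) -lim_seriesZ; last exact: dot_cvg.
congr (limn (series _)); apply/funext => j.
by rewrite /dotterm rdotZl mulrCA.
Qed.

Lemma dot_adj (c : K) : exists c' : K, forall g h,
  dot (fun j => c * g j) h = dot g (fun j => c' * h j).
Proof.
have [c' cE] := rdot_adj c; exists c' => g h; rewrite /dot.
by congr (limn (series _)); apply/funext => j; rewrite /dotterm cE.
Qed.

Lemma dotgg g : l2 g -> nsum (sqterm g) = (dot g g)%:E.
Proof.
move=> lg; rewrite /nsum; apply/cvg_lim => //.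
rewrite (_ : (fun n => _) = EFin \o series (dotterm g g)).
  by apply: cvg_EFin; [exact: nearW|exact: (dot_cvg lg lg)].
by apply/funext => n /=; rewrite sumEFin -sqtermE.
Qed.

Lemma dotgg_ge0 g : l2 g -> 0 <= dot g g.
Proof. by move=> lg; rewrite -lee_fin -dotgg// nsum_ge0//; exact: sqterm_ge0. Qed.

Lemma dotD_sqr g h (t : R) : l2 g -> l2 h ->
  dot (fun j => g j + of_real t * h j) (fun j => g j + of_real t * h j) =
  dot g g + 2 * t * dot g h + t ^+ 2 * dot h h.
Proof.
move=> lg lh; have lt := l2Z (of_real t) lh; have ls := l2D lg lt.
have tr g' : l2 g' -> dot g' (fun j => of_real t * h j) = t * dot g' h.
  by move=> lg'; rewrite dotC dotZl// dotC.
by rewrite dotDl// !dotDr// !tr// !dotZl// [dot h g]dotC; ring.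
Qed.

(** A near-minimiser of the distance is nearly orthogonal to the directions in
    which one may move. *)
Lemma near_minimal_dot g h (e : R) : l2 g -> l2 h ->
  (forall t : R, dot g g - e <=
     dot (fun j => g j + of_real t * h j) (fun j => g j + of_real t * h j)) ->
  forall t, 0 < t -> dot g h <= e / (2 * t) + t * dot h h / 2.
Proof.
move=> lg lh gm t t0; have := gm (- t); rewrite dotD_sqr// sqrrN => h1.
rewrite -(ler_pM2l (_ : 0 < 2 * t)) ?mulr_gt0// mulrDr mulrCA divff ?mulf_neq0 ?gt_eqF//.
by rewrite mulr1; move: h1; rewrite expr2; lra.
Qed.

Lemma minimal_dot g h : l2 g -> l2 h ->
  (forall t : R, dot g g <=
     dot (fun j => g j + of_real t * h j) (fun j => g j + of_real t * h j)) ->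
  dot g h = 0.
Proof.
move=> lg lh gm; have hh := dotgg_ge0 lh; have {}gm t := gm t.
apply/eqP/negPn/negP => d0.
have := gm (- (dot g h / (dot h h + 1))); rewrite dotD_sqr//.
have h1 : 0 < dot h h + 1 by rewrite ltr_wpDl.
set d := dot g h in d0 *; set c := dot h h in hh h1 *; set q := d / (c + 1).
have dE : d = q * (c + 1) by rewrite /q divfK ?gt_eqF.
have q0 : 0 < q ^+ 2.
  by rewrite lt_neqAle sqr_ge0 andbT eq_sym sqrf_eq0 /q mulf_neq0// invr_eq0 gt_eqF.
rewrite dE sqrrN expr2 in q0 *; nra.
Qed.

End weighted_l2.

(** * Quasi nuclear operators in weighted form *)

Section weighted_qn.
Context {R : realType} {k : scalar_kind}.
Local Notation K := (scalar_field R k).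
Implicit Types (X Y Z : normedModType K) (p q r : R) (a b : nat -> R).

(** Positivity makes every coordinate a bounded function on bounded sets of
    L^p(a), so that coordinatewise limits exist. *)
Definition weights a := (forall j, 0 < a j) /\ (nsum a < +oo)%E.

Lemma weights_ge0 a : weights a -> nonneg a.
Proof. by move=> [a0 _] j; exact: ltW. Qed.

Definition unit_functionals X (u : nat -> X -> K^o) :=
  forall j, bounded_op (u j) /\ forall x, rnorm (u j x) <= rnorm x.

Definition qn_dominated X Y p a (u : nat -> X -> K^o) (C : R) (T : X -> Y) :=
  forall x, ((rnorm (T x) `^ p)%:E <=
    C%:E * nsum (fun j => (a j * rnorm (u j x) `^ p)%R))%E.

Definition weighted_qn X Y p (T : X -> Y) :=
  bounded_op T /\ exists a u C,
  [/\ weights a, unit_functionals u, 0 <= C & qn_dominated p a u C T].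

(** Lets one divide by weights built from norms that may vanish. *)
Lemma add_geometric (c : nat -> R) : nonneg c -> (nsum c < +oo)%E ->
  weights (fun j => c j + 1 / (2 ^ j.+1)%:R).
Proof.
move=> c0 coo; split=> [j|].
  by rewrite ltr_wpDl// divr_gt0// ltr0n expn_gt0.
apply: le_lt_trans (@epsilon_trick R (fun j => (c j)%:E) 1 xpredT (fun j => c0 j) ler01) _.
by rewrite lte_add_pinfty// ltry.
Qed.

(** The functional f_n is divided by the p-th root of a_n = |f_n|^p + 2^-(n+1). *)
Lemma QN_weighted X Y p (T : X -> Y) : 1 <= p -> QN p T -> weighted_qn p T.
Proof.
move=> p1 [bT [f [bf foo fT]]]; split=> //.
have p0 : 0 < p by rewrite (lt_le_trans ltr01).
have pN0 : p != 0 by rewrite gt_eqF.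
have oo : (\sum_(0 <= n <oo) op_norm (f n) `^ p < +oo)%E.
  by apply: (lty_poweRy (r := p^-1)); rewrite ?invr_eq0.
have nfin n : exists2 c : R, 0 <= c & op_norm (f n) = c%:E.
  have : (op_norm (f n) `^ p < +oo)%E.
    apply: le_lt_trans oo.
    by apply: (@term_le_eseries R (fun n => op_norm (f n) `^ p)%E) => j; exact: poweR_ge0.
  move=> /(lty_poweRy pN0) fnoo; exists (fine (op_norm (f n))).
    by rewrite fine_ge0// op_norm_ge0.
  by rewrite fineK// ge0_fin_numE// op_norm_ge0.
have {nfin}[c c0 cE] : exists2 c : nat -> R, nonneg c &
    forall n, op_norm (f n) = (c n)%:E.
  have /choice[c cP] : forall n, exists c : R, 0 <= c /\ op_norm (f n) = c%:E.
    by move=> n; have [c c0 cE] := nfin n; exists c.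
  by exists c => n; have [] := cP n.
have cp0 : nonneg (fun n => c n `^ p) by move=> n; exact: powR_ge0.
have coo : (nsum (fun n => (c n `^ p)%R) < +oo)%E.
  by apply: le_lt_trans oo; rewrite /nsum; under [leRHS]eq_eseriesr do rewrite cE poweR_EFin.
pose a n := c n `^ p + 1 / (2 ^ n.+1)%:R.
have wa : weights a := add_geometric cp0 coo.
have a0 n : 0 < a n by case: wa.
have aV0 n : 0 <= a n `^ (- p^-1) by exact: powR_ge0.
pose u n (x : X) : K^o := of_real (a n `^ (- p^-1)) *: f n x.
have uE n x : rnorm (u n x) = a n `^ (- p^-1) * rnorm (f n x) by apply: (@rnorm_of_realZ R k K^o); exact: aV0.
exists a, u, 1; split=> //.
  move=> n; split; first exact: bounded_opZl.
  move=> x; rewrite uE powRN ler_pdivrMl ?powR_gt0//.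
  apply: (@le_trans _ _ (c n * rnorm x)); first by apply: op_norm_le; rewrite ?cE.
  rewrite ler_wpM2r ?rnorm_ge0//.
  have -> : c n = (c n `^ p) `^ p^-1 by rewrite -powRrM divff// powRr1.
  apply: ge0_ler_powR; rewrite ?nnegrE ?invr_ge0 ?powR_ge0 ?(ltW p0) ?(ltW (a0 n))//.
  by rewrite lerDl divr_ge0.
move=> x; rewrite mul1e -poweR_EFin.
have := fT x; rewrite /lp_norm => h.
have : ((rnorm (T x))%:E `^ p <= ((\sum_(0 <= n <oo) (rnorm (f n x))%:E `^ p) `^ p^-1) `^ p)%E.
  by apply: le_poweR; rewrite ?(ltW p0)// lee_fin rnorm_ge0.
rewrite -poweRrM mulVf// poweRe1; last by apply: nneseries_ge0 => *; exact: poweR_ge0.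
move=> /le_trans; apply; rewrite /nsum; apply: lee_nneseries => j *.
  exact: poweR_ge0.
rewrite poweR_EFin lee_fin uE powRM ?rnorm_ge0// -powRrM mulNr mulVf//.
by rewrite powR_inv1 ?(ltW (a0 j))// mulVKf// gt_eqF.
Qed.

Lemma nsum_functionals_fin X p a (u : nat -> X -> K^o) x : 0 <= p ->
  nonneg a -> (nsum a < +oo)%E -> unit_functionals u ->
  (nsum (fun j => (a j * rnorm (u j x) `^ p)%R) < +oo)%E.
Proof.
move=> p0 a0 aoo uu; apply: (@le_lt_trans _ _ ((rnorm x `^ p)%:E * nsum a)%E).
  rewrite -nsumZ//; apply: le_nsum => j; first by rewrite mulr_ge0// powR_ge0.
  rewrite mulrC ler_wpM2r//; apply: ge0_ler_powR; rewrite ?nnegrE ?rnorm_ge0//.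
  by case: (uu j).
by rewrite lte_mul_pinfty// lee_fin powR_ge0.
Qed.

(** Conversely the functionals a_n^(1/p) u_n witness that T is quasi p-nuclear,
    and the total mass of a controls the ideal norm. *)
Lemma weighted_qn_norm X Y p a (u : nat -> X -> K^o) (T : X -> Y) (A : R) : 1 <= p ->
  nonneg a -> (nsum a <= A%:E)%E -> unit_functionals u -> qn_dominated p a u 1 T ->
  exists2 f, qn_seq p T f & (lp_norm p (fun n => op_norm (f n)) <= (A `^ p^-1)%:E)%E.
Proof.
move=> p1 a0 aA uu dT; have p0 : 0 < p by rewrite (lt_le_trans ltr01).
have pN0 : p != 0 by rewrite gt_eqF.
pose f n (x : X) : K^o := of_real (a n `^ p^-1) *: u n x.
have fE n x : rnorm (f n x) = a n `^ p^-1 * rnorm (u n x).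
  by apply: (@rnorm_of_realZ R k K^o); exact: powR_ge0.
have A0 : 0 <= A by rewrite -lee_fin (le_trans _ aA)// nsum_ge0.
have fn n : (op_norm (f n) <= (a n `^ p^-1)%:E)%E.
  apply: ge_ereal_sup => _ [x x1 <-]; rewrite lee_fin fE ler_piMr ?powR_ge0//.
  by apply: le_trans x1; case: (uu n).
have fle : (lp_norm p (fun n => op_norm (f n)) <= (A `^ p^-1)%:E)%E.
  rewrite /lp_norm -poweR_EFin; apply: le_poweR; rewrite ?invr_ge0 ?(ltW p0)//.
    by apply: nneseries_ge0 => *; exact: poweR_ge0.
  apply: le_trans aA; apply: lee_nneseries => j *; first exact: poweR_ge0.
  have -> : (a j)%:E = ((a j `^ p^-1)%:E `^ p)%E.
    by rewrite poweR_EFin -powRrM mulVf// powRr1.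
  by apply: le_poweR; rewrite ?op_norm_ge0 ?(ltW p0).
exists f => //; split.
- by move=> n; apply: bounded_opZl; case: (uu n).
- by apply: le_lt_trans fle _; rewrite ltry.
move=> x; have := dT x; rewrite mul1e -poweR_EFin /lp_norm => h.
have -> : (rnorm (T x))%:E = (((rnorm (T x))%:E `^ p) `^ p^-1)%E.
  by rewrite -poweRrM divff// poweRe1// lee_fin rnorm_ge0.
apply: le_poweR; rewrite ?invr_ge0 ?poweR_ge0 ?(ltW p0)//.
apply: le_trans h _; apply: lee_nneseries => j *.
  by rewrite lee_fin mulr_ge0// powR_ge0.
by rewrite fE poweR_EFin lee_fin powRM ?powR_ge0 ?rnorm_ge0// -powRrM mulVf// powRr1.
Qed.

(** Jensen's inequality for the finite measure a. *)
Lemma qn_dominated_le X Y p q a (u : nat -> X -> K^o) (C A : R) (T : X -> Y) :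
  0 < p -> p <= q -> nonneg a -> (nsum a <= A%:E)%E -> unit_functionals u -> 0 <= C ->
  qn_dominated p a u C T ->
  qn_dominated q a u (C `^ (q / p) * A `^ (q / p - 1)) T.
Proof.
move=> p0 pq a0 aA uu C0 dT x; have q0 : 0 < q by exact: lt_le_trans pq.
have A0 : 0 <= A by rewrite -lee_fin (le_trans _ aA)// nsum_ge0.
have aoo : (nsum a < +oo)%E by apply: le_lt_trans aA _; rewrite ltry.
have s0 r : nonneg (fun j => a j * rnorm (u j x) `^ r).
  by move=> j; rewrite mulr_ge0// powR_ge0.
have [S S0 SE] := nsum_fin (s0 p) (nsum_functionals_fin x (ltW p0) a0 aoo uu).
have [V V0 VE] := nsum_fin (s0 q) (nsum_functionals_fin x (ltW q0) a0 aoo uu).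
have SV : S <= V `^ (p / q) * A `^ (1 - p / q).
  rewrite le_eqVlt in pq; case/predU1P: pq => [pq|pq].
    rewrite pq divff ?gt_eqF// subrr powRr0 mulr1 powRr1// -lee_fin -SE -VE.
    by rewrite pq.
  have th : 0 < p / q < 1 by rewrite divr_gt0//= ltr_pdivrMr// mul1r.
  rewrite -lee_fin -SE; apply: (le_trans _ (nsum_hoelder_le th (s0 q) a0 _ aA)).
    apply: le_nsum => j; first exact: s0.
    rewrite powRM ?powR_ge0// -powRrM [q * _]mulrC divfK ?gt_eqF//.
    rewrite mulrAC -powRD; last by rewrite addrC subrK oner_eq0.
    by rewrite [_ / _ + _]addrC subrK powRr1// mulrC.
  by rewrite VE.
move: (dT x); rewrite SE VE -!EFinM !lee_fin => h.
have qp0 : 0 <= q / p by rewrite divr_ge0 ?ltW.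
have rT : 0 <= rnorm (T x) by exact: rnorm_ge0.
have -> : rnorm (T x) `^ q = (rnorm (T x) `^ p) `^ (q / p).
  by rewrite -powRrM mulrC divfK ?gt_eqF.
apply: (@le_trans _ _ ((C * (V `^ (p / q) * A `^ (1 - p / q))) `^ (q / p))).
  have h' : rnorm (T x) `^ p <= C * (V `^ (p / q) * A `^ (1 - p / q)).
    by apply: (le_trans h); rewrite ler_wpM2l.
  apply: ge0_ler_powR => //; rewrite nnegrE ?powR_ge0//.
  by apply: le_trans h'; exact: powR_ge0.
rewrite !powRM ?mulr_ge0 ?powR_ge0// -!powRrM.
rewrite mulrA [p / q * (q / p)]mulrA divfK ?gt_eqF// divff ?gt_eqF// powRr1//.
rewrite mulrBl mul1r mulrA divfK ?gt_eqF// divff ?gt_eqF//.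
by rewrite -!mulrA ler_wpM2l ?powR_ge0// [leRHS]mulrC.
Qed.

Lemma weighted_qn_le X Y p q (T : X -> Y) : 0 < p -> p <= q ->
  weighted_qn p T -> weighted_qn q T.
Proof.
move=> p0 pq [bT [a [u [C [wa uu C0 dT]]]]]; split=> //.
have a0 := weights_ge0 wa; have [A A0 AE] := nsum_fin a0 wa.2.
exists a, u, (C `^ (q / p) * A `^ (q / p - 1)); split=> //.
  by rewrite mulr_ge0// powR_ge0.
by apply: qn_dominated_le; rewrite ?AE.
Qed.

End weighted_qn.

(** * Composition of quasi nuclear operators *)

Section qn_composition.
Context {R : realType} {k : scalar_kind}.
Local Notation K := (scalar_field R k).
Implicit Types (X Y Z : normedModType K) (p q r : R) (a b : nat -> R).

(** The functional v o T is dominated by the L^p(a) norm of (u_j)_j, hence by the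
    pairing with a density d in the dual space. *)
Lemma functional_domination X Y p a (u : nat -> X -> K^o) (C : R) (T : X -> Y)
    (v : Y -> K^o) : 1 < p -> weights a -> unit_functionals u -> 0 <= C ->
  bounded_op T -> qn_dominated p a u C T ->
  bounded_op v -> (forall y, rnorm (v y) <= rnorm y) ->
  exists d : nat -> R, [/\ nonneg d,
    (nsum (fun j => (a j * d j `^ conj_exp p)%R) <= (dom_const p)%:E)%E &
    forall x, ((rnorm (v (T x)))%:E <=
      (C `^ p^-1)%:E * nsum (fun j => (a j * d j * rnorm (u j x))%R))%E].
Proof.
move=> p1 wa uu C0 bT dT bv v1; have p0 : 0 < p by rewrite (lt_trans ltr01).
have a0 := weights_ge0 wa; set c := C `^ p^-1; have c0 : 0 <= c by exact: powR_ge0.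
have ru j x : 0 <= rnorm (u j x) by exact: rnorm_ge0.
pose t j x := c * rnorm (u j x).
pose psi x := scalar_re (v (T x)).
pose scale s (x : X) := of_real s *: x.
have bvT : bounded_op (v \o T) by exact: bounded_op_comp.
have tE x : nsum (fun j => a j * t j x `^ p) =
    (C%:E * nsum (fun j => (a j * rnorm (u j x) `^ p)%R))%E.
  rewrite -nsumZ; last by move=> j; rewrite mulr_ge0// powR_ge0.
  apply: eq_nsum => j; rewrite /t powRM// -powRrM mulVf ?gt_eqF// powRr1//.
  by rewrite mulrCA.
have [d [d0 dK dP]] : exists d : nat -> R, [/\ nonneg d,
    (nsum (fun j => (a j * d j `^ conj_exp p)%R) <= (dom_const p)%:E)%E &
    forall y, ((psi y)%:E <= nsum (fun j => (a j * d j * t j y)%R))%E].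
  apply: (@lp_dual_domination R X scale p a t psi) => //.
  - by case: wa.
  - by move=> j x; rewrite mulr_ge0.
  - by move=> j; case: (uu j) => bu _; rewrite /t (bounded_op_lin0 bu) rnorm0 mulr0.
  - move=> j x y; case: (uu j) => bu _.
    by rewrite /t (bounded_op_add _ _ bu) -mulrDr ler_wpM2l// rnormD.
  - move=> j s x s0; case: (uu j) => bu _.
    rewrite /t /scale (bounded_op_scale _ _ bu) mulrCA; congr (_ * _).
    by apply: (@rnorm_of_realZ R k K^o); exact: ltW.
  - move=> x y; rewrite /psi (bounded_op_add _ _ bT) (bounded_op_add _ _ bv).
    exact: scalar_reD.
  - move=> s x s0; rewrite /psi /scale (bounded_op_scale _ _ bT).
    by rewrite (bounded_op_scale _ _ bv); exact: scalar_re_of_realM.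
  - move=> x; rewrite tE; have := nsum_functionals_fin x (ltW p0) a0 wa.2 uu.
    by move=> h; rewrite lte_mul_pinfty.
  - move=> x px; rewrite tE; apply: le_trans (dT x); rewrite lee_fin.
    apply: ge0_ler_powR; rewrite ?nnegrE ?rnorm_ge0 ?(ltW p0)//.
    by apply: le_trans (v1 _); exact: scalar_re_le_rnorm.
exists d; split=> // x.
have [th th1 thE] := scalar_phase (v (T x) : K).
have -> : rnorm (v (T x)) = psi (th *: x).
  by rewrite /psi -thE (bounded_op_scale _ _ bT) (bounded_op_scale _ _ bv).
apply: le_trans (dP _) _; rewrite -nsumZ; last by move=> j; rewrite !mulr_ge0.
apply: le_nsum => j; first by rewrite !mulr_ge0.
rewrite [leRHS]mulrCA ler_wpM2l ?mulr_ge0//; rewrite /t ler_wpM2l//.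
case: (uu j) => bu _; rewrite (bounded_op_scale _ _ bu).
rewrite [leLHS](_ : _ = rnorm (th : K^o) * rnorm (u j x)); last exact: (@rnormZ R k K^o).
by rewrite ler_piMl.
Qed.

(** Hoelder's inequality with the exponents 1/q + 1/p + (1 - 1/r) = 1, splitting
    d |u| = (d^p' |u|^r)^(1/q) (|u|^r)^(1/p) (d^p')^(1 - 1/r). *)
Lemma composition_hoelder X p q r a (u : nat -> X -> K^o) (d : nat -> R) (D : R) x :
  1 < p -> 1 < r -> 0 < q -> r^-1 = p^-1 + q^-1 ->
  weights a -> unit_functionals u -> nonneg d ->
  (nsum (fun j => (a j * d j `^ conj_exp p)%R) <= D%:E)%E ->
  forall F G, (nsum (fun j => (a j * d j `^ conj_exp p * rnorm (u j x) `^ r)%R) <= F%:E)%E ->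
  (nsum (fun j => (a j * rnorm (u j x) `^ r)%R) <= G%:E)%E ->
  (nsum (fun j => (a j * d j * rnorm (u j x))%R) <=
    (F `^ q^-1 * G `^ p^-1 * D `^ (1 - r^-1))%:E)%E.
Proof.
move=> p1 r1 q0 rpq wa uu d0 dD F G hF hG.
have p0 : 0 < p by rewrite (lt_trans ltr01).
have r0 : 0 < r by rewrite (lt_trans ltr01).
have q1 := conj_exp_gt1 p1; have p'0 : 0 < conj_exp p by rewrite (lt_trans ltr01).
have a0 := weights_ge0 wa; have ru j : 0 <= rnorm (u j x) by exact: rnorm_ge0.
have rV : 0 < 1 - r^-1 by rewrite subr_gt0 invf_lt1.
have tE : q^-1 + p^-1 + (1 - r^-1) = 1 by rewrite rpq; ring.
have f0 : nonneg (fun j => a j * d j `^ conj_exp p * rnorm (u j x) `^ r).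
  by move=> j; rewrite !mulr_ge0 ?powR_ge0.
have g0 : nonneg (fun j => a j * rnorm (u j x) `^ r).
  by move=> j; rewrite !mulr_ge0 ?powR_ge0.
have h0 : nonneg (fun j => a j * d j `^ conj_exp p).
  by move=> j; rewrite !mulr_ge0 ?powR_ge0.
have qV : 0 < q^-1 by rewrite invr_gt0.
have pV : 0 < p^-1 by rewrite invr_gt0.
apply: le_trans (nsum_hoelder3_le qV pV rV tE f0 g0 h0 hF hG dD).
apply: le_nsum => j; first by rewrite !mulr_ge0.
rewrite le_eqVlt; apply/orP; left; apply/eqP.
rewrite !powRM ?mulr_ge0 ?powR_ge0// -!powRrM.
have e1 : a j = a j `^ q^-1 * a j `^ p^-1 * a j `^ (1 - r^-1).
  by rewrite -!powRD ?tE ?oner_eq0// ?powRr1// gt_eqF// addr_gt0.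
have e2 : d j = d j `^ (conj_exp p * q^-1) * d j `^ (conj_exp p * (1 - r^-1)).
  have e : conj_exp p * q^-1 + conj_exp p * (1 - r^-1) = 1.
    rewrite -mulrDr (_ : q^-1 + _ = (conj_exp p)^-1) ?divff ?gt_eqF//.
    by rewrite conj_expV// rpq; ring.
  by rewrite -powRD ?e ?oner_eq0// powRr1.
have e3 : rnorm (u j x) = rnorm (u j x) `^ (r / q) * rnorm (u j x) `^ (r / p).
  have e : r / q + r / p = 1 by rewrite -mulrDr addrC -rpq divff// gt_eqF.
  by rewrite -powRD ?e ?oner_eq0// powRr1.
by rewrite {1}e1 {1}e2 {1}e3; ring.
Qed.

(** With d_i a density for the functional v_i o T and e_j = sum_i b_i d_ij^p',
    the composition is dominated by the weights a_j (1 + e_j). *)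
Lemma weighted_qn_comp X Y Z p q r (T : X -> Y) (S : Y -> Z) :
  1 < p -> 1 < r -> 0 < q -> r^-1 = p^-1 + q^-1 ->
  weighted_qn p T -> weighted_qn q S -> weighted_qn r (S \o T).
Proof.
move=> p1 r1 q0 rpq [bT [a [u [C [wa uu C0 dT]]]]] [bS [b [v [C' [wb uv C'0 dS]]]]].
split; first exact: bounded_op_comp.
have p0 : 0 < p by rewrite (lt_trans ltr01).
have r0 : 0 < r by rewrite (lt_trans ltr01).
have a0 := weights_ge0 wa; have b0 := weights_ge0 wb.
have [B B0 BE] := nsum_fin b0 wb.2.
set p' := conj_exp p.
have /choice[d dP] : forall i, exists d : nat -> R, [/\ nonneg d,
    (nsum (fun j => (a j * d j `^ p')%R) <= (dom_const p)%:E)%E &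
    forall x, ((rnorm (v i (T x)))%:E <=
      (C `^ p^-1)%:E * nsum (fun j => (a j * d j * rnorm (u j x))%R))%E].
  by move=> i; have [bv v1] := uv i; exact: (functional_domination p1 wa uu C0 bT dT bv v1).
have d0 i : nonneg (d i) by case: (dP i).
move: (dom_const p) dP => D dP.
have ad0 i j : 0 <= a j * d i j `^ p' by rewrite mulr_ge0 ?powR_ge0.
have D0 : 0 <= D.
  by rewrite -lee_fin; case: (dP 0%N) => _ h _; apply: le_trans h; exact: nsum_ge0.
have bd0 j : nonneg (fun i => b i * d i j `^ p').
  by move=> i; rewrite mulr_ge0 ?powR_ge0.
have /choice[e eE] : forall j, exists e : R, 0 <= e /\
    nsum (fun i => b i * d i j `^ p') = e%:E.
  move=> j; have [||e e0 eE] := @nsum_fin R (fun i => b i * d i j `^ p'); first exact: bd0.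
    apply: (@le_lt_trans _ _ ((D / a j)%:E * nsum b)%E); last by rewrite BE ltry.
    rewrite -nsumZ//; apply: le_nsum => i; first exact: bd0.
    rewrite mulrC ler_wpM2r// ler_pdivlMr; last by case: wa.
    rewrite mulrC; case: (dP i) => _ h _.
    exact: (@term_le_nsum _ (fun j => a j * d i j `^ p') D j (ad0 i) h).
  by exists e.
have e0 j : 0 <= e j by case: (eE j).
have swap (h : nat -> R) : nonneg h -> nsum (fun j => a j * e j * h j) =
    (\sum_(0 <= i <oo) (b i)%:E * nsum (fun j => (a j * d i j `^ p' * h j)%R))%E.
  move=> h0; have nn i j : 0 <= b i * (a j * d i j `^ p' * h j) by rewrite !mulr_ge0 ?powR_ge0.
  transitivity (\sum_(0 <= i <oo) nsum (fun j => (b i * (a j * d i j `^ p' * h j))%R))%E;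
    last first.
    apply: eq_eseriesr => i _; rewrite nsumZ// => j.
    by rewrite mulr_ge0.
  rewrite nsum_interchange//; apply: eq_eseriesr => j _.
  rewrite (eq_nsum (t := fun i => (a j * h j) * (b i * d i j `^ p'))); last first.
    by move=> i; ring.
  by rewrite nsumZ; [rewrite (eE j).2 -EFinM mulrAC|exact: bd0].
have ae0 j : 0 <= a j * e j by rewrite mulr_ge0.
have aeoo : (nsum (fun j => (a j * e j)%R) < +oo)%E.
  rewrite (eq_nsum (t := fun j => a j * e j * 1)); last by move=> j; rewrite mulr1.
  rewrite swap//; apply: (@le_lt_trans _ _ (\sum_(0 <= i <oo) (D * b i)%:E)%E).
    apply: lee_nneseries => i *.
      by rewrite mule_ge0 ?lee_fin// nsum_ge0// => j; rewrite mulr1.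
    rewrite mulrC EFinM lee_wpmul2l ?lee_fin//; case: (dP i) => _ h _.
    by apply: le_trans h; apply: le_nsum => j; rewrite mulr1.
  by rewrite -/(nsum _) nsumZ// BE -EFinM ltry.
(* The first summand serves the factor sum_j a_j |u_j x|^r of the Hoelder
   bound, the second one the sum over i of the other factors. *)
pose w j := a j + a j * e j.
have w0 : nonneg w by move=> j; rewrite addr_ge0.
have ww : weights w.
  split=> [j|]; first by rewrite ltr_wpDr//; case: wa.
  by rewrite nsumD// lte_add_pinfty//; case: wa.
pose M := C `^ p^-1 * D `^ (1 - r^-1).
have M0 : 0 <= M by rewrite mulr_ge0 ?powR_ge0.
exists w, u, ((C' * M `^ q) `^ (r / q)); split=> //.
  by rewrite powR_ge0.
move=> x; have ur j : 0 <= rnorm (u j x) `^ r by exact: powR_ge0.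
have wr0 : nonneg (fun j => w j * rnorm (u j x) `^ r) by move=> j; rewrite mulr_ge0.
have [W W0 WE] := nsum_fin wr0 (nsum_functionals_fin x (ltW r0) w0 ww.2 uu).
have GW : (nsum (fun j => (a j * rnorm (u j x) `^ r)%R) <= W%:E)%E.
  rewrite -WE; apply: le_nsum => j; first by rewrite mulr_ge0.
  by rewrite ler_wpM2r// lerDl.
have EW : (nsum (fun j => (a j * e j * rnorm (u j x) `^ r)%R) <= W%:E)%E.
  rewrite -WE; apply: le_nsum => j; first by rewrite mulr_ge0.
  by rewrite ler_wpM2r// lerDr.
have f0 i : nonneg (fun j => a j * d i j `^ p' * rnorm (u j x) `^ r).
  by move=> j; rewrite mulr_ge0.
have /choice[F FP] : forall i, exists F : R, 0 <= F /\
    nsum (fun j => a j * d i j `^ p' * rnorm (u j x) `^ r) = F%:E.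
  move=> i; have [|F F0 FE] := @nsum_fin R _ (f0 i); last by exists F.
  apply: (@le_lt_trans _ _ ((rnorm x `^ r)%:E * D%:E)%E); last by rewrite -EFinM ltry.
  apply: (@le_trans _ _ ((rnorm x `^ r)%:E * nsum (fun j => (a j * d i j `^ p')%R))%E).
    rewrite -nsumZ//; apply: le_nsum => j; first exact: f0.
    rewrite mulrC ler_wpM2r//; apply: ge0_ler_powR; rewrite ?nnegrE ?rnorm_ge0 ?(ltW r0)//.
    by case: (uu j).
  by rewrite lee_wpmul2l ?lee_fin ?powR_ge0//; case: (dP i).
have F0 i : 0 <= F i by case: (FP i).
have vle i : rnorm (v i (T x)) `^ q <= M `^ q * W `^ (q / p) * F i.
  have h : rnorm (v i (T x)) <= C `^ p^-1 * (F i `^ q^-1 * W `^ p^-1 * D `^ (1 - r^-1)).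
    case: (dP i) => di0 dD /(_ x) dx; rewrite -lee_fin; apply: (le_trans dx).
    rewrite EFinM lee_wpmul2l ?lee_fin ?powR_ge0//.
    by apply: (composition_hoelder p1 r1 q0 rpq wa uu di0 dD _ GW); rewrite (FP i).2.
  apply: (@le_trans _ _ ((C `^ p^-1 * (F i `^ q^-1 * W `^ p^-1 * D `^ (1 - r^-1))) `^ q)).
    by apply: ge0_ler_powR; rewrite ?nnegrE ?rnorm_ge0 ?mulr_ge0 ?powR_ge0 ?(ltW q0).
  rewrite /M !powRM ?mulr_ge0 ?powR_ge0// -!powRrM mulVf ?gt_eqF// powRr1//.
  by rewrite le_eqVlt; apply/orP; left; apply/eqP; rewrite [p^-1 * q]mulrC; ring.
have ST : rnorm (S (T x)) `^ q <= C' * M `^ q * W `^ (q / r).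
  rewrite -lee_fin; apply: (le_trans (dS (T x))).
  rewrite -mulrA EFinM lee_wpmul2l ?lee_fin//.
  apply: (@le_trans _ _ ((M `^ q * W `^ (q / p))%:E * nsum (fun i => (b i * F i)%R))%E).
    rewrite -nsumZ; last by move=> i; rewrite mulr_ge0.
    apply: le_nsum => i; first by rewrite mulr_ge0 ?powR_ge0.
    by rewrite mulrCA ler_wpM2l.
  have qr : q / r = q / p + 1 by rewrite rpq mulrDr divff ?gt_eqF.
  rewrite qr powRD; last by rewrite gt_eqF ?orbT// addr_gt0// divr_gt0.
  rewrite powRr1// mulrA [leRHS]EFinM lee_wpmul2l ?lee_fin ?mulr_ge0 ?powR_ge0//.
  apply: le_trans EW; rewrite swap; last by move=> j.
  by apply: lee_nneseries => i *; rewrite ?(FP i).2 ?lee_fin ?mulr_ge0.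
rewrite /= WE -EFinM lee_fin.
have -> : rnorm (S (T x)) `^ r = (rnorm (S (T x)) `^ q) `^ (r / q).
  by rewrite -powRrM [q * _]mulrC divfK ?gt_eqF.
apply: (@le_trans _ _ ((C' * M `^ q * W `^ (q / r)) `^ (r / q))).
  by apply: ge0_ler_powR; rewrite ?nnegrE ?divr_ge0 ?mulr_ge0 ?powR_ge0 ?(ltW r0) ?(ltW q0).
rewrite [X in X <= _]powRM ?mulr_ge0 ?powR_ge0// -powRrM.
by rewrite mulrA divfK ?gt_eqF// divff ?gt_eqF// powRr1.
Qed.

End qn_composition.

(** * Finite-rank approximation for exponent 2, quasi nuclear case *)

Section qn_approximation.
Context {R : realType} {k : scalar_kind}.
Local Notation K := (scalar_field R k).
Implicit Types (X Y : normedModType K) (a : nat -> R).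

Lemma dotgg_scale a (c : K) g : nonneg a -> l2 a g ->
  dot a (fun j => c * g j) (fun j => c * g j) = rnorm (c : K^o) ^+ 2 * dot a g g.
Proof.
move=> a0 lg; apply: EFin_inj; rewrite -dotgg//; last exact: l2Z.
rewrite EFinM -dotgg// -nsumZ; last exact: sqterm_ge0.
by apply: eq_nsum => j; rewrite /sqterm rnormM exprMn mulrCA.
Qed.

Lemma l2_sum a N (g : nat -> nat -> K) : nonneg a -> (forall i, l2 a (g i)) ->
  l2 a (fun j => \sum_(i < N) g i j).
Proof.
move=> a0 lg; elim: N => [|N IH].
  rewrite /l2 (eq_nsum (t := fun=> 0)) ?nsum0// => j.
  by rewrite /sqterm big_ord0 rnorm0 expr0n mulr0.
rewrite (_ : (fun j => _) = fun j => \sum_(i < N) g i j + g N j).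
  exact: l2D.
by apply/funext => j; rewrite big_ord_recr.
Qed.

Lemma dot_suml a N (g : nat -> nat -> K) h : nonneg a -> (forall i, l2 a (g i)) ->
  l2 a h -> dot a (fun j => \sum_(i < N) g i j) h = \sum_(i < N) dot a (g i) h.
Proof.
move=> a0 lg lh; elim: N => [|N IH].
  rewrite big_ord0 /dot (_ : dotterm _ _ _ = fun=> 0).
    rewrite (_ : series _ = fun=> 0); first exact: lim_cst.
    by apply/funext => n; rewrite /series/= big1.
  apply/funext => j; rewrite /dotterm big_ord0.
  by rewrite rdot0l mulr0.
rewrite big_ord_recr/= -IH (_ : (fun j => _) = fun j => \sum_(i < N) g i j + g N j).
  by apply: dotDl => //; exact: l2_sum.
by apply/funext => j; rewrite big_ord_recr.
Qed.

Fact dilation_shift (F : fieldType) (c s x y z : F) : c != 0 ->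
  c * (x + (-1) * y) + s * z = c * (x + (-1) * (y + - (s / c) * z)).
Proof. by move=> c0; field. Qed.

Definition unit_seq (i j : nat) : K := (j == i)%:R.

Lemma l2_unit_seq a i : nonneg a -> l2 a (unit_seq i).
Proof.
move=> a0; rewrite /l2; apply: (@le_lt_trans _ _ (a i)%:E); last exact: ltry.
apply/nsum_leP => [|n]; first exact: sqterm_ge0.
have s j : sqterm a (unit_seq i) j = if j == i then a i else 0.
  rewrite /sqterm /unit_seq; case: eqP => [->|_] /=.
    by rewrite (_ : rnorm _ = 1) ?expr1n ?mulr1// /rnorm normr1 (scalar_re_nat 1).
  by rewrite (@rnorm0 _ _ K^o) expr0n mulr0.
under eq_bigr do rewrite s.
rewrite -big_mkcond/= -(big_mkord (fun j => j == i) (fun=> a i)).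
have [ni|ni] := leqP n i.
  rewrite big1_seq// => j /andP[/eqP ->]; rewrite mem_index_iota/=.
  by rewrite ltnNge ni.
by rewrite big_nat1_eq ni/=.
Qed.

(** Write A x = (u_j x)_j in the weighted l^2 space.  Each basis vector e_i with
    i < N is replaced by a nearly closest point A x_i of the range of A, so that
    e_i - A x_i is almost orthogonal to that range; x |-> sum_(i < N) u_i(x) x_i
    then approximates the identity as seen through A.  The error y satisfies
    q(y) = (tail, A y) + sum_(i < N) (u_i(x) (e_i - A x_i), A y) for the squared
    norm q(y) of A y, and each term is at most a multiple of q(y) plus something
    small. *)
Lemma qn2_finite_rank_error X a (u : nat -> X -> K^o) N (d : R) :
  weights a -> unit_functionals u -> 0 < d -> (0 < N)%N ->
  exists e : nat -> X, forall x,
   (nsum (fun j => (a j * rnorm (u j (x - \sum_(i < N) u i x *: e i)) ^+ 2)%R) <=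
    2%:E * nsum (tail N (fun j => (a j * rnorm (u j x) ^+ 2)%R)) +
    (2 * N%:R * d * \sum_(i < N) rnorm (u i x) ^+ 2)%:E)%E.
Proof.
move=> wa uu d0 N0; have a0 := weights_ge0 wa.
pose A (x : X) j : K := u j x.
have lA x : l2 a (A x).
  have := nsum_functionals_fin x (ler0n R 2) a0 wa.2 uu.
  rewrite /l2; congr (_ < _)%E; apply: eq_nsum => j.
  by rewrite powR_sqr// rnorm_ge0.
have AD x y j : A (x + y) j = A x j + A y j.
  by rewrite /A; case: (uu j) => bu _; exact: (bounded_op_add _ _ bu).
have AZ c x j : A (c *: x) j = c * A x j.
  by rewrite /A; case: (uu j) => bu _; exact: (bounded_op_scale _ _ bu).
pose dist i x j := unit_seq i j + (-1) * A x j.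
have ldist i x : l2 a (dist i x).
  apply: l2D => //; first exact: l2_unit_seq.
  exact: l2Z.
have /choice[e eP] : forall i, exists e : X, forall x,
    dot a (dist i e) (dist i e) <= dot a (dist i x) (dist i x) + d.
  move=> i; pose E := range (fun x => dot a (dist i x) (dist i x)).
  have hE : has_inf E.
    split; first by exists (dot a (dist i 0) (dist i 0)); exists 0.
    by exists 0 => _ [x _ <-]; exact: dotgg_ge0.
  have [_ [e _ <-] eE] := inf_adherent d0 hE.
  exists e => x; apply: (le_trans (ltW eE)); rewrite lerD2r.
  by apply: ge_inf; [case: hE|exists x].
exists e => x; set y := x - _.
pose q := dot a (A y) (A y).
pose tl j : K := if (j < N)%N then 0 else u j x.
have ltl : l2 a tl.
  apply: (l2_le a0 _ (lA x)) => j; rewrite /tl; case: ifP => // _.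
  by rewrite (@rnorm0 _ _ K^o) rnorm_ge0.
pose v i j : K := u i x * dist i (e i) j.
have lv i : l2 a (v i) by exact: l2Z.
have yE : A y = fun j => tl j + \sum_(i < N) v i j.
  apply/funext => j.
  have uj : A y j = u j x - \sum_(i < N) u i x * A (e i) j.
    rewrite /A /y; case: (uu j) => bu _; have [L ->] := bounded_opE bu.
    rewrite linearB linear_sum; congr (_ - _); apply: eq_bigr => i _.
    by rewrite linearZ.
  have sj : \sum_(i < N) u i x * unit_seq i j = u j x - tl j.
    rewrite /tl; have [jN|jN] := ltnP j N.
      rewrite (bigD1 (Ordinal jN))//= /unit_seq eqxx mulr1 big1 ?addr0 ?subr0// => i ij.
      by rewrite eq_sym (_ : (i : nat) == j = false) ?mulr0//; apply: contraNF ij.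
    rewrite subrr big1// => i _; rewrite /unit_seq gtn_eqF ?mulr0//.
    exact: leq_trans (ltn_ord i) jN.
  rewrite uj (_ : \sum_(i < N) v i j = \sum_(i < N) u i x * unit_seq i j -
    \sum_(i < N) u i x * A (e i) j); last first.
    rewrite -sumrB; apply: eq_bigr => i _.
    by rewrite /v /dist mulN1r mulrBr.
  by rewrite sj addrA [tl j + _]addrC subrK.
have qE : q = dot a tl (A y) + \sum_(i < N) dot a (v i) (A y).
  rewrite {1}/q {1}yE dotDl//; first by rewrite dot_suml.
  exact: l2_sum.
have q0 : 0 <= q by exact: dotgg_ge0.
have N0' : 0 < N%:R :> R by rewrite ltr0n.
have h1 : dot a tl (A y) <= dot a tl tl + q / 4.
  have := near_minimal_dot a0 ltl (lA y) (e := dot a tl tl) _ (t := 2^-1).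
  rewrite mulfV ?pnatr_eq0// divr1 => h; have := h _ _; rewrite -/q => {}h.
  have : dot a tl (A y) <= dot a tl tl + 2^-1 * q / 2.
    apply: h; last by rewrite invr_gt0.
    by move=> t; rewrite subrr; apply: dotgg_ge0 => //; apply: l2D => //; exact: l2Z.
  by move=> ?; lra.
have h2 i : dot a (v i) (A y) <= N%:R * d * rnorm (u i x) ^+ 2 + q / (4 * N%:R).
  have := near_minimal_dot a0 (lv i) (lA y) (e := rnorm (u i x) ^+ 2 * d) _ (t := (2 * N%:R)^-1).
  rewrite -/q => h.
  have : dot a (v i) (A y) <= rnorm (u i x) ^+ 2 * d / (2 * (2 * N%:R)^-1) + (2 * N%:R)^-1 * q / 2.
    apply: h; last by rewrite invr_gt0 mulr_gt0.
    move=> t; rewrite dotgg_scale// -mulrBr.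
    have lt' : l2 a (fun j => v i j + of_real t * A y j).
      by apply: l2D => //; exact: l2Z.
    have [c0|c0] := eqVneq (u i x : K) 0.
      by rewrite c0 (@rnorm0 _ _ K^o) expr0n mul0r; exact: dotgg_ge0.
    rewrite (_ : (fun j => _) = fun j => u i x * dist i (e i - (of_real t / u i x) *: y) j).
      rewrite dotgg_scale// ler_wpM2l ?sqr_ge0// lerBlDr; exact: eP.
    apply/funext => j; rewrite /v /dist -scaleNr AD AZ.
    exact: dilation_shift.
  move=> /le_trans; apply; rewrite le_eqVlt; apply/orP; left; apply/eqP.
  by field; rewrite gt_eqF.
have h3 : q <= 2 * dot a tl tl + 2 * N%:R * d * \sum_(i < N) rnorm (u i x) ^+ 2.
  have h4 : \sum_(i < N) dot a (v i) (A y) <=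
      N%:R * d * \sum_(i < N) rnorm (u i x) ^+ 2 + q / 4.
    apply: (@le_trans _ _ (\sum_(i < N)
        (N%:R * d * rnorm (u i x) ^+ 2 + q / (4 * N%:R)))).
      by apply: ler_sum => i _; exact: h2.
    rewrite big_split/= -mulr_sumr lerD2l sumr_const card_ord -mulr_natr.
    rewrite le_eqVlt; apply/orP; left; apply/eqP; by field; rewrite gt_eqF.
  by have := qE; lra.
have sq z : (fun j => a j * rnorm (u j z) ^+ 2) = sqterm a (A z) by [].
rewrite sq dotgg// -/q; have -> : nsum (tail N (fun j => a j * rnorm (u j x) ^+ 2)) =
    (dot a tl tl)%:E.
  rewrite -dotgg//; apply: eq_nsum => j; rewrite /tail /sqterm /tl.
  by case: ifP => // _; rewrite (@rnorm0 _ _ K^o) expr0n mulr0.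
by rewrite -EFinM -EFinD lee_fin.
Qed.

(** N is chosen first, to make the tail of the weights small, then the precision
    d of the nearly closest points, in terms of N. *)
Lemma weighted_qn2_approx X Y (T : X -> Y) (eps : R) : 0 < eps -> weighted_qn 2 T ->
  exists2 F, finite_rank F & exists b u,
    [/\ nonneg b, (nsum b <= eps%:E)%E, unit_functionals u & qn_dominated 2 b u 1 (T - F)].
Proof.
move=> eps0 [bT [a [u [C [wa uu C0 dT]]]]]; have a0 := weights_ge0 wa.
have C1 : 0 < C + 1 by rewrite ltr_wpDl.
have eta0 : 0 < eps / (4 * (C + 1)) by rewrite divr_gt0// mulr_gt0.
have [N0 N0P] := nsum_tail_small a0 wa.2 eta0; pose N := N0.+1.
have NR : 0 < N%:R :> R by rewrite ltr0n.
have tN : (nsum (tail N a) <= (eps / (4 * (C + 1)))%:E)%E.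
  apply: le_trans N0P; apply: le_nsum => [|j]; first exact: tail_ge0.
  rewrite /tail; case: ltnP => jN; case: ltnP => jN0 //.
  by move: (leq_ltn_trans jN jN0); rewrite ltnNge leqnSn.
pose d := eps / (4 * (C + 1)) / N%:R ^+ 2.
have d0 : 0 < d by rewrite divr_gt0// exprn_gt0.
have [e eP] := qn2_finite_rank_error wa uu d0 (ltn0Sn N0).
exists (fun x => \sum_(i < N) (u i x : K) *: T (e i)).
  by apply: (@finite_rank_sum _ _ X Y N u (T \o e)) => i; case: (uu i).
pose b j := if (j < N)%N then C * (2 * N%:R * d) else C * (2 * a j).
have dN : 0 <= 2 * N%:R * d by apply: mulr_ge0 (ltW d0).
have b0 : nonneg b.
  by move=> j; rewrite /b; case: ifP => _; apply: mulr_ge0 => //; exact: mulr_ge0.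
exists b, u.
split; [exact: b0| |exact: uu|].
  rewrite (nsum_split N b0).
  have -> : \sum_(j < N) b j = C * (2 * N%:R * d) * N%:R.
    rewrite (eq_bigr (fun=> C * (2 * N%:R * d))); first by rewrite sumr_const card_ord -[LHS]mulr_natr.
    by move=> i _; rewrite /b ltn_ord.
  have -> : nsum (tail N b) = ((C * 2)%:E * nsum (tail N a))%E.
    rewrite -nsumZ; last exact: tail_ge0.
    by apply: eq_nsum => j; rewrite /tail /b; case: (j < N)%N; rewrite ?mulr0 ?mulrA.
  have [t t0 tE] := nsum_fin (tail_ge0 N a0) (le_lt_trans tN (ltry _)).
  move: tN; rewrite tE -EFinM -EFinD !lee_fin => tN.
  have e1 : eps / (4 * (C + 1)) = eps / 4 / (C + 1) by rewrite invfM mulrA.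
  have e2 : C * (2 * N%:R * d) * N%:R = 2 * C * (eps / 4 / (C + 1)).
    by rewrite /d e1; field; rewrite !gt_eqF.
  rewrite e2; rewrite e1 in tN; set s := eps / 4 / (C + 1) in tN *.
  have es : eps = 4 * (s * (C + 1)) by rewrite /s divfK ?gt_eqF//; field.
  have s0 : 0 < s by rewrite /s !divr_gt0.
  rewrite [leRHS]es; nra.
move=> x; rewrite mul1e.
have -> : (T - (fun x => \sum_(i < N) (u i x : K) *: T (e i))) x =
    T (x - \sum_(i < N) (u i x : K) *: e i).
  have [L ->] := bounded_opE bT; rewrite fctE linearB linear_sum; congr (_ - _).
  by apply: eq_bigr => i _; rewrite linearZ.
apply: (le_trans (dT _)).
set y := x - _.
have sqE z : nsum (fun j => a j * rnorm (u j z) `^ 2) = nsum (fun j => a j * rnorm (u j z) ^+ 2).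
  by apply: eq_nsum => j; rewrite powR_sqr// rnorm_ge0.
have br0 : nonneg (fun j => b j * rnorm (u j x) `^ 2).
  by move=> j; rewrite mulr_ge0 ?powR_ge0.
rewrite sqE; apply: (@le_trans _ _ (C%:E * (2%:E * nsum (tail N (fun j => a j * rnorm (u j x) ^+ 2)%R) +
    (2 * N%:R * d * \sum_(i < N) rnorm (u i x) ^+ 2)%:E))%E).
  by rewrite lee_wpmul2l ?lee_fin//; exact: eP.
have ar0 : nonneg (fun j => a j * rnorm (u j x) ^+ 2).
  by move=> j; rewrite mulr_ge0 ?sqr_ge0.
rewrite (nsum_split N br0).
have -> : \sum_(j < N) b j * rnorm (u j x) `^ 2 =
    C * (2 * N%:R * d * \sum_(i < N) rnorm (u i x) ^+ 2).
  rewrite mulrA mulr_sumr; apply: eq_bigr => i _.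
  by rewrite /b ltn_ord powR_sqr// rnorm_ge0.
have -> : nsum (tail N (fun j => b j * rnorm (u j x) `^ 2)) =
    (C%:E * (2%:E * nsum (tail N (fun j => (a j * rnorm (u j x) ^+ 2)%R))))%E.
  rewrite muleA -EFinM -nsumZ; last exact: tail_ge0.
  apply: eq_nsum => j; rewrite /tail /b; case: (j < N)%N; rewrite ?mulr0//.
  by rewrite powR_sqr ?rnorm_ge0// !mulrA.
by rewrite addeC muleDr.
Qed.

End qn_approximation.

(** * Compact operators in weighted form *)

Section weighted_sk.
Context {R : realType} {k : scalar_kind}.
Local Notation K := (scalar_field R k).
Implicit Types (X Y Z : normedModType K) (p q s t : R) (a b : nat -> R).

Definition combination Y a (y : nat -> Y) (xi : nat -> K) (n : nat) : Y :=
  \sum_(j < n) (of_real (a j) * xi j) *: y j.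

Definition unit_vectors Y (y : nat -> Y) := forall j, rnorm (y j) <= 1.

(** The exponent s is that of the coefficients: it is dual to the exponent of the
    ideal, and the class shrinks when s grows.  The constant C, in place of 1,
    saves renormalising the vectors y_j. *)
Definition sk_dominated X Y s a (y : nat -> Y) (C : R) (T : X -> Y) :=
  forall x, rnorm x <= 1 -> exists2 xi : nat -> K,
    (nsum (fun j => (a j * rnorm (xi j : K^o) `^ s)%R) <= C%:E)%E &
    combination a y xi @ \oo --> T x.

Definition weighted_sk X Y s (T : X -> Y) :=
  bounded_op T /\ exists a y C,
  [/\ weights a, unit_vectors y, 0 <= C & sk_dominated s a y C T].

Lemma nsum_powR_le a (g : nat -> R) s t (A C : R) : nonneg a -> nonneg g ->
  0 <= s -> s <= t -> (nsum a <= A%:E)%E ->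
  (nsum (fun j => (a j * g j `^ t)%R) <= C%:E)%E ->
  (nsum (fun j => (a j * g j `^ s)%R) <= (A + C)%:E)%E.
Proof.
move=> a0 g0 s0 st aA gC.
have n0 r : nonneg (fun j => a j * g j `^ r) by move=> j; rewrite mulr_ge0 ?powR_ge0.
apply: (@le_trans _ _ (nsum (fun j => a j + a j * g j `^ t))).
  apply: le_nsum => [|j]; first exact: n0.
  by rewrite -[X in _ <= X + _]mulr1 -mulrDr ler_wpM2l// powR_le1D.
by rewrite nsumD// EFinD leeD.
Qed.

Lemma weighted_sk_le X Y s t (T : X -> Y) : 0 <= s -> s <= t ->
  weighted_sk t T -> weighted_sk s T.
Proof.
move=> s0 st [bT [a [y [C [wa uy C0 dT]]]]]; split=> //.
have a0 := weights_ge0 wa; have [A A0 AE] := nsum_fin a0 wa.2.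
exists a, y, (A + C); split=> //; first exact: addr_ge0.
move=> x /dT[xi xiC xiT]; exists xi => //.
apply: (@nsum_powR_le _ _ s t) => //; last by rewrite AE.
by move=> j; exact: rnorm_ge0.
Qed.

Lemma rnorm_combination Y a (y : nat -> Y) (xi : nat -> K) n :
  nonneg a -> unit_vectors y ->
  rnorm (combination a y xi n) <= \sum_(j < n) a j * rnorm (xi j : K^o).
Proof.
move=> a0 uy; apply: (le_trans (rnorm_sum _ _ _)); apply: ler_sum => j _.
rewrite rnormZ -[scalar_re _]/(rnorm (of_real (a j) * xi j : K^o)).
by rewrite rnormM rnorm_of_real// ler_piMr// mulr_ge0// rnorm_ge0.
Qed.

(** The p-convex hull of a p-summable sequence is closed: coefficient sequences
    of approximants have a weak limit in the dual sequence space, and the hull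
    depends continuously on the coefficients for weak limits. *)
Lemma sk_hull_closed Y a (y : nat -> Y) s (rho : R) (z : Y) :
  1 < s -> weights a -> unit_vectors y -> 0 <= rho ->
  (forall e, 0 < e -> exists n (xi : nat -> K),
     (nsum (fun j => (a j * rnorm (xi j : K^o) `^ s)%R) <= (rho + e)%:E)%E /\
     rnorm (z - combination a y xi n) <= e) ->
  exists2 xi : nat -> K, (nsum (fun j => (a j * rnorm (xi j : K^o) `^ s)%R) <= rho%:E)%E &
    combination a y xi @ \oo --> z.
Proof.
move=> s1 wa uy rho0 approx; have a0 := weights_ge0 wa.
have s0 : 0 < s by rewrite (lt_trans ltr01).
have [A A0 AE] := nsum_fin a0 wa.2.
have kr (c : K) : 0 <= rnorm (c : K^o) by exact: rnorm_ge0.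
pose ep i : R := i.+1%:R^-1.
have ep0 i : 0 < ep i by rewrite invr_gt0 ltr0n.
have ep1 i : ep i <= 1 by rewrite invf_le1 ?ltr0n// ler1n.
have /choice[n /choice[xi0 xi0P]] := fun i => approx (ep i) (ep0 i).
pose xi i j : K := if (j < n i)%N then xi0 i j else 0.
have nn (g : nat -> K) : nonneg (fun j => a j * rnorm (g j : K^o) `^ s).
  by move=> j; rewrite mulr_ge0 ?powR_ge0.
have xiC i : (nsum (fun j => (a j * rnorm (xi i j : K^o) `^ s)%R) <= (rho + ep i)%:E)%E.
  apply: le_trans (xi0P i).1; apply: le_nsum => [|j]; first exact: nn.
  rewrite ler_wpM2l//; apply: ge0_ler_powR; rewrite ?nnegrE ?(ltW s0)//.
  by rewrite /xi; case: ifP => // _; rewrite (@rnorm0 _ _ K^o).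
have xiC1 i : (nsum (fun j => (a j * rnorm (xi i j : K^o) `^ s)%R) <= (rho + 1)%:E)%E.
  by apply: le_trans (xiC i) _; rewrite lee_fin lerD2l.
have [U [UU Uoo]] := ultra_eventually.
have epU : ep @ U --> (0 : R).
  by apply: (cvg_trans _ (@cvg_harmonic R)); exact: cvg_app.
have /choice[x xP] : forall j, exists l : K, (fun i => rnorm (xi i j - l : K^o)) @ U --> (0 : R).
  move=> j; apply: (@ultra_bounded_cvg_scalar _ _ _ _ (((rho + 1) / a j) `^ s^-1)) => i.
  have -> : rnorm (xi i j : K^o) = (rnorm (xi i j : K^o) `^ s) `^ s^-1.
    by rewrite -powRrM divff ?gt_eqF// powRr1.
  apply: ge0_ler_powR; rewrite ?nnegrE ?invr_ge0 ?powR_ge0 ?divr_ge0 ?addr_ge0 ?(ltW s0)//.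
  rewrite ler_pdivlMr; last by case: wa.
  rewrite mulrC; exact: (@term_le_nsum _ (fun j => a j * rnorm (xi i j : K^o) `^ s) _ j (nn (xi i)) (xiC1 i)).
have xn j : (fun i => rnorm (xi i j : K^o)) @ U --> rnorm (x j : K^o).
  apply/cvgrPdist_lt => e e0; move/cvgrPdist_lt : (xP j) => /(_ _ e0).
  apply: filterS => i; rewrite sub0r normrN ger0_norm//; apply: le_lt_trans.
  rewrite ler_norml; apply/andP; split.
    rewrite lerNl opprB lerBlDr.
    by rewrite -[X in rnorm X <= _](subrK (x j)); exact: (@rnormD _ _ K^o).
  rewrite lerBlDr rnormBC -[X in rnorm X <= _](subrK (xi i j)).
  exact: (@rnormD _ _ K^o).
have xC : (nsum (fun j => (a j * rnorm (x j : K^o) `^ s)%R) <= rho%:E)%E.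
  apply: (@weak_limit_nsum _ U _ s rho a (fun i => rho + ep i) (fun i j => rnorm (xi i j : K^o))).
  - exact: s0.
  - exact: a0.
  - by move=> i j; exact: kr.
  - by move=> j; exact: kr.
  - exact: xiC.
  - by rewrite -[X in _ --> X]addr0; apply: cvgD => //; exact: cvg_cst.
  - exact: xn.
exists x => //.
have ax0 : nonneg (fun j => a j * rnorm (x j : K^o)) by move=> j; rewrite mulr_ge0.
have axoo : (nsum (fun j => (a j * rnorm (x j : K^o))%R) < +oo)%E.
  apply: (@le_lt_trans _ _ (A + rho)%:E); last exact: ltry.
  have := @nsum_powR_le a (fun j => rnorm (x j : K^o)) 1 s A rho a0 (fun j => kr (x j)) ler01 (ltW s1).
  rewrite AE => /(_ (lexx _) xC); apply: le_trans; apply: le_nsum => // j.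
  by rewrite powRr1.
have key J : ((rnorm (z - combination a y x J))%:E <=
    nsum (tail J (fun j => (a j * rnorm (x j : K^o))%R)))%E.
  pose x' j : K := if (j < J)%N then x j else 0.
  pose g i j := rnorm (xi i j - x' j : K^o).
  pose l j := if (j < J)%N then 0 else rnorm (x j : K^o).
  have := @weak_limit_le R U _ (conj_exp s) (2 `^ s * ((rho + 1) + rho))
    (rnorm (z - combination a y x J)) a (fun=> 1) ep g l (conj_exp_gt1 s1) a0.
  rewrite conj_expK// => wl.
  rewrite (eq_nsum (t := fun j => a j * l j * 1)); last first.
    by move=> j; rewrite /tail /l mulr1; case: ifP => //; rewrite mulr0.
  apply: wl.
  - by [].
  - by move=> i j; exact: kr.
  - by move=> j; rewrite /l; case: ifP.
  - move=> i; apply: (@le_trans _ _ (nsum (fun j => 2 `^ s *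
       (a j * rnorm (xi i j : K^o) `^ s + a j * rnorm (x j : K^o) `^ s)))).
      apply: le_nsum => j; first by rewrite mulr_ge0 ?powR_ge0.
      rewrite -mulrDr mulrCA ler_wpM2l//.
      apply: (@le_trans _ _ ((rnorm (xi i j : K^o) + rnorm (x j : K^o)) `^ s)).
        have gle : g i j <= rnorm (xi i j : K^o) + rnorm (x j : K^o).
          apply: (le_trans (@rnormD _ _ K^o _ _)); rewrite lerD2l rnormN /x'.
          by case: ifP => // _; rewrite (@rnorm0 _ _ K^o).
        by apply: ge0_ler_powR; rewrite ?nnegrE ?addr_ge0 ?kr ?(ltW s0).
      exact: powRD_le.
    rewrite nsumZ; last by move=> j; rewrite addr_ge0//; exact: nn.
    rewrite EFinM lee_wpmul2l ?lee_fin ?powR_ge0// nsumD; [|exact: nn|exact: nn].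
    by rewrite EFinD leeD.
  - by under eq_nsum do rewrite powR1 mulr1; case: wa.
  - move=> j; rewrite /g /l /x'; case: ifP => _; first exact: xP.
    by under eq_fun do rewrite subr0; exact: xn.
  - exact: epU.
  move=> i; pose M := maxn (n i) J.
  have e1 : combination a y (xi0 i) (n i) = \sum_(j < M) (of_real (a j) * xi i j) *: y j.
    rewrite /combination (big_ord_widen M (fun j => (of_real (a j) * xi0 i j) *: y j)) ?leq_maxl//.
    rewrite [LHS]big_mkcond/=; apply: eq_bigr => j _.
    by rewrite /xi; case: ifP => // _; rewrite mulr0 scale0r.
  have e2 : combination a y x J = \sum_(j < M) (of_real (a j) * x' j) *: y j.
    rewrite /combination (big_ord_widen M (fun j => (of_real (a j) * x j) *: y j)) ?leq_maxr//.
    rewrite [LHS]big_mkcond/=; apply: eq_bigr => j _.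
    by rewrite /x'; case: ifP => // _; rewrite mulr0 scale0r.
  have e3 : z - combination a y x J = (z - combination a y (xi0 i) (n i)) +
      combination a y (fun j => xi i j - x' j) M.
    have -> : combination a y (fun j => xi i j - x' j) M =
        combination a y (xi0 i) (n i) - combination a y x J.
      rewrite e1 e2 -sumrB; apply: eq_bigr => j _.
      by rewrite mulrBr scalerBl.
    by rewrite addrA subrK.
  rewrite e3; apply: (@le_trans _ _ ((ep i)%:E + (\sum_(j < M) a j * g i j * 1)%:E)%E).
    rewrite -EFinD lee_fin; apply: (le_trans (rnormD _ _)); apply: lerD.
      by case: (xi0P i).
    under [leRHS]eq_bigr do rewrite mulr1.
    exact: rnorm_combination.
  rewrite leeD2l//; apply: (@psum_le_nsum _ (fun j => a j * g i j * 1)) => j.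
  by rewrite mulr1 mulr_ge0//; exact: kr.
apply/cvg_rnormP => e e0; have [N NP] := nsum_tail_small ax0 axoo e0.
exists N => m Nm; rewrite -lee_fin; apply: (le_trans (key m)); apply: le_trans NP.
apply: le_nsum => [|j]; first exact: tail_ge0.
rewrite /tail; case: (ltnP j m) => jm; case: (ltnP j N) => jN //.
by move: (leq_ltn_trans (leq_trans Nm jm) jN); rewrite ltnn.
Qed.

End weighted_sk.
Section sk_weights.
Context {R : realType} {k : scalar_kind}.
Local Notation K := (scalar_field R k).
Implicit Types (X Y Z : normedModType K) (p q s t : R) (a b : nat -> R).

(** With a_n = |y_n|^p + 2^-(n+1), the vector y_n is divided by a_n^(1/p) and its
    coefficient by a_n^(1/p'). *)
Lemma SK_weighted X Y p (T : X -> Y) : 1 < p -> SK p T -> weighted_sk (conj_exp p) T.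
Proof.
move=> p1 [bT [y [yoo yT]]]; split=> //.
have p0 : 0 < p by rewrite (lt_trans ltr01).
have q1 := conj_exp_gt1 p1; have q0 : 0 < conj_exp p by rewrite (lt_trans ltr01).
pose c n := rnorm (y n) `^ p.
have c0 : nonneg c by move=> n; exact: powR_ge0.
have coo : (nsum c < +oo)%E by apply: lp_norm_fin_nsum => //; exact: ltW.
pose a n := c n + 1 / (2 ^ n.+1)%:R.
have wa : weights a := add_geometric c0 coo.
have a0 n : 0 < a n by case: wa.
have aM r r' : (r + r' = 0) -> forall n, a n `^ r * a n `^ r' = 1.
  by move=> e n; rewrite -powRD e ?powRr0// eqxx/= gt_eqF.
pose z n := of_real (a n `^ (- p^-1)) *: y n.
exists a, z, 1; split=> //.
  move=> n; rewrite /z rnorm_of_realZ ?powR_ge0//.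
  rewrite powRN ler_pdivrMl ?powR_gt0// mulr1.
  have -> : rnorm (y n) = c n `^ p^-1.
    by rewrite /c -powRrM divff ?gt_eqF// powRr1// rnorm_ge0.
  apply: ge0_ler_powR; rewrite ?nnegrE ?invr_ge0 ?(ltW p0) ?(ltW (a0 n)) ?c0//.
  by rewrite lerDl divr_ge0.
move=> x x1; have [l + lT] : p_hull p y (T x) by apply: yT; exists x.
rewrite /sk_coef gt_eqF//= => /(lp_norm_le1_nsum (ltW q1)) l1.
exists (fun n => of_real (a n `^ (p^-1 - 1)) * l n).
  apply: le_trans l1; rewrite le_eqVlt; apply/orP; left; apply/eqP.
  apply: eq_nsum => n; rewrite rnormM rnorm_of_real ?powR_ge0// powRM ?powR_ge0 ?rnorm_ge0//.
  rewrite mulrA -powRrM.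
  have -> : (p^-1 - 1) * conj_exp p = -1.
    by rewrite -opprB -conj_expV// mulNr mulVf// gt_eqF.
  by rewrite powR_inv1 ?(ltW (a0 n))// divff ?mul1r// gt_eqF.
rewrite (_ : combination _ _ _ = series (fun n => (l n : K) *: y n)) //.
apply/funext => n; rewrite /combination /series/= big_mkord; apply: eq_bigr => j _.
rewrite /z scalerA mulrA mulrAC -!of_realM.
have -> : a j * a j `^ (p^-1 - 1) * a j `^ (- p^-1) = 1.
  by rewrite mulr_powRB1 ?invr_gt0 ?(ltW (a0 j))// aM// subrr.
by rewrite of_real1 mul1r.
Qed.

(** For p = 1 the coefficients are bounded by 1, hence bounded in L^2(a). *)
Lemma SK1_weighted X Y (T : X -> Y) : SK 1 T -> weighted_sk 2 T.
Proof.
move=> [bT [y [yoo yT]]]; split=> //.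
pose c n := rnorm (y n).
have c0 : nonneg c by move=> n; exact: rnorm_ge0.
have coo : (nsum c < +oo)%E.
  have := lp_norm_fin_nsum (lexx 1) yoo; rewrite (eq_nsum (t := c))// => n.
  by rewrite powRr1// rnorm_ge0.
pose a n := c n + 1 / (2 ^ n.+1)%:R.
have wa : weights a := add_geometric c0 coo.
have a0 n : 0 < a n by case: wa.
have [A A0 AE] := nsum_fin (weights_ge0 wa) wa.2.
pose z n := of_real (a n)^-1 *: y n.
exists a, z, A; split=> //.
  move=> n; rewrite /z rnorm_of_realZ ?invr_ge0 ?(ltW (a0 n))//.
  by rewrite ler_pdivrMl// mulr1 lerDl divr_ge0.
move=> x x1; have [l + lT] : p_hull 1 y (T x) by apply: yT; exists x.
rewrite /sk_coef eqxx => -[_ l1]; exists l.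
  rewrite -AE; apply: le_nsum => n; first by rewrite mulr_ge0 ?powR_ge0// ltW.
  rewrite ler_piMr ?(ltW (a0 n))// powR_sqr ?rnorm_ge0// expr_le1// rnorm_ge0//.
rewrite (_ : combination _ _ _ = series (fun n => (l n : K) *: y n)) //.
apply/funext => n; rewrite /combination /series/= big_mkord; apply: eq_bigr => j _.
by rewrite /z scalerA mulrAC -of_realM divff ?gt_eqF// of_real1 mul1r.
Qed.

(** The factor a_n = a_n^(1/p) a_n^(1/p') is shared between vectors and
    coefficients.  The latter are moreover divided by C + 1, which brings them
    into the unit ball of l^p' because |xi|^p' <= 1 + |xi|^2 and A <= 1. *)
Lemma weighted_sk_norm X Y p a (y : nat -> Y) (T : X -> Y) (A C : R) : 2 <= p ->
  nonneg a -> (nsum a <= A%:E)%E -> A <= 1 -> 0 <= C -> unit_vectors y ->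
  sk_dominated 2 a y C T ->
  exists2 f, sk_seq p T f &
    (lp_norm p (fun n => (rnorm (f n))%:E) <= ((C + 1) * A `^ p^-1)%:E)%E.
Proof.
move=> p2 a0 aA A1 C0 uy dT.
have p1 : 1 < p by rewrite (lt_le_trans _ p2)// ltr1n.
have p0 : 0 < p by rewrite (lt_trans ltr01).
have q1 := conj_exp_gt1 p1; have q0 : 0 < conj_exp p by rewrite (lt_trans ltr01).
have q2 : conj_exp p <= 2.
  by rewrite /conj_exp ler_pdivrMr ?subr_gt0//; lra.
have A0 : 0 <= A by rewrite -lee_fin (le_trans _ aA)// nsum_ge0.
have C1 : 1 <= C + 1 by rewrite lerDr.
have Cp : 0 < C + 1 by rewrite (lt_le_trans ltr01).
pose f n : Y := of_real ((C + 1) * a n `^ p^-1) *: y n.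
have f0 n : 0 <= (C + 1) * a n `^ p^-1 by rewrite mulr_ge0 ?powR_ge0// ltW.
have fA : (lp_norm p (fun n => (rnorm (f n))%:E) <= ((C + 1) * A `^ p^-1)%:E)%E.
  apply: nsum_le_lp_norm; first exact: ltW.
  - by move=> n; exact: rnorm_ge0.
  - by rewrite mulr_ge0 ?powR_ge0// ltW.
  rewrite powRM ?powR_ge0 ?(ltW Cp)// -powRrM mulVf ?gt_eqF// powRr1//.
  apply: (@le_trans _ _ (((C + 1) `^ p)%:E * nsum a)%E); last first.
    by rewrite EFinM lee_wpmul2l ?lee_fin ?powR_ge0.
  rewrite -nsumZ//; apply: le_nsum => n; first exact: powR_ge0.
  rewrite /f rnorm_of_realZ// powRM ?rnorm_ge0// powRM ?powR_ge0 ?(ltW Cp)//.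
  rewrite -powRrM mulVf ?gt_eqF// powRr1// ler_piMr ?mulr_ge0 ?powR_ge0//.
  apply: (@le_trans _ _ (1 `^ p)); last by rewrite powR1.
  by apply: ge0_ler_powR; rewrite ?nnegrE ?rnorm_ge0 ?(ltW p0).
exists f => //; split; first by apply: (le_lt_trans fA); rewrite ltry.
move=> _ [x x1 <-]; have [xi xiC xiT] := dT x x1.
exists (fun n => of_real (a n `^ (conj_exp p)^-1 / (C + 1)) * xi n).
  rewrite /sk_coef gt_eqF//=; apply: nsum_le_lp_norm => //; first exact: ltW.
    by move=> n; exact: rnorm_ge0.
  rewrite powR1.
  apply: (@le_trans _ _ (((C + 1) `^ (- conj_exp p))%:E *
      nsum (fun n => (a n * rnorm (xi n : K^o) `^ conj_exp p)%R))%E).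
    rewrite -nsumZ; last by move=> n; rewrite mulr_ge0 ?powR_ge0.
    apply: le_nsum => n; first exact: powR_ge0.
    rewrite rnormM rnorm_of_real ?divr_ge0 ?powR_ge0 ?(ltW Cp)//.
    rewrite powRM ?divr_ge0 ?powR_ge0 ?rnorm_ge0 ?(ltW Cp)//.
    rewrite powRM ?invr_ge0 ?powR_ge0 ?(ltW Cp)// -powRrM mulVf ?gt_eqF// powRr1//.
    by rewrite -[_^-1]powR_inv1 ?(ltW Cp)// -powRrM mulN1r mulrCA mulrA.
  have h := nsum_powR_le a0 (fun n => rnorm_ge0 (xi n : K^o)) (ltW q0) q2 aA xiC.
  apply: (@le_trans _ _ (((C + 1) `^ (- conj_exp p))%:E * (A + C)%:E)%E).
    by rewrite lee_wpmul2l ?lee_fin ?powR_ge0.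
  rewrite -EFinM lee_fin powRN ler_pdivrMl ?powR_gt0// mulr1.
  apply: (@le_trans _ _ (C + 1)); first by rewrite addrC lerD2l.
  by apply: le1r_powR => //; exact: ltW.
rewrite (_ : series _ = combination a y xi) //.
apply/funext => n; rewrite /combination /series/= big_mkord; apply: eq_bigr => j _.
rewrite /f scalerA mulrAC -of_realM; congr (_ * _ *: _); congr of_real.
rewrite mulrA divfK ?gt_eqF// conj_expV// -powRD ?subrK ?powRr1//.
by rewrite oner_eq0.
Qed.

End sk_weights.

(** * Composition of compact operators *)

Section sk_composition.
Context {R : realType} {k : scalar_kind}.
Local Notation K := (scalar_field R k).
Implicit Types (X Y Z : normedModType K) (p q s t : R) (a b : nat -> R).

(** Finitely many of the series defining the S y_i are truncated at a common
    place; interchanging the two finite sums exhibits approximants of S w. *)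
Lemma combination_comp_approx Y Z (S : Y -> Z) a (y : nat -> Y) b (z : nat -> Z)
    (xi : nat -> K) (eta : nat -> nat -> K) (w : Y) (e : R) :
  bounded_op S -> 0 < e -> nonneg a ->
  combination a y xi @ \oo --> w ->
  (forall i, combination b z (eta i) @ \oo --> S (y i)) ->
  exists n m, rnorm (S w - combination b z
    (fun j => \sum_(i < n) of_real (a i) * xi i * eta i j) m) <= e.
Proof.
move=> bS e0 a0 /cvg_rnormP yw zS.
have [M M0 SM] := bounded_op_gt0 bS; set c := scalar_re M in SM.
have c0 : 0 < c by exact: scalar_re_gt0.
have [n nP] := yw (e / 2 / c) (divr_gt0 (divr_gt0 e0 (ltr0n _ 2)) c0).
pose D := \sum_(i < n) rnorm (of_real (a i) * xi i : K^o).
have D0 : 0 <= D by apply: sumr_ge0 => i _; exact: rnorm_ge0.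
have D1 : 0 < D + 1 by rewrite ltr_wpDl.
pose d := e / 2 / (D + 1); have d0 : 0 < d by rewrite !divr_gt0.
have /choice[N NP] : forall i, exists N, forall m, (N <= m)%N ->
    rnorm (S (y i) - combination b z (eta i) m) <= d.
  by move=> i; move/cvg_rnormP : (zS i); apply.
exists n, (\max_(i < n) N i); set m := \max_(i < n) N i.
have [L SE] := bounded_opE bS.
have e1 : S (combination a y xi n) - combination b z
    (fun j => \sum_(i < n) of_real (a i) * xi i * eta i j) m =
    \sum_(i < n) (of_real (a i) * xi i) *: (S (y i) - combination b z (eta i) m).
  rewrite SE /combination linear_sum.
  under [X in _ - X]eq_bigr do rewrite mulr_sumr scaler_suml.
  rewrite exchange_big/= -sumrB; apply: eq_bigr => i _.
  rewrite linearZ scalerBr; congr (_ - _); rewrite scaler_sumr; apply: eq_bigr => j _.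
  by rewrite scalerA mulrCA.
have -> : S w - combination b z
    (fun j => \sum_(i < n) of_real (a i) * xi i * eta i j) m =
    S (w - combination a y xi n) + \sum_(i < n)
    (of_real (a i) * xi i) *: (S (y i) - combination b z (eta i) m).
  by rewrite -e1 SE linearB addrA subrK.
apply: (le_trans (rnormD _ _)); rewrite [leRHS]splitr; apply: lerD.
  by apply: (le_trans (SM _)); rewrite mulrC -ler_pdivlMr//; exact: nP.
apply: (le_trans (rnorm_sum _ _ _)); apply: (@le_trans _ _ (D * d)).
  rewrite mulr_suml; apply: ler_sum => i _; rewrite rnormZ.
  rewrite ler_wpM2l ?rnorm_ge0//.
  by apply: NP; exact: (leq_bigmax (F := fun i : 'I_n => N i) i).
rewrite /d mulrA ler_pdivrMr// mulrC ler_wpM2l ?divr_ge0 ?(ltW e0)//.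
by rewrite lerDl.
Qed.

(** Hoelder's inequality with the exponents 1/t + (1 - 1/q) + (1 - 1/s) = 1,
    splitting x h = (x^s h^q)^(1/t) (x^s)^(1 - 1/q) (h^q)^(1 - 1/s). *)
Lemma kernel_hoelder s q t a (x h : nat -> R) (C H E : R) :
  1 < s -> 1 < q -> 1 < t -> t^-1 = s^-1 + q^-1 - 1 ->
  nonneg a -> nonneg x -> nonneg h ->
  (nsum (fun i => (a i * x i `^ s)%R) <= C%:E)%E ->
  (nsum (fun i => (a i * x i `^ s * h i `^ q)%R) <= H%:E)%E ->
  (nsum (fun i => (a i * h i `^ q)%R) <= E%:E)%E ->
  (nsum (fun i => (a i * x i * h i)%R) <=
     (H `^ t^-1 * C `^ (1 - q^-1) * E `^ (1 - s^-1))%:E)%E.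
Proof.
move=> s1 q1 t1 tE a0 x0 h0 xC xH hE.
have s0 : 0 < s by rewrite (lt_trans ltr01).
have q0 : 0 < q by rewrite (lt_trans ltr01).
have t0 : 0 < t^-1 by rewrite invr_gt0 (lt_trans ltr01).
have sV : 0 < 1 - s^-1 by rewrite subr_gt0 invf_lt1.
have qV : 0 < 1 - q^-1 by rewrite subr_gt0 invf_lt1.
have eE : t^-1 + (1 - q^-1) + (1 - s^-1) = 1 by rewrite tE; ring.
have n1 : nonneg (fun i => a i * x i `^ s) by move=> i; rewrite mulr_ge0 ?powR_ge0.
have n2 : nonneg (fun i => a i * x i `^ s * h i `^ q) by move=> i; rewrite !mulr_ge0 ?powR_ge0.
have n3 : nonneg (fun i => a i * h i `^ q) by move=> i; rewrite mulr_ge0 ?powR_ge0.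
apply: le_trans (nsum_hoelder3_le t0 qV sV eE n2 n1 n3 xH xC hE).
apply: le_nsum => i; first by rewrite !mulr_ge0.
rewrite le_eqVlt; apply/orP; left; apply/eqP.
rewrite !powRM ?mulr_ge0 ?powR_ge0// -!powRrM.
have e1 : a i = a i `^ t^-1 * a i `^ (1 - q^-1) * a i `^ (1 - s^-1).
  by rewrite -!powRD ?eE ?oner_eq0// ?powRr1// gt_eqF// addr_gt0.
have e2 : x i = x i `^ (s * t^-1) * x i `^ (s * (1 - q^-1)).
  have e : s * t^-1 + s * (1 - q^-1) = 1.
    rewrite -mulrDr (_ : t^-1 + _ = s^-1) ?divff ?gt_eqF//.
    by rewrite tE; ring.
  by rewrite -powRD ?e ?oner_eq0// powRr1.
have e3 : h i = h i `^ (q * t^-1) * h i `^ (q * (1 - s^-1)).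
  have e : q * t^-1 + q * (1 - s^-1) = 1.
    rewrite -mulrDr (_ : t^-1 + _ = q^-1) ?divff ?gt_eqF//.
    by rewrite tE; ring.
  by rewrite -powRD ?e ?oner_eq0// powRr1.
by rewrite {1}e1 {1}e2 {1}e3; ring.
Qed.

(** The exponents are the dual ones: 1/t - 1 = (1/s - 1) + (1/q - 1) says that
    the ideals' exponents obey 1/r = 1/p + 1/q.  Let eta_i be coefficients of
    S y_i and e_j = sum_i a_i |eta_ij|^q.  For the weights b_j (1 + e_j) the
    vector S (T x) has coefficients zeta_j / (1 + e_j) with
    zeta_j = sum_i a_i xi_i eta_ij. *)
Lemma weighted_sk_comp X Y Z s q t (T : X -> Y) (S : Y -> Z) :
  1 < s -> 1 < q -> 1 < t -> t^-1 = s^-1 + q^-1 - 1 ->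
  weighted_sk s T -> weighted_sk q S -> weighted_sk t (S \o T).
Proof.
move=> s1 q1 t1 tE [bT [a [y [C [wa uy C0 dT]]]]] [bS [b [z [D [wb uz D0 dS]]]]].
split; first exact: bounded_op_comp.
have s0 : 0 < s by rewrite (lt_trans ltr01).
have q0 : 0 < q by rewrite (lt_trans ltr01).
have t0 : 0 < t by rewrite (lt_trans ltr01).
have a0 := weights_ge0 wa; have b0 := weights_ge0 wb.
have [A A0 AE] := nsum_fin a0 wa.2.
have kr (c : K) : 0 <= rnorm (c : K^o) by exact: rnorm_ge0.
have /choice[eta etaP] : forall i, exists eta : nat -> K,
    (nsum (fun j => (b j * rnorm (eta j : K^o) `^ q)%R) <= D%:E)%E /\
    combination b z eta @ \oo --> S (y i).
  by move=> i; have [eta e1 e2] := dS (y i) (uy i); exists eta.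
pose h i j := rnorm (eta i j : K^o) `^ q.
have h0 i j : 0 <= h i j by exact: powR_ge0.
have bh0 i : nonneg (fun j => b j * h i j) by move=> j; rewrite mulr_ge0.
have bhD i : (nsum (fun j => (b j * h i j)%R) <= D%:E)%E by case: (etaP i).
have ah0 j : nonneg (fun i => a i * h i j) by move=> i; rewrite mulr_ge0.
have hD i j : h i j <= D / b j.
  rewrite ler_pdivlMr; last by case: wb.
  by rewrite mulrC; exact: (@term_le_nsum _ (fun j => b j * h i j) _ j (bh0 i) (bhD i)).
have /choice[e eE] : forall j, exists e : R, 0 <= e /\
    nsum (fun i => a i * h i j) = e%:E.
  move=> j; have [||e e0 eE] := @nsum_fin R (fun i => a i * h i j) => //; last by exists e.
  apply: (@le_lt_trans _ _ ((D / b j)%:E * nsum a)%E); last by rewrite AE ltry.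
  by rewrite -nsumZ//; apply: le_nsum => // i; rewrite mulrC ler_wpM2r.
have e0 j : 0 <= e j by case: (eE j).
have swap (g : nat -> R) : nonneg g ->
    (\sum_(0 <= j <oo) (b j)%:E * nsum (fun i => (a i * g i * h i j)%R) <=
     D%:E * nsum (fun i => (a i * g i)%R))%E.
  move=> g0; have ag0 : nonneg (fun i => a i * g i) by move=> i; rewrite mulr_ge0.
  rewrite (@eq_eseriesr _ _ (fun j => nsum (fun i => (b j * (a i * g i * h i j))%R)));
    last by move=> j _; rewrite nsumZ// => i; rewrite !mulr_ge0.
  rewrite -(@nsum_interchange R (fun i j => b j * (a i * g i * h i j))); last first.
    by move=> i j; rewrite !mulr_ge0.
  rewrite -nsumZ//; apply: lee_nneseries => i *.
    by apply: nsum_ge0 => j; rewrite !mulr_ge0.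
  rewrite (eq_nsum (t := fun j => (a i * g i) * (b j * h i j))); last by move=> j; ring.
  by rewrite nsumZ// [D * _]mulrC [leRHS]EFinM lee_wpmul2l ?lee_fin// mulr_ge0.
have be0 : nonneg (fun j => b j * e j) by move=> j; rewrite mulr_ge0.
have beoo : (nsum (fun j => (b j * e j)%R) < +oo)%E.
  apply: (@le_lt_trans _ _ (D%:E * nsum (fun i => (a i * 1)%R))%E); last first.
    by under eq_nsum do rewrite mulr1; rewrite AE ltry.
  apply: le_trans (swap (fun=> 1) (fun=> ler01)).
  apply: lee_nneseries => j *; first by rewrite lee_fin.
  by rewrite EFinM -(eE j).2; under [X in (_ <= _ * X)%E]eq_nsum do rewrite mulr1.
pose w j := b j + b j * e j.
have w0 : nonneg w by move=> j; rewrite addr_ge0.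
have ww : weights w.
  split=> [j|]; first by rewrite ltr_wpDr//; case: wb.
  by rewrite nsumD// lte_add_pinfty//; case: wb.
pose M := C `^ (t * (1 - q^-1)); have M0 : 0 <= M by exact: powR_ge0.
exists w, z, (M * (D * C)); split=> //; first by rewrite !mulr_ge0.
move=> x x1; have [xi xiC xiT] := dT x x1.
apply: sk_hull_closed => //; first by rewrite !mulr_ge0.
move=> ep ep0; have [n [m nmP]] := combination_comp_approx bS ep0 a0 xiT (fun i => (etaP i).2).
pose zeta j := \sum_(i < n) of_real (a i) * xi i * eta i j.
have e1 j : 0 < 1 + e j by rewrite ltr_wpDr.
exists m, (fun j => of_real (1 + e j)^-1 * zeta j); split; last first.
  rewrite (_ : combination w z _ m = combination b z zeta m)//.
  apply: eq_bigr => j _; congr (_ *: _); rewrite mulrA -of_realM /w.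
  by rewrite -[X in X + _]mulr1 -mulrDr mulfK// gt_eqF.
pose gx i := rnorm (xi i : K^o) `^ s.
have gx0 : nonneg gx by move=> i; exact: powR_ge0.
have agh0 j : nonneg (fun i => a i * gx i * h i j) by move=> i; rewrite !mulr_ge0.
have /choice[H HP] : forall j, exists H : R, 0 <= H /\
    nsum (fun i => a i * gx i * h i j) = H%:E.
  move=> j; have [|H H0 HE] := @nsum_fin R _ (agh0 j); last by exists H.
  apply: (@le_lt_trans _ _ ((D / b j)%:E * C%:E)%E); last by rewrite -EFinM ltry.
  apply: (@le_trans _ _ ((D / b j)%:E * nsum (fun i => (a i * gx i)%R))%E).
    rewrite -nsumZ; last by move=> i; rewrite mulr_ge0.
    by apply: le_nsum => // i; rewrite mulrC ler_wpM2r ?mulr_ge0.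
  by rewrite lee_wpmul2l// lee_fin divr_ge0.
have H0 j : 0 <= H j by case: (HP j).
have zle j : w j * rnorm (of_real (1 + e j)^-1 * zeta j : K^o) `^ t <= M * (b j * H j).
  have z1 : rnorm (zeta j : K^o) <= H j `^ t^-1 * C `^ (1 - q^-1) * e j `^ (1 - s^-1).
    apply: (le_trans (@rnorm_sum _ _ K^o _ _ _ _)).
    apply: (@le_trans _ _ (\sum_(i < n) a i * rnorm (xi i : K^o) * rnorm (eta i j : K^o))).
      by apply: ler_sum => i _; rewrite !rnormM rnorm_of_real.
    have nn : nonneg (fun i => a i * rnorm (xi i : K^o) * rnorm (eta i j : K^o)).
      by move=> i; rewrite !mulr_ge0.
    rewrite -lee_fin; apply: (le_trans (psum_le_nsum n nn)).
    by apply: (kernel_hoelder s1 q1 t1 tE a0) => //; rewrite -/(h _ _) ?(HP j).2 ?(eE j).2.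
  have z2 : rnorm (zeta j : K^o) `^ t <= M * H j * e j `^ (t * (1 - s^-1)).
    apply: (@le_trans _ _ ((H j `^ t^-1 * C `^ (1 - q^-1) * e j `^ (1 - s^-1)) `^ t)).
      by apply: ge0_ler_powR; rewrite ?nnegrE ?mulr_ge0 ?powR_ge0 ?(ltW t0).
    rewrite !powRM ?mulr_ge0 ?powR_ge0// -!powRrM mulVf ?gt_eqF// powRr1//.
    by rewrite /M [(1 - q^-1) * t]mulrC [(1 - s^-1) * t]mulrC [H j * _]mulrC.
  rewrite rnormM rnorm_of_real ?invr_ge0 ?(ltW (e1 j))// powRM ?invr_ge0 ?(ltW (e1 j))//.
  have -> : w j = b j * (1 + e j) by rewrite /w mulrDr mulr1.
  have sV : 0 <= 1 - s^-1 by rewrite subr_ge0 invf_le1// ltW.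
  have z3 : e j `^ (t * (1 - s^-1)) <= (1 + e j) `^ (t * (1 - s^-1)).
    by apply: ge0_ler_powR; rewrite ?nnegrE ?mulr_ge0 ?(ltW t0) ?(ltW (e1 j))// lerDr.
  have st : t^-1 <= s^-1.
    by rewrite tE -addrA gerDl subr_le0 invf_le1// ltW.
  (* The total power of 1 + e_j is 1 - t / s, and t >= s. *)
  have z4 : (1 + e j) * (1 + e j)^-1 `^ t * (1 + e j) `^ (t * (1 - s^-1)) <= 1.
    rewrite -{1}[1 + e j]powRr1 ?(ltW (e1 j))// -[(1 + e j)^-1]powR_inv1 ?(ltW (e1 j))//.
    have eN : 1 + e j != 0 by rewrite gt_eqF.
    rewrite -powRrM -!powRD ?eN ?implybT//.
    rewrite (_ : 1 + -1 * t + t * (1 - s^-1) = 1 - t / s); last by ring.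
    apply: (@le_trans _ _ ((1 + e j) `^ 0)); last by rewrite powRr0.
    apply: ler_powR; first by rewrite lerDl.
    rewrite subr_le0 -[leLHS](mulfV (_ : t != 0)) ?gt_eqF//.
    by rewrite ler_wpM2l// ltW.
  apply: (@le_trans _ _ (b j * (1 + e j) * ((1 + e j)^-1 `^ t *
      (M * H j * (1 + e j) `^ (t * (1 - s^-1)))))).
    rewrite ler_wpM2l ?mulr_ge0 ?(ltW (e1 j))// ler_wpM2l ?powR_ge0//.
    by apply: (le_trans z2); rewrite ler_wpM2l// mulr_ge0.
  rewrite [X in X <= _](_ : _ = M * (b j * H j) * ((1 + e j) * (1 + e j)^-1 `^ t *
    (1 + e j) `^ (t * (1 - s^-1)))); last by ring.
  by rewrite ler_piMr// !mulr_ge0.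
have MbH0 : nonneg (fun j => M * (b j * H j)) by move=> j; rewrite !mulr_ge0.
apply: (@le_trans _ _ (nsum (fun j => M * (b j * H j)))).
  by apply: le_nsum => j //; rewrite mulr_ge0 ?powR_ge0.
have bH0 : nonneg (fun j => b j * H j) by move=> j; rewrite !mulr_ge0.
rewrite nsumZ//; apply: (@le_trans _ _ (M%:E * (D * C)%:E)%E); last first.
  by rewrite -EFinM lee_fin lerDl ltW.
rewrite lee_wpmul2l ?lee_fin//; apply: (@le_trans _ _ (D%:E * nsum (fun i => (a i * gx i)%R))%E).
  apply: le_trans (swap gx gx0); apply: lee_nneseries => j *.
    by rewrite lee_fin.
  by rewrite (HP j).2 EFinM.
by rewrite EFinM lee_wpmul2l ?lee_fin.
Qed.

End sk_composition.

(** * Finite-rank approximation for exponent 2, compact case *)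

Section sk_approximation.
Context {R : realType} {k : scalar_kind}.
Local Notation K := (scalar_field R k).
Implicit Types (X Y : normedModType K) (a : nat -> R).

Lemma combinationD Y a (y : nat -> Y) (c : K) (xi eta : nat -> K) n :
  combination a y (fun j => c * xi j + eta j) n =
  c *: combination a y xi n + combination a y eta n.
Proof.
rewrite /combination scaler_sumr -big_split/=; apply: eq_bigr => j _.
by rewrite scalerA -scalerDl mulrDr mulrCA.
Qed.

Lemma cvg_combinationD Y a (y : nat -> Y) (c : K) (xi eta : nat -> K) (v w : Y) :
  combination a y xi @ \oo --> v -> combination a y eta @ \oo --> w ->
  combination a y (fun j => c * xi j + eta j) @ \oo --> c *: v + w.
Proof.
move=> xv ew; rewrite (_ : combination a y (fun j => _) =
  fun n => c *: combination a y xi n + combination a y eta n).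
  by apply: cvgD => //; exact: cvgZl_tmp.
by apply/funext => n; rewrite combinationD.
Qed.

Lemma l2_zero a (g : nat -> K) : (forall j, 0 < a j) -> l2 a g -> dot a g g = 0 ->
  g = fun=> 0.
Proof.
move=> a0 lg g0; have a0' : nonneg a by move=> j; exact: ltW.
apply/funext => j; apply: (@rnorm_eq0 _ _ K^o); apply/eqP.
have := @term_le_nsum _ (sqterm a g) 0 j (sqterm_ge0 a0' g).
rewrite (dotgg a0' lg) g0 => /(_ (lexx _)); rewrite /sqterm pmulr_rle0// => h.
by rewrite -sqrf_eq0 eq_le h sqr_ge0.
Qed.

Definition solution X Y a (y : nat -> Y) (T : X -> Y) (x : X) (xi : nat -> K) :=
  l2 a xi /\ combination a y xi @ \oo --> T x.

Lemma solutionD X Y a (y : nat -> Y) (T : X -> Y) (c : K) x x' xi xi' :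
  nonneg a -> bounded_op T ->
  solution a y T x xi -> solution a y T x' xi' ->
  solution a y T (c *: x + x') (fun j => c * xi j + xi' j).
Proof.
move=> a0 bT [lx cx] [lx' cx']; split; first by apply: l2D => //; exact: l2Z.
by rewrite (bounded_op_add _ _ bT) (bounded_op_scale _ _ bT); exact: cvg_combinationD.
Qed.

Lemma nsum_sqterm a (xi : nat -> K) :
  nsum (fun j => a j * rnorm (xi j : K^o) `^ 2) = nsum (sqterm a xi).
Proof. by apply: eq_nsum => j; rewrite powR_sqr// rnorm_ge0. Qed.

(** T lifts to a linear map into l^2: the solution xi of least norm of
    sum_j a_j xi_j y_j = T x is the one orthogonal to the solutions of the
    homogeneous equation, so it depends linearly on x. *)
Lemma sk2_linear_lifting X Y a (y : nat -> Y) C (T : X -> Y) :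
  bounded_op T -> weights a -> unit_vectors y -> 0 <= C -> sk_dominated 2 a y C T ->
  exists xi : X -> nat -> K, [/\
    forall c x x' j, xi (c *: x + x') j = c * xi x j + xi x' j,
    forall x, solution a y T x (xi x) &
    forall x, dot a (xi x) (xi x) <= C * rnorm x ^+ 2].
Proof.
move=> bT wa uy C0 dT; have a0 := weights_ge0 wa.
have sol0 : solution a y T 0 (fun=> 0).
  split; first by rewrite /l2 (eq_nsum (t := fun=> 0)) ?nsum0// => j;
    rewrite /sqterm (@rnorm0 _ _ K^o) expr0n mulr0.
  rewrite (bounded_op_lin0 bT) (_ : combination _ _ _ = fun=> 0); first exact: cvg_cst.
  by apply/funext => n; rewrite /combination big1// => j _; rewrite mulr0 scale0r.
have solZ c x xi : solution a y T x xi -> solution a y T (c *: x) (fun j => c * xi j).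
  move=> sx; have := solutionD c a0 bT sx sol0; rewrite addr0.
  by rewrite (_ : (fun j => c * xi j + 0) = fun j => c * xi j)//; apply/funext => j; rewrite addr0.
have exists_sol x : exists2 xi, solution a y T x xi & dot a xi xi <= C * rnorm x ^+ 2.
  have [x0|x0] := eqVneq (rnorm x) 0.
    exists (fun=> 0); first by rewrite (rnorm_eq0 x0).
    rewrite x0 expr0n mulr0 -lee_fin -dotgg//; last by case: sol0.
    rewrite (eq_nsum (t := fun=> 0)) ?nsum0// => j.
    by rewrite /sqterm (@rnorm0 _ _ K^o) expr0n mulr0.
  have xp : 0 < rnorm x by rewrite lt_neqAle eq_sym x0 rnorm_ge0.
  pose x1 := of_real (rnorm x)^-1 *: x.
  have x11 : rnorm x1 <= 1 by rewrite rnorm_of_realZ ?invr_ge0 ?(ltW xp)// mulVf.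
  have [xi xiC xiT] := dT x1 x11; rewrite nsum_sqterm in xiC.
  have lxi : l2 a xi by apply: (le_lt_trans xiC); rewrite ltry.
  have xE : x = of_real (rnorm x) *: x1 by rewrite scalerA -of_realM divff// of_real1 scale1r.
  exists (fun j => of_real (rnorm x) * xi j); first by rewrite {1}xE; apply: solZ.
  rewrite dotgg_scale// rnorm_of_real ?rnorm_ge0// mulrC ler_wpM2r ?sqr_ge0//.
  by rewrite -lee_fin -dotgg.
have /choice[xi xiP] : forall x, exists xi, solution a y T x xi /\
    forall xi', solution a y T x xi' -> dot a xi xi <= dot a xi' xi'.
  move=> x; pose E := [set dot a xi xi | xi in solution a y T x].
  have hE : has_inf E.
    have [xi sxi _] := exists_sol x; split; first by exists (dot a xi xi); exists xi.
    by exists 0 => _ [xi' [lxi' _] <-]; exact: dotgg_ge0.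
  have rho0 : 0 <= inf E.
    by apply: lb_le_inf; [case: hE|move=> _ [xi' [lxi' _] <-]; exact: dotgg_ge0].
  have [] := @sk_hull_closed R k Y a y 2 (inf E) (T x) _ wa uy rho0.
  - by rewrite ltr1n.
  - move=> e e0; have [_ [xi [lxi cxi] <-] xiE] := inf_adherent e0 hE.
    have [n nP] := (cvg_rnormP _ _).1 cxi e e0.
    exists n, xi; split; last exact: nP.
    by rewrite nsum_sqterm dotgg// lee_fin ltW.
  move=> xi; rewrite nsum_sqterm => xiE cxi.
  have lxi : l2 a xi by apply: (le_lt_trans xiE); rewrite ltry.
  exists xi; split=> // xi' sxi'.
  rewrite dotgg// lee_fin in xiE; apply: (le_trans xiE).
  by apply: ge_inf; [case: hE|exists xi'].
have sxi x : solution a y T x (xi x) by case: (xiP x).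
have lxi x : l2 a (xi x) by case: (sxi x).
have orth x m : solution a y T 0 m -> dot a (xi x) m = 0.
  move=> sm; have lm : l2 a m by case: sm.
  apply: minimal_dot => // t; apply: (xiP x).2.
  have := solutionD (of_real t) a0 bT sm (sxi x); rewrite scaler0 add0r.
  by rewrite (_ : (fun j => _) = fun j => xi x j + of_real t * m j)//; apply/funext => j; rewrite addrC.
exists xi; split=> //; last first.
  move=> x; have [xi' sxi' xiC] := exists_sol x.
  by apply: le_trans xiC; exact: (xiP x).2.
move=> c x x' j.
pose d j := (-1) * (c * xi x j + xi x' j) + xi (c *: x + x') j.
have sd : solution a y T 0 d.
  have := solutionD (-1) a0 bT (solutionD c a0 bT (sxi x) (sxi x')) (sxi (c *: x + x')).
  by rewrite scaleN1r addNr.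
have ld : l2 a d by case: sd.
have lc : l2 a (fun j => c * xi x j) by exact: l2Z.
have lcx : l2 a (fun j => c * xi x j + xi x' j) by exact: l2D.
have sN1 : (-1 : K) = of_real (-1) by rewrite /of_real; case: k => //=; rewrite rmorphN1.
have d0 : dot a d d = 0.
  rewrite {1}/d dotDl//; last exact: l2Z.
  rewrite orth// addr0 sN1 dotZl// dotDl// [dot a (xi x') d]orth// addr0.
  have [c' cE] := dot_adj a c; rewrite cE orth ?mulr0//.
  by rewrite -[X in solution _ _ _ X](scaler0 _ c'); exact: solZ.
have /(congr1 (fun g => g j)) := l2_zero wa.1 ld d0.
by rewrite /d mulN1r addrC => /eqP; rewrite subr_eq0 => /eqP.
Qed.

Lemma weighted_sk2_approx X Y (T : X -> Y) : weighted_sk 2 T ->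
  exists2 C, 0 <= C & forall eps : R, 0 < eps -> exists2 F, finite_rank F &
    exists b y, [/\ nonneg b, (nsum b <= eps%:E)%E, unit_vectors y &
      sk_dominated 2 b y C (T - F)].
Proof.
move=> [bT [a [y [C [wa uy C0 dT]]]]]; exists C => // eps eps0.
have a0 := weights_ge0 wa.
have [xi [xilin xisol xiC]] := sk2_linear_lifting bT wa uy C0 dT.
have [N NP] := nsum_tail_small a0 wa.2 eps0.
pose u j (x : X) : K^o := of_real (a j) * xi x j.
have bu j : bounded_op (u j).
  split=> [c x x'|].
    by rewrite /u xilin mulrDr mulrCA.
  have aj : 0 < a j by case: wa.
  pose M := C / a j + 1; have M1 : 1 <= M by rewrite /M lerDr divr_ge0.
  exists (a j * M) => x.
  rewrite [leLHS](rnormM (of_real (a j)) (xi x j)) rnorm_of_real// -mulrA ler_wpM2l//.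
  rewrite -ler_sqr ?nnegrE ?rnorm_ge0//; last first.
    by rewrite mulr_ge0 ?rnorm_ge0// (le_trans ler01).
  have h := @term_le_nsum _ (sqterm a (xi x)) (C * rnorm x ^+ 2) j (sqterm_ge0 a0 _).
  have {h} : sqterm a (xi x) j <= C * rnorm x ^+ 2.
    by apply: h; rewrite dotgg ?lee_fin//; case: (xisol x).
  rewrite /sqterm mulrC -ler_pdivlMr// => /le_trans; apply.
  rewrite mulrAC exprMn ler_wpM2r ?sqr_ge0//.
  apply: (@le_trans _ _ M); first by rewrite /M lerDl.
  by rewrite expr2 ler_peMl// (le_trans ler01).
exists (fun x => \sum_(j < N) (u j x : K) *: y j); first exact: finite_rank_sum.
exists (tail N a), y; split=> //; first exact: tail_ge0.
move=> x x1; exists (xi x).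
  have [lx _] := xisol x.
  apply: (@le_trans _ _ (nsum (sqterm a (xi x)))).
    rewrite -nsum_sqterm; apply: le_nsum => j.
      by rewrite mulr_ge0 ?powR_ge0//; exact: tail_ge0.
    by rewrite ler_wpM2r ?powR_ge0//; exact: tail_le.
  rewrite dotgg// lee_fin; apply: (le_trans (xiC x)).
  by rewrite ler_piMr// expr_le1// rnorm_ge0.
have [_ /cvg_rnormP cx] := xisol x.
apply/cvg_rnormP => e e0; have [n0 n0P] := cx e e0; exists (maxn n0 N) => n.
rewrite geq_max => /andP[n0n Nn].
have -> : combination (tail N a) y (xi x) n = combination a y (xi x) n - combination a y (xi x) N.
  rewrite /combination (big_ord_widen n (fun j => (of_real (a j) * xi x j) *: y j) Nn).
  rewrite [X in _ - X]big_mkcond/= -sumrB; apply: eq_bigr => j _; rewrite /tail.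
  case: ifP => _; last by rewrite subr0.
  rewrite subrr (_ : of_real 0 = 0) ?mul0r ?scale0r//.
  by rewrite /of_real; case: k.
rewrite (_ : (T - _) x - _ = T x - combination a y (xi x) n); first exact: n0P.
by rewrite fctE opprB addrA -[combination a y (xi x) N]/(\sum_(j < N) (u j x : K) *: y j) subrK.
Qed.

End sk_approximation.

(** * Products in the quotient algebra *)

Section op_approximation.
Context {R : realType} {k : scalar_kind} {X : normedModType (scalar_field R k)}.

Definition op_approximable (T : X -> X) := forall e : R, 0 < e ->
  exists2 F, finite_rank F & forall x, rnorm ((T - F) x) <= e * rnorm x.

Lemma op_compBr (S T F : X -> X) : bounded_op S -> S \o (T - F) = (S \o T) - (S \o F).
Proof.
by move=> bS; have [L ->] := bounded_opE bS; apply/funext => x; rewrite !fctE /= linearB.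
Qed.

End op_approximation.

Section ideal_index.
Context {R : realType} {k : scalar_kind} {X : normedModType (scalar_field R k)}.
Local Notation K := (scalar_field R k).
Implicit Types (J : endo_ideal X) (p q r : R).

Lemma products_vanishP J n : (0 < n)%N ->
  (forall (T : ideal_elt J) (s : seq (ideal_elt J)), size s = n.-1 ->
     fr_closure J (foldl (@elt_comp _ _ _ J) T s)) ->
  products_vanish (quotient_algebra J) n.
Proof.
move=> n0 cl; split=> // a s; rewrite /= => sn.
have {sn} sn : size s = n.-1 by rewrite -sn.
have foldE T (s' : seq (ideal_elt J)) :
    foldl (@fr_mul _ _ _ J) (fr_class T) (map (@fr_class _ _ _ J) s') =
    fr_class (foldl (@elt_comp _ _ _ J) T s').
  by elim: s' T => //= S s' IH T; rewrite fr_mul_class IH.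
have sE : s = map (@fr_class _ _ _ J) (map repr s).
  by rewrite -map_comp -[LHS]map_id; apply: eq_map => x /=; rewrite fr_class_repr.
rewrite -[LHS]/(foldl (@fr_mul _ _ _ J) a s) sE -[a]fr_class_repr foldE.
transitivity (fr_class (0 : ideal_elt J)); last by rewrite /fr_class piE.
apply/fr_classP; rewrite -[X in fr_closure J X]/(elt_op (_ - 0)) subr0.
by apply: cl; rewrite size_map.
Qed.

Lemma nil_index_le J n : products_vanish (quotient_algebra J) n ->
  exists h : nilpotent (quotient_algebra J), (nil_index h <= n)%N.
Proof.
move=> pn; exists (ex_intro _ n pn); rewrite /nil_index.
by case: ex_minnP => m _; apply; apply/asboolP.
Qed.

(** Enlarging the exponent max(2, p / m) of a product of m factors to q makes one
    more composition end exactly at max(2, p / (m + 1)). *)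
Lemma next_exponent p m : 2 < p -> (0 < m)%N -> exists q : R,
  [/\ 0 < q, Num.max 2 (p / m%:R) <= q &
      (Num.max 2 (p / m.+1%:R))^-1 = p^-1 + q^-1].
Proof.
move=> p2 m0; have p0 : 0 < p by rewrite (lt_trans _ p2).
have mR : 0 < m%:R :> R by rewrite ltr0n.
have mR1 : 0 < m.+1%:R :> R by rewrite ltr0n.
set r := Num.max 2 (p / m.+1%:R).
have r2 : 2 <= r by rewrite le_max lexx.
have r0 : 0 < r by rewrite (lt_le_trans _ r2).
have rp : r < p.
  rewrite gt_max p2 ltr_pdivrMr// -{1}[p]mulr1 ltr_pM2l// ltr1n.
  by rewrite ltnS.
have d0 : 0 < r^-1 - p^-1 by rewrite subr_gt0 ltf_pV2.
exists (r^-1 - p^-1)^-1; rewrite invr_gt0 d0 invrK; split=> //; last first.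
  by rewrite addrC subrK.
have r1 : r^-1 <= 2^-1 by rewrite lef_pV2 ?posrE.
have rm : r^-1 <= m.+1%:R / p.
  rewrite -[leRHS]invrK lef_pV2 ?posrE ?invr_gt0 ?divr_gt0// invf_div.
  by rewrite le_max lexx orbT.
rewrite ge_max; apply/andP; split.
  rewrite -[leLHS]invrK lef_pV2 ?posrE ?invr_gt0//.
  by apply: le_trans r1; rewrite lerBlDr lerDl invr_ge0 ltW.
rewrite -[leLHS]invrK lef_pV2 ?posrE ?invr_gt0 ?divr_gt0// invf_div.
by rewrite lerBlDr -[X in _ + X]mul1r -mulrDl natr1.
Qed.

(** The exponent p / m shrinks with the number m of factors until it reaches 2. *)
Lemma product_exponent J (W : R -> (X -> X) -> Prop) p :
  2 < p -> (forall T, J T -> W p T) ->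
  (forall q r T, 2 <= q -> q <= r -> W q T -> W r T) ->
  (forall q r S T, 2 <= q -> 2 <= r -> r^-1 = p^-1 + q^-1 ->
     W p T -> W q S -> W r (S \o T)) ->
  forall (T : ideal_elt J) s,
  W (Num.max 2 (p / (size s).+1%:R)) (foldl (@elt_comp _ _ _ J) T s).
Proof.
move=> p2 JW incl comp T; elim/last_ind => [|s S IH].
  rewrite /= divr1 max_r ?(ltW p2)//; apply: JW; exact: elt_opP.
rewrite foldl_rcons size_rcons.
have [q [q0 qm qE]] := next_exponent p2 (ltn0Sn (size s)).
have q2 : 2 <= q by apply: le_trans qm; rewrite le_max lexx.
apply: (comp q) => //; first by rewrite le_max lexx.
  by apply: JW; exact: elt_opP.
by apply: incl IH => //; rewrite le_max lexx.
Qed.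

End ideal_index.

(** * Products of operators and the closure of the finite-rank operators *)

Section qn_index.
Context {R : realType} {k : scalar_kind}.
Local Notation K := (scalar_field R k).
Variables (p : R) (hp : 1 <= p) (X : normedModType K).
Let p0 : 0 < p. Proof. exact: lt_le_trans hp. Qed.

Lemma weighted_qn2_op_approximable (T : X -> X) : weighted_qn 2 T -> op_approximable T.
Proof.
move=> wT e e0; have [F fF [b [u [b0 be uu dT]]]] := weighted_qn2_approx (exprn_gt0 2 e0) wT.
exists F => // x; rewrite -ler_sqr ?nnegrE ?rnorm_ge0//; last first.
  by rewrite mulr_ge0 ?rnorm_ge0// ltW.
rewrite -lee_fin -powR_sqr ?rnorm_ge0//; apply: (le_trans (dT x)); rewrite mul1e.
rewrite exprMn mulrC EFinM; apply: (@le_trans _ _ ((rnorm x ^+ 2)%:E * nsum b)%E).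
  rewrite -nsumZ//; apply: le_nsum => j; first by rewrite mulr_ge0 ?powR_ge0.
  rewrite mulrC ler_wpM2r// powR_sqr ?rnorm_ge0// lerXn2r ?nnegrE ?rnorm_ge0//.
  by case: (uu j).
by rewrite lee_wpmul2l// lee_fin sqr_ge0.
Qed.

Lemma qn_comp_approximable (S T : X -> X) : QN p S -> bounded_op T ->
  op_approximable T -> QN p (S \o T) -> fr_closure (QN_ideal hp X) (S \o T).
Proof.
move=> [bS [f Sf]] bT aT QST; split=> // e e0.
have [L L0 LE] : exists2 L : R, 0 <= L & lp_norm p (fun n => op_norm (f n)) = L%:E.
  case: Sf => _ foo _; exists (fine (lp_norm p (fun n => op_norm (f n)))).
    by rewrite fine_ge0// lp_norm_ge0.
  by rewrite fineK// ge0_fin_numE// lp_norm_ge0.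
have L1 : 0 < L + 1 by rewrite ltr_wpDl.
have d0 : 0 < e / (L + 1) by rewrite divr_gt0.
have [F fF TF] := aT _ d0; exists (S \o F); split; first exact: finite_rank_compl.
rewrite -op_compBr//.
have TF' x : rnorm ((T - F) x) <= scalar_re (of_real (e / (L + 1)) : K) * rnorm x.
  by rewrite scalar_re_of_real.
have bTF : bounded_op (T - F) by apply: bounded_opB => //; case: fF.
have [h hS hle] := qn_seq_compr hp (of_real_gt0 d0) TF' bTF Sf.
apply: le_lt_trans (qn_norm_le hS) _; apply: le_lt_trans hle _.
rewrite LE scalar_re_of_real -EFinM lte_fin -mulrA gtr_pMr//.
by rewrite ltr_pdivrMl// mulr1 ltrDl.
Qed.

(** Weights of mass d <= 1 dominating T - F for the exponent 2 also dominate it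
    for p, and bound its ideal norm by d^(1/p). *)
Lemma qn2_fr_closure (T : X -> X) : 2 <= p -> weighted_qn 2 T -> QN p T ->
  fr_closure (QN_ideal hp X) T.
Proof.
move=> p2 wT QT; split=> // e e0.
pose d := Num.min 1 ((e / 2) `^ p).
have e2 : 0 < e / 2 by rewrite divr_gt0.
have d0 : 0 < d by rewrite lt_min ltr01 powR_gt0.
have d1 : d <= 1 by rewrite ge_min lexx.
have de : d `^ p^-1 < e.
  apply: (@le_lt_trans _ _ (e / 2)); last by rewrite ltr_pdivrMr// ltr_pMr// ltr1n.
  have -> : e / 2 = ((e / 2) `^ p) `^ p^-1 by rewrite -powRrM divff ?gt_eqF// powRr1// ltW.
  apply: ge0_ler_powR; rewrite ?nnegrE ?invr_ge0 ?powR_ge0 ?(ltW p0) ?(ltW d0)//.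
  by rewrite ge_min lexx orbT.
have [F fF [b [u [b0 bd uu dT]]]] := weighted_qn2_approx d0 wT.
exists F; split=> //.
have dT' : qn_dominated p b u 1 (T - F).
  move=> x; apply: (le_trans (qn_dominated_le (ltr0n _ 2) p2 b0 bd uu ler01 dT x)).
  rewrite powR1 mul1r; apply: lee_wpmul2r.
    by apply: nsum_ge0 => j; rewrite mulr_ge0 ?powR_ge0.
  rewrite lee_fin; apply: (@le_trans _ _ (1 `^ (p / 2 - 1))); last by rewrite powR1.
  apply: ge0_ler_powR; rewrite ?nnegrE ?(ltW d0)//.
  by rewrite subr_ge0 ler_pdivlMr// mul1r.
have [f Tf fle] := weighted_qn_norm hp b0 bd uu dT'.
by apply: le_lt_trans (qn_norm_le Tf) _; apply: le_lt_trans fle _; rewrite lte_fin.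
Qed.

End qn_index.

Section sk_index.
Context {R : realType} {k : scalar_kind}.
Local Notation K := (scalar_field R k).
Variables (p : R) (hp : 1 <= p) (X : normedModType K).
Let p0 : 0 < p. Proof. exact: lt_le_trans hp. Qed.

(** By Cauchy and Schwarz, sum_j b_j |xi_j| is small when sum_j b_j is. *)
Lemma weighted_sk2_op_approximable (T : X -> X) : weighted_sk 2 T -> op_approximable T.
Proof.
move=> wT e e0; have [bT _] := wT.
have [C C0 aT] := weighted_sk2_approx wT.
have C1 : 0 < C + 1 by rewrite ltr_wpDl.
pose th := e / (C + 1); have th0 : 0 < th by rewrite divr_gt0.
have th2 : 0 < 2 * th by apply: mulr_gt0 th0.
have [F fF [b [y [b0 bd uy dT]]]] := aT (e * th) (mulr_gt0 e0 th0).
have bTF : bounded_op (T - F) by apply: bounded_opB => //; case: fF.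
exists F => //; apply: (unit_ball_bound bTF) => x x1.
have [xi xiC /cvg_rnormP xiT] := dT x x1.
apply/ler_addgt0Pr => d d0; have [n /(_ n (leqnn n)) nP] := xiT d d0.
rewrite -[X in rnorm X](subrK (combination b y xi n)) addrC.
apply: (le_trans (rnormD _ _)); apply: lerD => //.
apply: (le_trans (rnorm_combination xi n b0 uy)).
rewrite nsum_sqterm in xiC.
have h1 := (nsum_leP _ b0).1 bd n; have h2 := (nsum_leP _ (sqterm_ge0 b0 xi)).1 xiC n.
apply: (@le_trans _ _ (\sum_(j < n) (b j * (2 * th)^-1 + sqterm b xi j * (th / 2)))).
  apply: ler_sum => j _; rewrite /sqterm -mulrA -mulrDr ler_wpM2l//.
  set z := rnorm _; rewrite invfM -(ler_pM2l th2).
  rewrite (_ : 2 * th * (2^-1 * th^-1 + z ^+ 2 * (th / 2)) = 1 + (th * z) ^+ 2).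
    by have := sqr_ge0 (1 - th * z); rewrite !expr2; lra.
  by field; rewrite gt_eqF.
rewrite big_split/= -!mulr_suml.
apply: (@le_trans _ _ (e * th * (2 * th)^-1 + C * (th / 2))).
  apply: lerD; apply: ler_wpM2r => //; first by rewrite invr_ge0 (ltW th2).
  by apply: divr_ge0 => //; exact: ltW.
have -> : e * th * (2 * th)^-1 = e / 2 by field; rewrite gt_eqF.
have e1 : th * (C + 1) = e by rewrite /th divfK// gt_eqF.
by move: e1 th0; set t := th => e1 th0; nra.
Qed.

Lemma sk_comp_approximable (S T : X -> X) : SK p S -> bounded_op T ->
  op_approximable T -> SK p (S \o T) -> fr_closure (SK_ideal hp X) (S \o T).
Proof.
move=> [bS [f Sf]] bT aT QST; split=> // e e0.
have [L L0 LE] : exists2 L : R, 0 <= L & lp_norm p (fun n => (rnorm (f n))%:E) = L%:E.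
  case: Sf => foo _; exists (fine (lp_norm p (fun n => (rnorm (f n))%:E))).
    by rewrite fine_ge0// lp_norm_ge0.
  by rewrite fineK// ge0_fin_numE// lp_norm_ge0.
have L1 : 0 < L + 1 by rewrite ltr_wpDl.
have d0 : 0 < e / (L + 1) by rewrite divr_gt0.
have [F fF TF] := aT _ d0; exists (S \o F); split; first exact: finite_rank_compl.
rewrite -op_compBr//.
have TF' x : rnorm ((T - F) x) <= scalar_re (of_real (e / (L + 1)) : K) * rnorm x.
  by rewrite scalar_re_of_real.
have [h hS hle] := sk_seq_compr hp (of_real_gt0 d0) TF' bS Sf.
apply: le_lt_trans (sk_norm_le hS) _; apply: le_lt_trans hle _.
rewrite LE scalar_re_of_real -EFinM lte_fin -mulrA gtr_pMr//.
by rewrite ltr_pdivrMl// mulr1 ltrDl.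
Qed.

Lemma sk2_fr_closure (T : X -> X) : 2 <= p -> weighted_sk 2 T -> SK p T ->
  fr_closure (SK_ideal hp X) T.
Proof.
move=> p2 wT QT; split=> // e e0.
have [C C0 aT] := weighted_sk2_approx wT.
have C1 : 0 < C + 1 by rewrite ltr_wpDl.
pose g := e / 2 / (C + 1); have g0 : 0 < g by rewrite !divr_gt0.
pose d := Num.min 1 (g `^ p).
have d0 : 0 < d by rewrite lt_min ltr01 powR_gt0.
have d1 : d <= 1 by rewrite ge_min lexx.
have de : (C + 1) * d `^ p^-1 < e.
  apply: (@le_lt_trans _ _ (e / 2)); last by rewrite ltr_pdivrMr// ltr_pMr// ltr1n.
  rewrite mulrC -ler_pdivlMr// -/g.
  have -> : g = (g `^ p) `^ p^-1 by rewrite -powRrM divff ?gt_eqF// powRr1// ltW.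
  apply: ge0_ler_powR; rewrite ?nnegrE ?invr_ge0 ?powR_ge0 ?(ltW p0) ?(ltW d0)//.
  by rewrite ge_min lexx orbT.
have [F fF [b [y [b0 bd uy dT]]]] := aT d d0.
exists F; split=> //.
have [f Tf fle] := weighted_sk_norm p2 b0 bd d1 C0 uy dT.
by apply: le_lt_trans (sk_norm_le Tf) _; apply: le_lt_trans fle _; rewrite lte_fin.
Qed.

End sk_index.

(** * The index *)

Section index_arithmetic.
Context {R : realType}.
Implicit Types p : R.

Lemma index_small p : 1 <= p -> p <= 2 -> maxn 2 `|Num.ceil (p / 2)| = 2%N.
Proof.
move=> p1 p2; apply/maxn_idPl.
have c1 : (Num.ceil (p / 2) <= 1) by rewrite ceil_le_int ler_pdivrMr// mul1r.
have c0 : 0 <= Num.ceil (p / 2).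
  by rewrite ltW// ceil_gt0 divr_gt0// (lt_le_trans ltr01).
by rewrite -lez_nat gez0_abs// (le_trans c1).
Qed.

Lemma index_exponent p : 2 < p ->
  Num.max 2 (p / (maxn 2 `|Num.ceil (p / 2)|)%:R) = 2.
Proof.
move=> p2; have p0 : 0 < p by rewrite (lt_trans _ p2).
apply: max_l; rewrite ler_pdivrMr ?ltr0n ?leq_max//.
rewrite mulrC -ler_pdivrMr//.
apply: (le_trans (ceil_ge _)); apply: (@le_trans _ _ (`|Num.ceil (p / 2)|%N%:R)).
  by rewrite -[leRHS]/((Posz _)%:~R) ler_int gez0_abs// ltW// ceil_gt0 divr_gt0.
by rewrite ler_nat leq_max leqnn orbT.
Qed.

End index_arithmetic.

Section main.
Context {R : realType} {k : scalar_kind} {X : normedModType (scalar_field R k)}.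
Variables (p : R) (hp : 1 <= p).
Let p0 : 0 < p. Proof. exact: lt_le_trans hp. Qed.

Lemma weighted_sk_conj_le (q r : R) (T : X -> X) : 1 < q -> q <= r ->
  weighted_sk (conj_exp q) T -> weighted_sk (conj_exp r) T.
Proof.
move=> q1 qr; have r1 : 1 < r by exact: lt_le_trans qr.
have cq := conj_exp_gt1 q1; have cr := conj_exp_gt1 r1.
apply: weighted_sk_le; first by rewrite ltW// (lt_trans ltr01).
rewrite -lef_pV2 ?posrE ?(lt_trans ltr01)// !conj_expV// lerD2l lerN2.
by rewrite lef_pV2 ?posrE ?(lt_trans ltr01).
Qed.

Lemma SK_weighted2 (T : X -> X) : p <= 2 -> SK p T -> weighted_sk 2 T.
Proof.
move=> p2 sT; have [p1|p1] := eqVneq p 1; first by apply: SK1_weighted; rewrite -p1.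
have p1' : 1 < p by rewrite lt_neqAle eq_sym p1.
by rewrite -conj_exp2; apply: (weighted_sk_conj_le p1' p2); exact: SK_weighted.
Qed.

Lemma QN_products_vanish :
  products_vanish (quotient_algebra (QN_ideal hp X)) (maxn 2 `|Num.ceil (p / 2)|).
Proof.
apply: products_vanishP => [|T s]; first by rewrite leq_max.
have elt (S : ideal_elt (QN_ideal hp X)) : QN p S := elt_opP S.
have [p2|p2] := leP p 2.
  rewrite index_small//= => /eqP; case: s => [|S [|]]//= _.
  apply: (qn_comp_approximable hp (elt T) (elt S).1 _ (elt (elt_comp T S))).
  apply: weighted_qn2_op_approximable; apply: (weighted_qn_le p0 p2).
  exact: QN_weighted.
move=> sn; have n0 : (0 < maxn 2 `|Num.ceil (p / 2)|)%N by rewrite leq_max.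
apply: (qn2_fr_closure hp (ltW p2) _ (elt _)).
rewrite -(index_exponent p2) -(prednK n0) -sn.
apply: (@product_exponent R k X (QN_ideal hp X) (@weighted_qn R k X X) p p2).
- by move=> S; exact: QN_weighted.
- by move=> q r S q2 qr; apply: weighted_qn_le => //; exact: lt_le_trans q2.
move=> q r S S' q2 r2 rE wS' wS; apply: (weighted_qn_comp _ _ _ rE wS' wS).
- by apply: lt_trans p2; rewrite ltr1n.
- by apply: lt_le_trans r2; rewrite ltr1n.
- exact: lt_le_trans q2.
Qed.

Lemma SK_products_vanish :
  products_vanish (quotient_algebra (SK_ideal hp X)) (maxn 2 `|Num.ceil (p / 2)|).
Proof.
apply: products_vanishP => [|T s]; first by rewrite leq_max.
have elt (S : ideal_elt (SK_ideal hp X)) : SK p S := elt_opP S.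
have [p2|p2] := leP p 2.
  rewrite index_small//= => /eqP; case: s => [|S [|]]//= _.
  apply: (sk_comp_approximable hp (elt T) (elt S).1 _ (elt (elt_comp T S))).
  by apply: weighted_sk2_op_approximable; exact: SK_weighted2.
move=> sn; have n0 : (0 < maxn 2 `|Num.ceil (p / 2)|)%N by rewrite leq_max.
apply: (sk2_fr_closure hp (ltW p2) _ (elt _)).
rewrite -[X in weighted_sk X _]conj_exp2 -[X in weighted_sk (conj_exp X) _](index_exponent p2) -(prednK n0) -sn.
have p1 : 1 < p by apply: lt_trans p2; rewrite ltr1n.
have gt1 (q : R) : 2 <= q -> 1 < q by apply: lt_le_trans; rewrite ltr1n.
apply: (@product_exponent R k X (SK_ideal hp X) (fun q => @weighted_sk R k X X (conj_exp q)) p p2).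
- by move=> S; exact: SK_weighted.
- by move=> q r S q2 qr; apply: weighted_sk_conj_le => //; exact: gt1.
move=> q r S S' q2 r2 rE; have q1 := gt1 q q2; have r1 := gt1 r r2.
apply: weighted_sk_comp; [exact: conj_exp_gt1..|].
by rewrite !conj_expV// rE; ring.
Qed.

End main.

Theorem proposition4p1 (R : realType) (k : scalar_kind) (p : R) (hp : 1 <= p)
    (X : completeNormedModType (scalar_field R k)) :
  (exists h : nilpotent (quotient_algebra (QN_ideal hp X)),
     (nil_index h <= maxn 2 `|Num.ceil (p / 2)|)%N) /\
  (exists h : nilpotent (quotient_algebra (SK_ideal hp X)),
     (nil_index h <= maxn 2 `|Num.ceil (p / 2)|)%N).
Proof.
split; apply: nil_index_le; [exact: QN_products_vanish|exact: SK_products_vanish].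
Qed.
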